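(* Fix an integer $d\ge 2$ and an open interval $I$ containing $[-2,2]$. Let $p=p(n)\in[0,1]$ and $q=p(1-p)$. If $\lim_{n\to\infty}\frac{nq}{\log^4 n}=\infty$, then, almost surely, the $\binom{n-1}{d}$ smallest eigenvalues of the adjacency operator $A$ of $X(d,n,p)$ lie in $\sqrt{dnq}\,I$ for all but finitely many values of $n$.
   Context: Cells. Let $V$ be a vertex set with $|V|=n\ge d+1$. A simplicial complex on $V$ is a collection of subsets of $V$ (called cells) closed under taking subsets; a $j$-cell is a cell with $j+1$ elements. For a complex $X$, $X^j$ is the set of its $j$-cells. For $j\ge 1$ each $j$-cell has two orientations, corresponding to the orderings of its vertices modulo even permutations; $[\sigma^0,\dots,\sigma^j]$ denotes an oriented cell, $\overline{\sigma}$ (also written $(-1)\sigma$) is $\sigma$ with the opposite orientation, and $X^j_\pm$ is the set of oriented $j$-cells. An oriented cell $[\sigma^0,\dots,\sigma^{j+1}]$ induces on the $j$-cell of its boundary obtained by deleting $\sigma^i$ the orientation $(-1)^i[\sigma^0,\dots,\sigma^{i-1},\sigma^{i+1},\dots,\sigma^{j+1}]$. Model. For $p=p(n)\in[0,1]$, the Linial–Meshulam complex $X=X(d,n,p)$ is the random $d$-dimensional complex on $V$ that contains all subsets of $V$ of size at most $d$ (complete $(d-1)$-skeleton) and in which each $(d+1)$-element subset of $V$ is included as a $d$-cell independently with probability $p$. Set $q:=p(1-p)$. Coupling. All complexes $X(d,n,p)$, $n\in\mathbb{N}$, are defined on one probability space in the standard fashion: $V=\{1,\dots,n\}$, there is a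 family of independent Bernoulli variables $\chi_\tau$ with parameter $p$ indexed by all $(d+1)$-element subsets $\tau$ of $\{1,2,3,\dots\}$, and $\tau\subset\{1,\dots,n\}$ is a $d$-cell of $X(d,n,p)$ if and only if $\chi_\tau=1$. When $p=p(n)$ depends on $n$, take $\chi_\tau=\chi_\tau^{(n)}=\mathbf 1\{U_\tau\le p(n)\}$ with $(U_\tau)_\tau$ i.i.d. uniform on $[0,1]$. Adjacency operator. $\Omega^{d-1}$ is the real vector space of functions $f:X^{d-1}_\pm\to\mathbb{R}$ with $f(\overline{\sigma})=-f(\sigma)$, with inner product $\langle f,g\rangle=\sum_{\sigma\in X^{d-1}}f(\sigma)g(\sigma)$; its dimension is $N=\binom nd=\binom{n-1}{d}+\binom{n-1}{d-1}$. For $\sigma,\sigma'\in X^{d-1}_\pm$ write $\sigma'\sim\sigma$ if there is an oriented $d$-cell $\tau\in X^d_\pm$ such that both $\sigma$ and $\overline{\sigma'}$ are in the boundary of $\tau$ with the induced orientations. The adjacency operator $A$ is the self-adjoint operator $Af(\sigma)=\sum_{\sigma'\sim\sigma}f(\sigma')$ on $\Omega^{d-1}$. Eigenvalues are counted with multiplicity. *)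

(* Defs.v *)
From HB Require Import structures.
From mathcomp Require Import all_boot all_order all_algebra fingroup perm finmap.
From mathcomp Require Import all_classical all_reals all_analysis.
Set Implicit Arguments.
Unset Strict Implicit.
Unset Printing Implicit Defensive.
Import Order.TTheory GRing.Theory Num.Theory.
Import numFieldNormedType.Exports.

Local Open Scope ring_scope.

(* Oriented cells.  An ordering of a cell with k vertices is a duplicate-free
   k-tuple; an orientation is the set of all orderings that differ from a given
   one by an even permutation.  A complex is given by its set of cells. *)
Section OrientedCells.
Local Open Scope set_scope.
Variable T : finType.

Definition reorder k (s : k.-tuple T) (g : 'S_k) : k.-tuple T :=
  [tuple tnth s (g i) | i < k].

Definition orient k (s : k.-tuple T) : {set k.-tuple T} :=
  [set reorder s g | g : 'S_k & ~~ odd_perm g].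

Definition orient_opp k (c : {set k.-tuple T}) : {set k.-tuple T} :=
  [set reorder s g | s in c, g in [set h : 'S_k | odd_perm h]].

Definition oriented_cells (X : {set {set T}}) k : {set {set k.-tuple T}} :=
  [set orient s | s : k.-tuple T & uniq s && ([set x in s] \in X)].

Definition del k (s : k.+1.-tuple T) (i : 'I_k.+1) : k.-tuple T :=
  [tuple tnth s (lift i j) | j < k].

Definition oriented_boundary k (c : {set k.+1.-tuple T}) :
    {set {set k.-tuple T}} :=
  [set (if odd i then orient_opp (orient (del s i)) else orient (del s i))
     | s : k.+1.-tuple T in c, i : 'I_k.+1].

(* ocell X k is the type of oriented cells of X with k vertices, that is of
   dimension k.-1. *)
Definition ocell X k := {c : {set k.-tuple T} | c \in oriented_cells X k}.

(* The default value of insubd is only reached for k <= 1, where a cell has no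
   second ordering; see val_ocell_opp. *)
Definition ocell_opp X k (c : ocell X k) : ocell X k :=
  insubd c (orient_opp (val c)).

(* The two faces c and -c' of t are required to be distinct.  The degenerate
   case -c' = c would make -c a neighbour of c, and put a diagonal into the
   adjacency operator. *)
Definition ocell_adj X k (c c' : ocell X k) : bool :=
  [exists t : ocell X k.+1,
    [&& val c \in oriented_boundary (val t),
        val (ocell_opp c') \in oriented_boundary (val t)
      & c != ocell_opp c']].

Lemma reorderM k (s : k.-tuple T) (g h : 'S_k) :
  reorder (reorder s g) h = reorder s (h * g)%g.
Proof. by apply: eq_from_tnth => i; rewrite !tnth_mktuple permM. Qed.

Lemma reorder_uniq k (s : k.-tuple T) (g : 'S_k) :
  uniq s -> uniq (reorder s g).
Proof.
move=> /tuple_uniqP s_inj; apply/tuple_uniqP => i j.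
by rewrite !tnth_mktuple => /s_inj /perm_inj.
Qed.

Lemma reorder_mem k (s : k.-tuple T) (g : 'S_k) : reorder s g =i s.
Proof.
move=> x; apply/tnthP/tnthP => -[i ->].
  by exists (g i); rewrite tnth_mktuple.
by exists ((g^-1)%g i); rewrite tnth_mktuple permKV.
Qed.

Lemma orient_oppE k (s : k.-tuple T) (g : 'S_k) :
  odd_perm g -> orient_opp (orient s) = orient (reorder s g).
Proof.
move=> g_odd; apply/setP => t; apply/imset2P/imsetP.
  case=> _ h /imsetP[h1 h1_even ->]; rewrite !inE in h1_even * => h_odd ->.
  exists (h * h1 * g^-1)%g; last by rewrite !reorderM mulgKV.
  by rewrite inE !odd_permM odd_permV g_odd h_odd (negbTE h1_even).
case=> h; rewrite inE => h_even ->.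
exists s (h * g)%g; last by rewrite reorderM.
  apply/imsetP; exists 1%g; first by rewrite inE odd_perm1.
  by apply: eq_from_tnth => i; rewrite tnth_mktuple perm1.
by rewrite inE odd_permM g_odd (negbTE h_even).
Qed.

Lemma val_ocell_opp X k (c : ocell X k) :
  (1 < k)%N -> val (ocell_opp c) = orient_opp (val c).
Proof.
case: k c => [|[|k]] // c _; rewrite val_insubd ifT//.
case: c => /= _ /imsetP[s + ->]; rewrite inE => /andP[s_uniq s_X].
pose g : 'S_k.+2 := tperm ord0 ord_max.
have g_odd : odd_perm g by rewrite odd_tperm.
rewrite (orient_oppE _ g_odd); apply/imsetP; exists (reorder s g) => //.
rewrite inE reorder_uniq//=; congr (_ \in X): s_X.
by apply/setP => x; rewrite !inE reorder_mem.
Qed.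

End OrientedCells.

Section Adjacency.
Variables (R : realType) (T : finType) (X : {set {set T}}) (k : nat).
Local Notation cochain := {ffun ocell X k -> R}.

Definition symmetrize (f : cochain) : cochain :=
  [ffun c => f (ocell_opp c) + f c].

Fact symmetrize_is_linear : linear symmetrize.
Proof.
by move=> a f g; apply/ffunP => c; rewrite !ffunE scalerDr addrACA.
Qed.
HB.instance Definition _ :=
  GRing.isLinear.Build R cochain cochain _ symmetrize symmetrize_is_linear.

Definition forms : {vspace cochain} := lker (linfun symmetrize).

Lemma formsP (f : cochain) :
  reflect (forall c, f (ocell_opp c) = - f c) (f \in forms).
Proof.
rewrite memv_ker lfunE; apply: (iffP eqP) => [/ffunP f0 c|f0].
  by apply/eqP; rewrite -addr_eq0; have := f0 c; rewrite !ffunE => ->.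
by apply/ffunP => c; rewrite !ffunE f0 addNr.
Qed.

Definition adjacency_fun (f : cochain) : cochain :=
  [ffun c => \sum_(c' | ocell_adj c c') f c'].

Fact adjacency_is_linear : linear adjacency_fun.
Proof.
move=> a f g; apply/ffunP => c; rewrite !ffunE scaler_sumr -big_split/=.
by apply: eq_bigr => c' _; rewrite !ffunE.
Qed.
HB.instance Definition _ :=
  GRing.isLinear.Build R cochain cochain _ adjacency_fun adjacency_is_linear.

Definition adjacency : 'End(cochain) := linfun adjacency_fun.

End Adjacency.

(* s lists, in nondecreasing order and with multiplicity, the eigenvalues of
   the restriction of A to its invariant subspace W.  The size condition says
   that the eigenspaces in W exhaust W, as they do for a self-adjoint
   operator. *)
Definition sorted_spectrum (R : realType) (V : vectType R) (A : 'End(V))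
    (W : {vspace V}) (s : seq R) : Prop :=
  [/\ sorted (fun x y : R => x <= y) s, size s = \dim W
    & forall a, count_mem a s = \dim (W :&: passmx.leigenspace A a)%VS].

(* The vertices 1, ..., n are represented by the elements of 'I_n. *)
Definition vertex_labels n (tau : {set 'I_n}) : {fset nat} :=
  [fset (nat_of_ord x).+1 | x in tau]%fset.

(* The Linial-Meshulam complex in which the d-cells are determined by the
   values u of the uniform variables and the threshold p. *)
Definition LM_complex (R : realType) (d n : nat) (p : R) (u : {fset nat} -> R) :
    {set {set 'I_n}} :=
  [set tau : {set 'I_n} | (#|tau| <= d)%N
     || (#|tau| == d.+1) && (u (vertex_labels tau) <= p)]%SET.

Definition mutually_independent (disp : measure_display)
    (Om : measurableType disp) (R : realType) (P : probability Om R)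
    (J : choiceType) (D : set J) (Y : J -> {RV P >-> R}) : Prop :=
  forall (F : {fset J}) (B : J -> set R),
    ([set` F] `<=` D)%classic -> (forall j, measurable (B j)) ->
    P (\bigcap_(j in [set` F]) (Y j @^-1` B j))%classic
      = (\prod_(j <- F) P (Y j @^-1` B j)%classic)%E.

(* Main.v *)
Require Import Defs.
From HB Require Import structures.
From mathcomp Require Import all_boot all_order all_algebra all_fingroup finmap.
From mathcomp Require Import all_classical all_reals all_analysis.
From mathcomp Require Import ring lra zify.
From mathcomp Require spectral complex.
Import (canonicals) complex.
Set Implicit Arguments.
Unset Strict Implicit.
Unset Printing Implicit Defensive.
Import Order.TTheory GRing.Theory Num.Theory.
Import numFieldNormedType.Exports.
Local Open Scope ring_scope.

(** Give every facet (vertex set of a (d-1)-cell) the orientation of its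
    increasing enumeration. The forms become vectors indexed by the facets, and
    the adjacency operator becomes the symmetric matrix sum_t chi_t A_t over the
    (d+1)-sets t, where chi_t indicates the cells that are present and A_t has
    the entries - b_i b_j, for b the row of the incidence coefficients of t, off
    the diagonal. Write this matrix as p A + H, with A = sum_t A_t the adjacency
    matrix of the complete complex and H centered.

    The deterministic part is due to A. The matrix A + d is the lower Laplacian
    F F^T of the complete complex, so that A >= -d. Since the squared boundary
    operator vanishes, every row b is an eigenvector of A for -d, and the rows
    of the C(n-1,d) cells t through a fixed vertex are independent. If the
    quadratic form of H is at most h in absolute value, then all eigenvalues are
    at least -pd-h, and by Courant-Fischer the C(n-1,d) smallest ones are at most
    -pd+h. This is applied with h = (2+e) sqrt(dnq), which is much larger than
    pd. What remains is that H violates the bound with summable probability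
    (Borel-Cantelli does the rest). By Markov's inequality this follows from a
    bound for E Tr H^K with K of order log n.

    This moment is not found by counting closed walks but by two comparisons.
    Their errors are small because the A_t are supported on blocks of d+1 facets,
    any two of which share at most one facet.

    - Universality (trace_moment_universality). The centered indicators are
      replaced by random signs times sqrt q. Along the segment that joins the two
      laws the derivative of the trace moment only sees third moments, so that
      the logarithm of the moment changes by O(K^3 / sqrt(nq)). This is o(log n)
      exactly because nq / log^4 n tends to infinity.
    - Random signs (sign_moment_le). Let Y be the matrix with random signs.
      Integration by parts in one sign turns E Tr Y^(j+1) into the sum over
      t and u of E Tr A_t Y^u A_t Y^(j-1-u), up to an error (moment_step). Here
      the two powers may be taken from independent copies of Y (decoupling):
      correlating the copies gradually produces two pairs of block matrices that
      cross, and crossing makes a term smaller by a power of n (cross_trace_le).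
      Then only the mean powers E Y^u matter. They are invariant under the
      permutations of the vertices, up to signs, which leaves one diagonal value
      and one off-diagonal value, and the latter contributes little (main_term_le).
      Hence, for N facets, the moments
      x_c = E Tr Y^(2c) / (N lam^(2c)) obey
      x_(i+1) <= s (x_0 x_i + ... + x_i x_0) + small error, s = dn / lam^2. This is
      the recursion of the Catalan numbers. If s < 1/4 then its solution stays
      below 1, while x_k = 1 when lam is the K-th root of the normalized moment.
      So lam is at most about 2 sqrt(dn). *)

(** * Real inequalities and powers of symmetric matrices *)

Lemma le_of_eq (R : numDomainType) (x y : R) : x = y -> x <= y.
Proof. by move=> ->. Qed.

Section RealInequalities.
Variable R : rcfType.

(** Lagrange's identity: twice the difference of the two sides is a weighted sum
    of the squares of a i * b j - a j * b i. *)
Lemma weighted_Cauchy_Schwarz (I : finType) (w a b : I -> R) :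
  (forall i, 0 <= w i) ->
  (\sum_i w i * (a i * b i)) ^+ 2
    <= (\sum_i w i * a i ^+ 2) * (\sum_i w i * b i ^+ 2).
Proof.
move=> w0; rewrite -subr_ge0.
have dbl : ((\sum_i w i * a i ^+ 2) * (\sum_i w i * b i ^+ 2)
   - (\sum_i w i * (a i * b i)) ^+ 2) *+ 2
   = \sum_i \sum_j w i * w j * (a i * b j - a j * b i) ^+ 2.
  set A := \sum_i w i * a i ^+ 2; set B := \sum_i w i * b i ^+ 2.
  set C := \sum_i w i * (a i * b i).
  have -> : (A * B - C ^+ 2) *+ 2 = A * B + B * A - C * C - C * C by ring.
  rewrite !big_distrlr /= -!big_split/= -!sumrB; apply: eq_bigr => i _.
  by rewrite -!big_split/= -!sumrB; apply: eq_bigr => j _; ring.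
rewrite -(pmulrn_lge0 _ (ltn0Sn 1)) dbl.
apply: sumr_ge0 => i _; apply: sumr_ge0 => j _.
by apply: mulr_ge0; [apply: mulr_ge0|exact: sqr_ge0].
Qed.

Lemma Cauchy_Schwarz (I : finType) (a b : I -> R) :
  (\sum_i a i * b i) ^+ 2 <= (\sum_i a i ^+ 2) * (\sum_i b i ^+ 2).
Proof.
have := @weighted_Cauchy_Schwarz I (fun=> 1) a b (fun=> ler01).
have one (f : I -> R) : \sum_i 1 * f i = \sum_i f i.
  by apply: eq_bigr => i _; rewrite mul1r.
by rewrite !one.
Qed.

Lemma nonneg_root_exists k (c : R) : (0 < k)%N -> 0 <= c ->
  exists2 r, 0 <= r & r ^+ k = c.
Proof.
move=> k0 c0; have c1 : 0 <= 1 + c by lra.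
have [|r /andP[r0 _] /rootP] := @poly_ivt R ('X^k - c%:P) 0 (1 + c) c1.
  rewrite !hornerE expr0n; case: k k0 => // k _ /=.
  rewrite sub0r oppr_le0 c0 subr_ge0 /=.
  have : 1 + c <= (1 + c) ^+ k.+1 by rewrite ler_eXnr //; lra.
  lra.
by rewrite !hornerE => /eqP; rewrite subr_eq0 => /eqP rk; exists r.
Qed.

(** The ratios of consecutive terms are nondecreasing. If the bound fails at some
    u, then one ratio exceeds r, hence so do all later ones, and the bound fails
    at k as well. *)
Lemma logconvex_le (c : nat -> R) k (r : R) :
  0 <= r -> (forall u, (u <= k)%N -> 0 <= c u) -> c 0%N <= 1 ->
  (forall u, (u.+1 < k)%N -> c u.+1 ^+ 2 <= c u * c u.+2) ->
  c k <= r ^+ k -> forall u, (u <= k)%N -> c u <= r ^+ u.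
Proof.
move=> r0 c0 c01 cc ck.
have grow u : (u < k)%N -> c u <= r ^+ u -> r ^+ u.+1 < c u.+1 -> False.
  move=> uk cu cu1.
  suff H v : (u + v < k)%N -> r ^+ (u + v).+1 < c (u + v).+1 /\
      r * c (u + v)%N < c (u + v).+1.
    have := H (k - u).-1; have -> : (u + (k - u).-1)%N = k.-1 by lia.
    have -> : k.-1.+1 = k by lia.
    by case=> [|+ _]; [lia|rewrite ltNge ck].
  elim: v => [|v IH] uvk.
    rewrite addn0; split=> //; apply: le_lt_trans cu1.
    by rewrite exprS ler_wpM2l.
  rewrite addnS in uvk *.
  have [|h1 h2] := IH; first lia.
  have c1 : 0 <= c (u + v)%N by apply: c0; lia.
  have cpos : 0 < c (u + v).+1 by apply: le_lt_trans h2; rewrite mulr_ge0.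
  have := cc _ uvk => h3.
  have h4 : r * c (u + v).+1 < c (u + v).+2.
    move: h3 h2 cpos c1 (c0 _ uvk).
    move: (c (u + v)%N) (c (u + v).+1) (c (u + v).+2) => x y z h3 h2 y0 x0 z0.
    rewrite ltNge; apply/negP => zle.
    have : x * z <= x * (r * y) by rewrite ler_wpM2l.
    have : (r * x) * y < y * y by rewrite ltr_pM2r.
    nra.
  split=> //; apply: le_lt_trans h4.
  by rewrite exprS ler_wpM2l // ltW.
elim=> [|u IH] uk; first by rewrite expr0.
rewrite leNgt; apply/negP => h; apply: (grow u uk _ h).
by apply: IH; lia.
Qed.

End RealInequalities.

Section SymmetricPowers.
Variables (R : rcfType) (N : nat).
Implicit Types (Y : 'M[R]_N) (i j : 'I_N).

Lemma mxpowD Y u v i j :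
  (Y ^+ (u + v)) i j = \sum_l (Y ^+ u) i l * (Y ^+ v) l j.
Proof. by rewrite exprD mxE. Qed.

Lemma trmx_pow Y u : (Y ^+ u)^T = Y^T ^+ u.
Proof.
elim: u => [|u IH]; first by rewrite !expr0 trmx1.
by rewrite exprS trmx_mul IH [RHS]exprSr.
Qed.

Lemma sym_pow Y u i j : Y^T = Y -> (Y ^+ u) i j = (Y ^+ u) j i.
Proof. by move=> Ysym; rewrite -[in RHS]Ysym -trmx_pow mxE. Qed.

Lemma sqr_row_pow Y u i : Y^T = Y ->
  \sum_l (Y ^+ u) i l ^+ 2 = (Y ^+ u.*2) i i.
Proof.
move=> Ysym; rewrite -addnn mxpowD; apply: eq_bigr => l _.
by rewrite expr2 [in X in _ * X](sym_pow _ _ _ Ysym).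
Qed.

Lemma diag_pow_ge0 Y u i : Y^T = Y -> 0 <= (Y ^+ u.*2) i i.
Proof.
by move=> Ysym; rewrite -sqr_row_pow //; apply: sumr_ge0 => l _; exact: sqr_ge0.
Qed.

Lemma entry_pow_CS Y u v i j : Y^T = Y ->
  (Y ^+ (u + v)) i j ^+ 2 <= (Y ^+ u.*2) i i * (Y ^+ v.*2) j j.
Proof.
move=> Ysym; rewrite mxpowD -!sqr_row_pow //.
under [X in _ <= _ * X]eq_bigr do rewrite (sym_pow _ _ _ Ysym).
exact: Cauchy_Schwarz.
Qed.

(** Jensen's inequality for the spectral measure of a basis vector, obtained
    from the log-convexity of its even moments. *)
Lemma diag_pow_le Y k (r : R) i : Y^T = Y -> 0 <= r ->
  (Y ^+ k.*2) i i <= r ^+ k.*2 ->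
  forall u, (u <= k)%N -> (Y ^+ u.*2) i i <= r ^+ u.*2.
Proof.
move=> Ysym r0 Yr u uk; have -> : r ^+ u.*2 = (r ^+ 2) ^+ u by rewrite -exprM mul2n.
apply: (@logconvex_le R (fun u => (Y ^+ u.*2) i i) k) => //.
- exact: exprn_ge0.
- by move=> v _; exact: diag_pow_ge0.
- by rewrite mxE eqxx.
- move=> v _; have := @entry_pow_CS Y v v.+2 i i Ysym.
  by have -> : (v + v.+2 = v.+1.*2)%N by lia.
- by rewrite -exprM mul2n.
Qed.

(** Cauchy-Schwarz splits the factors evenly between the two ends. *)
Lemma entry_pow_le Y k (r : R) i j : Y^T = Y -> 0 <= r ->
  (Y ^+ k.*2) i i <= r ^+ k.*2 -> (Y ^+ k.*2) j j <= r ^+ k.*2 ->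
  forall q, (q <= k.*2)%N -> `|(Y ^+ q) i j| <= r ^+ q.
Proof.
move=> Ysym r0 Yi Yj q qk.
have -> : q = (q./2 + uphalf q)%N by rewrite addnC uphalf_half -addnA addnn odd_double_half.
rewrite -(ler_pXn2r (isT : (0 < 2)%N)) ?nnegrE ?normr_ge0 ?exprn_ge0//.
rewrite -normrX ger0_norm ?sqr_ge0//.
apply: le_trans (entry_pow_CS _ _ _ _ Ysym) _.
rewrite -exprM muln2 doubleD exprD.
apply: ler_pM; rewrite ?diag_pow_ge0//.
- by apply: (diag_pow_le Ysym r0 Yi); rewrite leq_half_double (leq_trans qk).
- by apply: (diag_pow_le Ysym r0 Yj); rewrite leq_uphalf_double.
Qed.

(** The squared norm of a row of a power is a diagonal entry of the doubled power,
    which is covered by the assumption for exponents up to k. *)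
Lemma row_pow_le Y k (r : R) i : Y^T = Y -> 0 <= r ->
  (Y ^+ k.*2) i i <= r ^+ k.*2 ->
  forall q, (q <= k)%N -> \sum_l (Y ^+ q) i l ^+ 2 <= (r ^+ q) ^+ 2.
Proof.
move=> Ysym r0 Yi q qk; rewrite sqr_row_pow // -exprM muln2.
exact: diag_pow_le Yi _ qk.
Qed.

End SymmetricPowers.

(** * Expectations over independent coordinates *)

Lemma sum_bool_pair (R : nmodType) (F : bool * bool -> R) :
  \sum_v F v = F (true, true) + F (true, false) + (F (false, true) + F (false, false)).
Proof.
rewrite (eq_bigr (fun v => F (v.1, v.2))); last by case.
by rewrite -(pair_bigA _ (fun x y => F (x, y))) /= !big_bool /=.
Qed.

Section Expectation.
Variables (R : realFieldType) (J : finType).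

(** Expectation of F for independent coordinates of law mu, where mu may take any
    values. *)
Definition expect (V : finType) (mu : V -> R) (F : {ffun J -> V} -> R) : R :=
  \sum_(w : {ffun J -> V}) (\prod_j mu (w j)) * F w.

Definition upd (V : Type) (w : {ffun J -> V}) (j : J) (v : V) : {ffun J -> V} :=
  [ffun i => if i == j then v else w i].

Lemma upd_eq (V : Type) (w : {ffun J -> V}) j v : upd w j v j = v.
Proof. by rewrite ffunE eqxx. Qed.

Lemma upd_neq (V : Type) (w : {ffun J -> V}) j v i : i != j -> upd w j v i = w i.
Proof. by move=> ij; rewrite ffunE (negbTE ij). Qed.

Lemma upd_upd (V : Type) (w : {ffun J -> V}) j v v' :
  upd (upd w j v) j v' = upd w j v'.
Proof. by apply/ffunP => i; rewrite !ffunE; case: eqP. Qed.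

Lemma upd_id (V : Type) (w : {ffun J -> V}) j : upd w j (w j) = w.
Proof. by apply/ffunP => i; rewrite !ffunE; case: eqP => // ->. Qed.

Section OneLaw.
Variables (V : finType) (mu : V -> R).
Hypothesis mu_ge0 : forall v, 0 <= mu v.
Hypothesis mu_sum : \sum_v mu v = 1.

Lemma weight_ge0 (w : {ffun J -> V}) : 0 <= \prod_j mu (w j).
Proof. by apply: prodr_ge0 => j _; exact: mu_ge0. Qed.

Lemma ler_expect F G : (forall w, F w <= G w) -> expect mu F <= expect mu G.
Proof.
by move=> FG; apply: ler_sum => w _; apply: ler_wpM2l; rewrite ?weight_ge0.
Qed.

Lemma expect_ge0 F : (forall w, 0 <= F w) -> 0 <= expect mu F.
Proof. by move=> F0; apply: sumr_ge0 => w _; rewrite mulr_ge0 ?weight_ge0. Qed.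

Lemma eq_expect F G : (forall w, F w = G w) -> expect mu F = expect mu G.
Proof. by move=> FG; apply: eq_bigr => w _; rewrite FG. Qed.

Lemma expect_cst c : expect mu (fun=> c) = c.
Proof.
rewrite /expect -mulr_suml -(bigA_distr_bigA (fun _ => mu)) /=.
by rewrite big1 ?mul1r // => j _; rewrite mu_sum.
Qed.

Lemma expectD F G : expect mu (fun w => F w + G w) = expect mu F + expect mu G.
Proof. by rewrite -big_split; apply: eq_bigr => w _; rewrite /= mulrDr. Qed.

Lemma expectZ c F : expect mu (fun w => c * F w) = c * expect mu F.
Proof. by rewrite mulr_sumr; apply: eq_bigr => w _; rewrite mulrCA. Qed.

Lemma expectN F : expect mu (fun w => - F w) = - expect mu F.
Proof. by rewrite -sumrN; apply: eq_bigr => w _; rewrite mulrN. Qed.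

Lemma expect_sum (I : Type) (r : seq I) (Q : pred I) (F : I -> {ffun J -> V} -> R) :
  expect mu (fun w => \sum_(i <- r | Q i) F i w)
  = \sum_(i <- r | Q i) expect mu (F i).
Proof.
by rewrite exchange_big /=; apply: eq_bigr => w _; rewrite mulr_sumr.
Qed.

Lemma ler_norm_expect F : `|expect mu F| <= expect mu (fun w => `|F w|).
Proof.
apply: le_trans (ler_norm_sum _ _ _) _; apply: ler_sum => w _.
by rewrite normrM (ger0_norm (weight_ge0 w)).
Qed.

(** One coordinate is given the weight g instead of mu: it may then
    be summed out separately. *)
Lemma expect_change_coord (g : V -> R) (j : J) F :
  \sum_(w : {ffun J -> V}) (g (w j) * \prod_(i | i != j) mu (w i)) * F w
  = expect mu (fun w => \sum_v g v * F (upd w j v)).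
Proof.
rewrite /expect; under [RHS]eq_bigr do rewrite mulr_sumr.
rewrite pair_bigA /=.
pose h (x : {ffun J -> V} * V) := (upd x.1 j x.2, x.1 j).
have hK : involutive h.
  by move=> [w v]; rewrite /h /= upd_upd upd_id upd_eq.
rewrite [RHS](reindex_inj (inv_inj hK)) /=.
rewrite -(pair_bigA _ (fun w v =>
  (\prod_i mu (upd w j v i)) * (g (w j) * F (upd (upd w j v) j (w j))))) /=.
apply: eq_bigr => w _; under [RHS]eq_bigr do rewrite upd_upd upd_id.
rewrite -mulr_suml mulrA; congr (_ * _).
have E v : \prod_i mu (upd w j v i) = mu v * \prod_(i | i != j) mu (w i).
  rewrite (bigD1 j) //= upd_eq; congr (_ * _).
  by apply: eq_bigr => i ij; rewrite upd_neq.
rewrite mulrC; congr (_ * _).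
rewrite (eq_bigr _ (fun v _ => E v)).
by rewrite -mulr_suml mu_sum mul1r.
Qed.

Lemma expect_perm (s : {perm J}) F :
  expect mu (fun w => F [ffun j => w (s j)]) = expect mu F.
Proof.
rewrite /expect [RHS](reindex_inj (h := fun w : {ffun J -> V} => [ffun j => w (s j)])).
  apply: eq_bigr => w _; congr (_ * _).
  rewrite (reindex_inj (@perm_inj _ s)).
  by apply: eq_bigr => j _; rewrite ffunE.
move=> w w' /ffunP E; apply/ffunP => j.
by have := E (s^-1%g j); rewrite !ffunE permKV.
Qed.

Lemma expect_map (V' : finType) (h : V -> V') F :
  expect mu (fun w => F [ffun j => h (w j)])
  = expect (fun v' => \sum_(v | h v == v') mu v) F.
Proof.
rewrite /expect.
under [RHS]eq_bigr => w' _.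
  rewrite (bigA_distr_big_dep (fun j v => h v == w' j)) mulr_suml.
over.
rewrite (exchange_big_dep xpredT) //=; apply: eq_bigr => w _.
rewrite (big_pred1 [ffun j => h (w j)]) // => w' /=.
apply/familyP/eqP => [E|-> j]; last by rewrite unfold_in ffunE.
by apply/ffunP => j; have := E j; rewrite unfold_in ffunE => /eqP.
Qed.

End OneLaw.

Lemma expect_prod (V1 V2 : finType) (m1 : V1 -> R) (m2 : V2 -> R) H :
  expect (fun v => m1 v.1 * m2 v.2)
    (fun w => H [ffun j => (w j).1] [ffun j => (w j).2])
  = expect m1 (fun w1 => expect m2 (fun w2 => H w1 w2)).
Proof.
rewrite /expect; under [RHS]eq_bigr do rewrite mulr_sumr.
rewrite pair_bigA /=.
rewrite [RHS](reindex (fun w : {ffun J -> V1 * V2} =>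
   ([ffun j => (w j).1], [ffun j => (w j).2]))) /=; last first.
  exists (fun x : {ffun J -> V1} * {ffun J -> V2} =>
    [ffun j => (x.1 j, x.2 j)]) => [w _|[w w'] _].
    by apply/ffunP => j; rewrite !ffunE -surjective_pairing.
  by congr pair; apply/ffunP => j; rewrite !ffunE.
apply: eq_bigr => w _; rewrite mulrA; congr (_ * _).
by rewrite -big_split /=; apply: eq_bigr => j _; rewrite !ffunE.
Qed.

Definition fair (b : bool) : R := 2^-1.

Lemma fair_ge0 b : 0 <= fair b. Proof. by rewrite invr_ge0 ler0n. Qed.

Lemma fair_sum : \sum_b fair b = 1.
Proof. by rewrite big_bool /fair /=; lra. Qed.

Definition flip (w : {ffun J -> bool}) (j : J) := upd w j (~~ w j).

Lemma expect_flip j F : expect fair (fun w => F (flip w j)) = expect fair F.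
Proof.
rewrite /expect [RHS](reindex_inj (h := flip^~ j)) //=.
by apply: can_inj (flip^~ j) _ => w; rewrite /flip upd_upd upd_eq negbK upd_id.
Qed.

(** Along the segment between two laws, the expectation is a polynomial in the
    parameter, and differentiating it changes one coordinate at a time. *)
Section Path.
Variables (V : finType) (m0 m1 : V -> R).
Hypothesis m0_sum : \sum_v m0 v = 1.
Hypothesis m1_sum : \sum_v m1 v = 1.

Definition path_law (t : R) (v : V) : R := m0 v + t * (m1 v - m0 v).

Lemma path_law_sum t : \sum_v path_law t v = 1.
Proof.
by rewrite /path_law big_split /= -mulr_sumr sumrB m0_sum m1_sum subrr mulr0 addr0.
Qed.

Lemma path_law_ge0 t v : 0 <= t <= 1 -> 0 <= m0 v -> 0 <= m1 v ->
  0 <= path_law t v.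
Proof. by move=> /andP[t0 t1] h0 h1; rewrite /path_law; nra. Qed.

Lemma path_law0 : path_law 0 =1 m0.
Proof. by move=> v; rewrite /path_law mul0r addr0. Qed.

Lemma path_law1 : path_law 1 =1 m1.
Proof. by move=> v; rewrite /path_law mul1r addrC subrK. Qed.

Definition path_poly (F : {ffun J -> V} -> R) : {poly R} :=
  \sum_(w : {ffun J -> V}) F w *: \prod_j ((m0 (w j))%:P + 'X * (m1 (w j) - m0 (w j))%:P).

Lemma horner_path_poly F t : (path_poly F).[t] = expect (path_law t) F.
Proof.
rewrite /path_poly horner_sum; apply: eq_bigr => w _.
rewrite hornerZ horner_prod mulrC; congr (_ * _).
by apply: eq_bigr => j _; rewrite !hornerE.
Qed.

Lemma deriv_bigprod (I : finType) (f : I -> {poly R}) :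
  (\prod_i f i)^`() = \sum_j (f j)^`() * \prod_(i | i != j) f i.
Proof.
suff H (s : seq I) : uniq s -> (\prod_(i <- s) f i)^`() =
    \sum_(j <- s) (f j)^`() * \prod_(i <- s | i != j) f i.
  by rewrite H ?index_enum_uniq.
elim: s => [|a s IH] /=; first by rewrite !big_nil derivC.
move=> /andP[as_ us]; rewrite !big_cons derivM IH // eqxx /=; congr (_ * _ + _).
  by rewrite big_seq [RHS]big_seq_cond; apply: eq_bigl => i;
     case: eqP => [->|]; rewrite ?(negbTE as_) ?andbT.
rewrite mulr_sumr big_seq [RHS]big_seq; apply: eq_bigr => j js.
rewrite big_cons; case: eqP => [aj|_]; first by rewrite aj js in as_.
by rewrite mulrCA.
Qed.

Lemma deriv_path_poly F t :
  (path_poly F)^`().[t]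
  = \sum_j expect (path_law t) (fun w => \sum_v (m1 v - m0 v) * F (upd w j v)).
Proof.
rewrite /path_poly raddf_sum horner_sum.
under eq_bigr => w _ do rewrite /= derivZ hornerZ deriv_bigprod horner_sum mulr_sumr.
rewrite exchange_big /=; apply: eq_bigr => j _.
rewrite -(expect_change_coord (path_law_sum t)); apply: eq_bigr => w _.
rewrite mulrC hornerM horner_prod; congr (_ * _ * _).
  by rewrite derivD derivC add0r derivM derivX derivC mulr0 addr0 mul1r hornerC.
by apply: eq_bigr => i _; rewrite !hornerE.
Qed.

End Path.
End Expectation.

(** * Block systems and local expansions *)

Section Telescoping.
Variable T : pzRingType.
Implicit Types Z B : T.

Lemma pow_telescope Z B r :
  (Z + B) ^+ r = Z ^+ r + \sum_(u < r) Z ^+ u * B * (Z + B) ^+ (r.-1 - u).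
Proof.
elim: r => [|r IH]; first by rewrite big_ord0 addr0 !expr0.
rewrite exprS mulrDl {1}IH mulrDr -exprS -addrA; congr (_ + _).
rewrite big_ord_recl /= expr0 mul1r subn0 addrC; congr (_ + _).
rewrite mulr_sumr; apply: eq_bigr => u _; rewrite /bump /= add1n exprS !mulrA.
by congr (_ * _ * _ * _ ^+ _); lia.
Qed.

Lemma pow_telescope_rev Z B r :
  (Z + B) ^+ r = Z ^+ r + \sum_(u < r) (Z + B) ^+ u * B * Z ^+ (r.-1 - u).
Proof.
elim: r => [|r IH]; first by rewrite big_ord0 addr0 !expr0.
rewrite exprSr mulrDr {1}IH mulrDl -exprSr -addrA; congr (_ + _).
rewrite big_ord_recr /= subnn expr0 mulr1; congr (_ + _).
rewrite mulr_suml; apply: eq_bigr => u _; rewrite -mulrA -exprSr.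
by congr (_ * _ ^+ _); have := ltn_ord u; lia.
Qed.

End Telescoping.

Lemma sum_ord_cst (R : pzRingType) n (x : R) : \sum_(u < n) x = n%:R * x.
Proof. by rewrite sumr_const card_ord mulr_natl. Qed.

Section BlockSystem.
Variables (R : rcfType) (N : nat) (J : finType).
Variables (S : J -> {set 'I_N}) (A : J -> 'M[R]_N) (D m : nat).

(** An abstraction of the matrices A_t of the cells. Universality and decoupling
    depend only on the way in which the blocks overlap. *)
Record block_system : Prop := BlockSystem {
  block_sym : forall t, (A t)^T = A t;
  block_supp : forall t i j,
    A t i j != 0 -> [/\ i \in S t, j \in S t & i != j];
  block_le1 : forall t i j, `|A t i j| <= 1;
  block_card : forall t, #|S t| = D;
  block_pair : forall t t' i j, i != j ->
    i \in S t -> j \in S t -> i \in S t' -> j \in S t' -> t = t';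
  block_deg : forall i, #|[set t | i \in S t]| = m }.

Definition block_le t (Z : 'M[R]_N) (z : R) :=
  forall i j, i \in S t -> j \in S t -> `|Z i j| <= z.

Definition supported t (Z : 'M[R]_N) :=
  forall i j, Z i j != 0 -> i \in S t /\ j \in S t.

Lemma supported_mulE t (Z U V : 'M[R]_N) i j : supported t Z ->
  (U *m Z *m V) i j = \sum_(a in S t) \sum_(b in S t) U i a * Z a b * V b j.
Proof.
move=> Zt; rewrite mxE.
under eq_bigr do rewrite mxE mulr_suml.
rewrite exchange_big /= (bigID (mem (S t))) /= [X in _ + X]big1 ?addr0.
  apply: eq_bigr => a _.
  rewrite (bigID (mem (S t))) /= [X in _ + X]big1 ?addr0 // => b bS.
  have /eqP-> : Z a b == 0 by apply: contraNT bS => /Zt[].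
  by rewrite mulr0 mul0r.
move=> a aS; apply: big1 => b _.
have /eqP-> : Z a b == 0 by apply: contraNT aS => /Zt[].
by rewrite mulr0 mul0r.
Qed.

Hypothesis HB : block_system.

Lemma block_supported t : supported t (A t).
Proof. by move=> i j /(block_supp HB)[]. Qed.

Lemma block_diag0 t i : A t i i = 0.
Proof. by apply/eqP; apply: contraT => /(block_supp HB)[_ _]; rewrite eqxx. Qed.

Lemma card_blocks : (#|J| * D = N * m)%N.
Proof.
have E1 : (\sum_(t : J) #|S t| = #|J| * D)%N.
  by rewrite (eq_bigr (fun=> D)) ?sum_nat_const // => t _; exact: block_card HB t.
rewrite -E1; under eq_bigr do rewrite -sum1_card big_mkcond /=.
rewrite exchange_big /= -[in RHS](card_ord N) -sum_nat_const.
apply: eq_bigr => i _; rewrite -(block_deg HB i) -sum1_card [RHS]big_mkcond /=.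
by apply: eq_bigr => t _; rewrite inE.
Qed.

Lemma sum_blocks (f : 'I_N -> R) :
  \sum_t \sum_(i in S t) f i = m%:R * \sum_i f i.
Proof.
under eq_bigr do rewrite big_mkcond /=.
rewrite exchange_big mulr_sumr /=; apply: eq_bigr => i _.
rewrite -big_mkcond /= -[in RHS](block_deg HB i) mulr_natl -sumr_const.
by apply: eq_bigl => t; rewrite inE.
Qed.

Lemma block_mulE t (U V : 'M[R]_N) i j :
  (U *m A t *m V) i j = \sum_(a in S t) \sum_(b in S t) U i a * A t a b * V b j.
Proof. exact/supported_mulE/block_supported. Qed.

Lemma mxtrace_blockE t (Z : 'M[R]_N) :
  \tr (A t *m Z) = \sum_(a in S t) \sum_(b in S t) A t a b * Z b a.
Proof.
rewrite /mxtrace (bigID (mem (S t))) /= [X in _ + X]big1 ?addr0.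
  apply: eq_bigr => a aS; rewrite mxE (bigID (mem (S t))) /=.
  rewrite [X in _ + X]big1 ?addr0 // => b bS.
  have /eqP-> : A t a b == 0 by apply: contraNT bS => /(block_supp HB)[].
  by rewrite mul0r.
move=> a aS; rewrite mxE; apply: big1 => b _.
have /eqP-> : A t a b == 0 by apply: contraNT aS => /(block_supp HB)[].
by rewrite mul0r.
Qed.

Lemma block_double_sum_le t (f : 'I_N -> 'I_N -> R) c : 0 <= c ->
  (forall a b, a \in S t -> b \in S t -> `|f a b| <= c) ->
  `|\sum_(a in S t) \sum_(b in S t) f a b| <= D%:R ^+ 2 * c.
Proof.
move=> c0 fc; apply: le_trans (ler_norm_sum _ _ _) _.
have sumc x : \sum_(a in S t) x = D%:R * x :> R.
  by rewrite sumr_const (block_card HB) mulr_natl.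
rewrite expr2 -mulrA -sumc; apply: ler_sum => a aS.
apply: le_trans (ler_norm_sum _ _ _) _.
by rewrite -sumc; apply: ler_sum => b bS; exact: fc.
Qed.

Lemma block_le_mul t U V u v : 0 <= u -> 0 <= v ->
  block_le t U u -> block_le t V v ->
  block_le t (U *m A t *m V) (D%:R ^+ 2 * (u * v)).
Proof.
move=> u0 v0 hU hV i j iS jS; rewrite block_mulE.
apply: block_double_sum_le; first exact: mulr_ge0.
move=> a b aS bS; rewrite !normrM -[u]mulr1 ler_pM ?mulr_ge0 ?normr_ge0 ?hV//.
by rewrite ler_pM ?normr_ge0 ?hU ?(block_le1 HB).
Qed.

Lemma block_le_trace t Z z : 0 <= z ->
  block_le t Z z -> `|\tr (A t *m Z)| <= D%:R ^+ 2 * z.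
Proof.
move=> z0 hZ; rewrite mxtrace_blockE.
apply: block_double_sum_le => // a b aS bS; rewrite normrM -[z]mul1r.
by rewrite ler_pM ?normr_ge0 ?hZ ?(block_le1 HB).
Qed.

Lemma mulmx_scale_mid (P Q W : 'M[R]_N) y :
  P * (y *: Q) * W = y *: (P *m Q *m W).
Proof. by rewrite scalemxAl scalemxAr. Qed.

Section LocalPotential.
Variables (k : nat) (l0 : R).
Hypotheses (k_gt0 : (0 < k)%N) (l0_gt0 : 0 < l0).
Local Notation K := (k.*2).

(** The local size of the powers of X on a block. By local_root its K-th root
    bounds all powers of X up to K there; the term l0 ^+ K keeps this root large
    enough for perturbations. *)
Definition pot t (X : 'M[R]_N) : R := l0 ^+ K + \sum_(i in S t) (X ^+ K) i i.

Lemma pot_ge t X : X^T = X -> l0 ^+ K <= pot t X.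
Proof.
by move=> Xs; rewrite /pot lerDl; apply: sumr_ge0 => i _; exact: diag_pow_ge0.
Qed.

Lemma pot_gt0 t X : X^T = X -> 0 < pot t X.
Proof. by move=> Xs; apply: lt_le_trans (pot_ge t Xs); rewrite exprn_gt0. Qed.

(** Diagonal entries of X ^+ K are at most their sum, and they control all
    smaller powers by entry_pow_le. *)
Lemma local_root t X : X^T = X -> exists r : R,
  [/\ l0 <= r, r ^+ K = pot t X
    & forall q, (q <= K)%N -> block_le t (X ^+ q) (r ^+ q)].
Proof.
move=> Xs; have [|r r0 rK] := @nonneg_root_exists R K (pot t X) _ (ltW (pot_gt0 t Xs)).
  by rewrite double_gt0.
exists r; split=> //.
  have := pot_ge t Xs; rewrite -rK.
  by rewrite ler_pXn2r ?nnegrE ?double_gt0 // ltW.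
have di i : i \in S t -> (X ^+ K) i i <= r ^+ K.
  move=> iS; rewrite rK /pot (bigD1 i) //=.
  have : 0 <= \sum_(j in S t | j != i) (X ^+ K) j j.
    by apply: sumr_ge0 => j _; exact: diag_pow_ge0.
  have := exprn_gt0 K l0_gt0; lra.
by move=> q qK i j iS jS; apply: (@entry_pow_le R N X k) => //; exact: di.
Qed.

Lemma sym_perturb t X y : X^T = X -> (X + y *: A t)^T = X + y *: A t.
Proof. by move=> Xs; rewrite linearD linearZ /= Xs (block_sym HB). Qed.

(** Each insertion of the perturbation costs D^2 entries of the block and gains a
    factor r, so that at most K insertions sum to less than the main term. *)
Lemma perturb_block_le t X r y : `|y| <= 1 -> 0 <= r ->
  2 * K%:R * D%:R ^+ 2 <= r ->
  (forall q, (q <= K)%N -> block_le t (X ^+ q) (r ^+ q)) ->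
  forall q, (q <= K)%N -> block_le t ((X + y *: A t) ^+ q) (2 * r ^+ q).
Proof.
move=> y1 r0 rbig hX q; have [n] := ubnP q; elim: n q => // n IH q qn qK i j iS jS.
rewrite pow_telescope mxE summxE.
apply: le_trans (ler_normD _ _) _; have h1 := hX q qK i j iS jS.
suff h2 : `|\sum_(u < q) (X ^+ u * (y *: A t) * (X + y *: A t) ^+ (q.-1 - u)) i j|
    <= r ^+ q by lra.
apply: le_trans (ler_norm_sum _ _ _) _.
have [->|q0] := posnP q; first by rewrite big_ord0 exprn_ge0.
have each (u : 'I_q) :
    `|(X ^+ u * (y *: A t) * (X + y *: A t) ^+ (q.-1 - u)) i j|
     <= D%:R ^+ 2 * (2 * r ^+ q.-1).
  have -> : X ^+ u * (y *: A t) * (X + y *: A t) ^+ (q.-1 - u)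
     = y *: (X ^+ u *m A t *m (X + y *: A t) ^+ (q.-1 - u)).
    exact: mulmx_scale_mid.
  rewrite mxE normrM -[leRHS]mul1r; apply: ler_pM; rewrite ?normr_ge0 //.
  have uq := ltn_ord u.
  have -> : r ^+ q.-1 = r ^+ u * r ^+ (q.-1 - u) by rewrite -exprD; congr (_ ^+ _); lia.
  rewrite [2 * _]mulrCA; apply: block_le_mul => //; rewrite ?mulr_ge0 ?exprn_ge0 //.
    by apply: hX; lia.
  by apply: IH; lia.
apply: le_trans (ler_sum _ (fun u _ => each u)) _.
rewrite sum_ord_cst.
have -> : r ^+ q = r * r ^+ q.-1 by rewrite -exprS prednK.
have -> : q%:R * (D%:R ^+ 2 * (2 * r ^+ q.-1)) = (2 * q%:R * D%:R ^+ 2) * r ^+ q.-1 by ring.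
apply: ler_wpM2r; first exact: exprn_ge0.
apply: le_trans rbig; rewrite ler_wpM2r ?sqr_ge0 // ler_wpM2l // ler_nat //.
Qed.

(** Changing a single block by a bounded amount does not change its local size
    by more than a factor two, because K is small compared with l0. *)
Lemma pot_perturb t X y : X^T = X -> `|y| <= 1 ->
  2 * K%:R * D%:R ^+ 3 <= l0 ->
  pot t (X + y *: A t) <= 2 * pot t X.
Proof.
move=> Xs y1 l0big; have [r [l0r rK hX]] := local_root t Xs.
have r0 : 0 < r by exact: lt_le_trans l0r.
have [D0|D0] := posnP D.
  have S0 : S t = finset.set0 by apply: cards0_eq; rewrite (block_card HB).
  by rewrite /pot S0 !big_set0 addr0; have := exprn_gt0 K l0_gt0; lra.
have D1 : 1 <= D%:R :> R by rewrite ler1n.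
have rbig : 2 * K%:R * D%:R ^+ 2 <= r.
  apply: le_trans l0r; apply: le_trans l0big.
  by rewrite ler_wpM2l ?mulr_ge0 // ler_weXn2l.
have hW := perturb_block_le y1 (ltW r0) rbig hX.
suff H : \sum_(i in S t) ((X + y *: A t) ^+ K) i i
    <= \sum_(i in S t) (X ^+ K) i i + r ^+ K.
  by rewrite rK in H; move: H; rewrite /pot; lra.
have K0 : (0 < K)%N by rewrite double_gt0.
have step i : i \in S t -> ((X + y *: A t) ^+ K) i i
    <= (X ^+ K) i i + 2 * K%:R * D%:R ^+ 2 * r ^+ K.-1.
  move=> iS; rewrite pow_telescope mxE summxE lerD2l.
  apply: le_trans (ler_norm _) _; apply: le_trans (ler_norm_sum _ _ _) _.
  have each (u : 'I_K) :
    `|(X ^+ u * (y *: A t) * (X + y *: A t) ^+ (K.-1 - u)) i i|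
     <= D%:R ^+ 2 * (2 * r ^+ K.-1).
    have -> : X ^+ u * (y *: A t) * (X + y *: A t) ^+ (K.-1 - u)
     = y *: (X ^+ u *m A t *m (X + y *: A t) ^+ (K.-1 - u)).
      exact: mulmx_scale_mid.
    rewrite mxE normrM -[leRHS]mul1r; apply: ler_pM; rewrite ?normr_ge0 //.
    have uq := ltn_ord u.
    have -> : r ^+ K.-1 = r ^+ u * r ^+ (K.-1 - u) by rewrite -exprD; congr (_ ^+ _); lia.
    rewrite [2 * _]mulrCA; apply: block_le_mul => //; rewrite ?mulr_ge0 ?exprn_ge0 ?(ltW r0) //.
      by apply: hX; lia.
    by apply: hW; lia.
  apply: le_trans (ler_sum _ (fun u _ => each u)) _.
  by rewrite sum_ord_cst; apply: le_of_eq; ring.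
apply: le_trans (ler_sum _ step) _.
rewrite big_split /= lerD2l sumr_const (block_card HB) -[_ *+ D]mulr_natl.
have -> : r ^+ K = r * r ^+ K.-1 by rewrite -exprS prednK.
rewrite !mulrA; apply: ler_wpM2r; first by rewrite exprn_ge0 // ltW.
apply: le_trans l0r; apply: le_trans l0big.
by apply: le_of_eq; ring.
Qed.

(** Third-order expansion of the trace of a power in the weight of one block:
    every remainder term contains the block matrix three times, so that only
    entries inside the block occur. *)
Lemma trace_pow_expansion t Z : Z^T = Z -> 2 * K%:R * D%:R ^+ 2 <= l0 ->
  exists c0 c1 c2 : R, forall x, `|x| <= 1 ->
  `|\tr ((Z + x *: A t) ^+ K) - (c0 + c1 * x + c2 * x ^+ 2)|
    <= `|x| ^+ 3 * (2 * D%:R ^+ 6 * K%:R ^+ 3 / l0 ^+ 3 * pot t Z).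
Proof.
move=> Zs l0big; have [r [l0r rK hZ]] := local_root t Zs.
have r0 : 0 < r by exact: lt_le_trans l0r.
pose W x := Z + x *: A t.
exists (\tr (Z ^+ K)).
exists (\sum_(a < K) \tr (A t *m (Z ^+ (K.-1 - a) *m Z ^+ a))).
exists (\sum_(a < K) \sum_(u < a)
   \tr (A t *m (Z ^+ (a.-1 - u) *m A t *m (Z ^+ (K.-1 - a) *m Z ^+ u)))).
move=> x x1.
have rbig : 2 * K%:R * D%:R ^+ 2 <= r by exact: le_trans l0r.
have hW := perturb_block_le x1 (ltW r0) rbig hZ.
have E : \tr (W x ^+ K) = \tr (Z ^+ K)
   + (\sum_(a < K) \tr (A t *m (Z ^+ (K.-1 - a) *m Z ^+ a))) * x
   + (\sum_(a < K) \sum_(u < a)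
     \tr (A t *m (Z ^+ (a.-1 - u) *m A t *m (Z ^+ (K.-1 - a) *m Z ^+ u)))) * x ^+ 2
   + x ^+ 3 * (\sum_(a < K) \sum_(u < a) \sum_(w < (a.-1 - u)%N)
     \tr (A t *m ((Z ^+ w *m A t *m W x ^+ ((a.-1 - u).-1 - w)) *m A t *m
        (Z ^+ (K.-1 - a) *m Z ^+ u)))).
  rewrite {1}/W pow_telescope_rev linearD /= -!addrA; congr (_ + _).
  rewrite raddf_sum mulr_suml mulr_suml mulr_sumr -!big_split /=.
  apply: eq_bigr => a _.
  rewrite mulmx_scale_mid linearZ /=.
  rewrite pow_telescope mulmxDl mulmxDl linearD /= mulrDr.
  have cyc (P Q T : 'M[R]_N) : \tr (P *m Q *m T) = \tr (Q *m (T *m P)).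
    by rewrite -mulmxA mxtrace_mulC mulmxA.
  rewrite cyc; congr (_ + _); first exact: mulrC.
  rewrite !mulmx_suml raddf_sum mulr_sumr mulr_suml mulr_sumr -!big_split /=.
  apply: eq_bigr => u _.
  rewrite mulmx_scale_mid -!scalemxAl linearZ /=.
  have -> : \tr (Z ^+ u *m A t *m (Z + x *: A t) ^+ (a.-1 - u) *m A t *m Z ^+ (K.-1 - a))
     = \tr (A t *m ((Z + x *: A t) ^+ (a.-1 - u) *m A t *m (Z ^+ (K.-1 - a) *m Z ^+ u))).
    by rewrite -!mulmxA mxtrace_mulC -!mulmxA.
  rewrite pow_telescope mulmxDl mulmxDl mulmxDr linearD /= !mulrDr mulrA mulrC -expr2.
  congr (_ + _).
  rewrite !mulmx_suml mulmx_sumr raddf_sum !mulr_sumr; apply: eq_bigr => w _ /=.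
  rewrite mulmx_scale_mid -!scalemxAl -!scalemxAr linearZ /= /W.
  by set e := \tr _; ring.
rewrite -/(W x) E.
set c1x := _ * x; set c2x := _ * x ^+ 2.
rewrite [X in `|X|](_ : _ = x ^+ 3 * (\sum_(a < K) \sum_(u < a) \sum_(w < (a.-1 - u)%N)
     \tr (A t *m ((Z ^+ w *m A t *m W x ^+ ((a.-1 - u).-1 - w)) *m A t *m
        (Z ^+ (K.-1 - a) *m Z ^+ u))))); last by rewrite addrC addKr.
rewrite normrM normrX; apply: ler_wpM2l; first by rewrite exprn_ge0.
set c := 2 * D%:R ^+ 6 * (pot t Z / l0 ^+ 3).
have c0 : 0 <= c.
  by rewrite mulr_ge0 ?divr_ge0 ?mulr_ge0 ?exprn_ge0 // ltW // pot_gt0.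
apply: (@le_trans _ _ (\sum_(a < K) \sum_(u < K) \sum_(w < K) c)); last first.
  rewrite !sum_ord_cst /c; apply: le_of_eq; ring.
apply: le_trans (ler_norm_sum _ _ _) _; apply: ler_sum => a _.
have mono n (F : nat -> R) G : (n <= K)%N -> (forall u, (u < n)%N -> `|F u| <= G) ->
   0 <= G -> `|\sum_(u < n) F u| <= \sum_(u < K) G.
  move=> nK FG G0; apply: le_trans (ler_norm_sum _ _ _) _.
  apply: (@le_trans _ _ (\sum_(u < n) G)).
    by apply: ler_sum => u _; apply: FG.
  by rewrite !sum_ord_cst ler_wpM2r // ler_nat.
apply: (mono a (fun u => \sum_(w < (a.-1 - u)%N)
   \tr (A t *m (Z ^+ w *m A t *m W x ^+ ((a.-1 - u).-1 - w) *m A t *m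
     (Z ^+ (K.-1 - a) *m Z ^+ u))))); first by have := ltn_ord a; lia.
  move=> u ua.
  apply: (mono _ (fun w => \tr (A t *m (Z ^+ w *m A t *m W x ^+ ((a.-1 - u).-1 - w)
     *m A t *m (Z ^+ (K.-1 - a) *m Z ^+ u))))) => //.
    by have := ltn_ord a; lia.
  move=> w wu; have aK := ltn_ord a.
  have -> : Z ^+ (K.-1 - a) *m Z ^+ u = Z ^+ (K.-1 - a + u) by rewrite exprD.
  set v := ((a.-1 - u).-1 - w)%N; set q := (K.-1 - a + u)%N.
  have deg : K = (w + v + q + 3)%N by rewrite /v /q; lia.
  apply: (@le_trans _ _ (D%:R ^+ 2 * (D%:R ^+ 2 * ((D%:R ^+ 2 * (r ^+ w * (2 * r ^+ v))) * r ^+ q)))).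
    have rq n : 0 <= r ^+ n by rewrite exprn_ge0 // ltW.
    apply: block_le_trace; first by rewrite !mulr_ge0 ?sqr_ge0 ?rq.
    apply: block_le_mul; rewrite ?mulr_ge0 ?sqr_ge0 ?rq //.
      apply: block_le_mul; rewrite ?mulr_ge0 ?rq //.
        by apply: hZ; lia.
      by apply: hW; lia.
    by apply: hZ; lia.
  rewrite [leLHS](_ : _ = 2 * D%:R ^+ 6 * r ^+ (w + v + q)); last first.
    by rewrite !exprD; ring.
  rewrite /c; apply: ler_wpM2l; first by rewrite mulr_ge0 ?exprn_ge0.
  rewrite ler_pdivlMr ?exprn_gt0 // -rK [in leRHS]deg [in leRHS]exprD.
  apply: ler_wpM2l; first by rewrite exprn_ge0 // ltW.
  by rewrite ler_pXn2r ?nnegrE // ltW.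
by apply: sumr_ge0 => w _.
Qed.

End LocalPotential.
End BlockSystem.

(** * Universality of trace moments *)

Section PolynomialCalculus.
Variable R : realType.

Lemma poly_increment_le (p : {poly R}) c :
  (forall s, 0 <= s <= 1 -> `|p^`().[s]| <= c) -> `|p.[1] - p.[0]| <= c.
Proof.
move=> pc; have [|s + ->] := @MVT R (horner p) (horner p^`()) 0 1 ltr01
  (fun s _ => is_derive_poly p s).
  by apply: continuous_subspaceT => s; exact: continuous_horner.
by rewrite subr0 mulr1 in_itv /= => /andP[s0 s1]; apply: pc; rewrite !ltW.
Qed.

Lemma poly_gronwall (p : {poly R}) c :
  (forall s, 0 <= s <= 1 -> p^`().[s] <= c * p.[s]) ->
  p.[1] <= expR c * p.[0].
Proof.
move=> pc.
pose f (s : R) := p.[s] * expR (- c * s).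
pose df (s : R) := (p^`().[s] - c * p.[s]) * expR (- c * s).
have fd (s : R) : is_derive s 1 f (df s).
  rewrite /f; apply: is_derive_eq.
  rewrite /df /GRing.scale /=; ring.
have [|s +] := @MVT R f df 0 1 ltr01 (fun s _ => fd s).
  apply: continuous_subspaceT => s; apply: differentiable_continuous.
  exact/derivable1_diffP.
rewrite subr0 mulr1 in_itv /= => /andP[s0 s1] fE.
have : f 1 <= f 0.
  rewrite -subr_le0 fE /df; apply: mulr_le0_ge0; last exact/ltW/expR_gt0.
  by rewrite subr_le0; apply: pc; rewrite !ltW.
rewrite /f mulr0 expR0 !mulr1 expRN -ler_pdivlMr ?invr_gt0 ?expR_gt0 //.
by rewrite invrK mulrC.
Qed.

End PolynomialCalculus.

Section Universality.
Variables (R : realType) (N : nat) (J V : finType).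
Variables (S : J -> {set 'I_N}) (A : J -> 'M[R]_N) (D m : nat).
Hypothesis HB : block_system S A D m.
Variables (x : V -> R) (m0 m1 : V -> R) (q : R).
Hypotheses (m0_ge0 : forall v, 0 <= m0 v) (m1_ge0 : forall v, 0 <= m1 v).
Hypotheses (m0_sum : \sum_v m0 v = 1) (m1_sum : \sum_v m1 v = 1).
Hypothesis x_le1 : forall v, `|x v| <= 1.
Hypothesis mean_eq : \sum_v m0 v * x v = \sum_v m1 v * x v.
Hypothesis variance_eq : \sum_v m0 v * x v ^+ 2 = \sum_v m1 v * x v ^+ 2.
Hypotheses (third0 : \sum_v m0 v * `|x v| ^+ 3 <= q)
  (third1 : \sum_v m1 v * `|x v| ^+ 3 <= q).
Variables (k : nat) (l0 : R).
Hypotheses (k_gt0 : (0 < k)%N) (l0_gt0 : 0 < l0) (D_gt0 : (0 < D)%N).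
Local Notation K := (k.*2).
Hypothesis l0_big : 2 * K%:R * D%:R ^+ 3 <= l0.

Definition block_sum (w : {ffun J -> V}) : 'M[R]_N := \sum_t x (w t) *: A t.

Lemma block_sum_sym w : (block_sum w)^T = block_sum w.
Proof.
rewrite /block_sum raddf_sum; apply: eq_bigr => t _ /=.
by rewrite linearZ /= (block_sym HB).
Qed.

Lemma block_sum_upd w t v :
  block_sum (upd w t v) = block_sum w - x (w t) *: A t + x v *: A t.
Proof.
rewrite /block_sum (bigD1 t) //= upd_eq [in RHS](bigD1 t) //=.
rewrite [x (w t) *: _ + _]addrC addrK addrC; congr (_ + _).
by apply: eq_bigr => i it; rewrite upd_neq.
Qed.

Lemma sum_pot_le X : \sum_t pot S k l0 t X <= m%:R * (N%:R * l0 ^+ K + \tr (X ^+ K)).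
Proof.
rewrite /pot big_split /= (sum_blocks HB) mulrDr lerD2r sumr_const.
rewrite -[_ *+ #|_|]mulr_natl mulrA -natrM.
apply: ler_wpM2r; first by rewrite exprn_ge0 ?ltW.
by rewrite ler_nat mulnC -(card_blocks HB) leq_pmulr.
Qed.

Let C : R := 2 * D%:R ^+ 6 * K%:R ^+ 3 / l0 ^+ 3.

Lemma C_ge0 : 0 <= C.
Proof. by rewrite divr_ge0 ?mulr_ge0 ?exprn_ge0 // ltW. Qed.

(** The quadratic Taylor polynomial of the trace in one weight has the same mean
    under both laws, and only the third-order remainder is left. *)
Lemma change_one_law w t :
  `|\sum_v (m1 v - m0 v) * \tr (block_sum (upd w t v) ^+ K)|
    <= 4 * q * C * pot S k l0 t (block_sum w).
Proof.
set X := block_sum w; set Z := X - x (w t) *: A t.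
have Xs : X^T = X by exact: block_sum_sym.
have ZE : Z = X + (- x (w t)) *: A t by rewrite scaleNr.
have Zs : Z^T = Z by rewrite ZE; exact: (sym_perturb HB).
have l0_big2 : 2 * K%:R * D%:R ^+ 2 <= l0.
  apply: le_trans l0_big; rewrite ler_wpM2l ?mulr_ge0 // ler_weXn2l //.
  by rewrite ler1n.
have [c0 [c1 [c2 H]]] := trace_pow_expansion HB k_gt0 l0_gt0 t Zs l0_big2.
pose Q v : R := c0 + c1 * x v + c2 * x v ^+ 2.
have Q0 : \sum_v (m1 v - m0 v) * Q v = 0.
  rewrite (eq_bigr (fun v => c0 * (m1 v - m0 v) + c1 * (m1 v * x v - m0 v * x v)
     + c2 * (m1 v * x v ^+ 2 - m0 v * x v ^+ 2))); last first.
    by move=> v _; rewrite /Q; ring.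
  rewrite !big_split /= -!mulr_sumr !sumrB m0_sum m1_sum mean_eq variance_eq.
  by rewrite !subrr !mulr0 !addr0.
have -> : \sum_v (m1 v - m0 v) * \tr (block_sum (upd w t v) ^+ K)
   = \sum_v (m1 v - m0 v) * (\tr ((Z + x v *: A t) ^+ K) - Q v).
  under [RHS]eq_bigr do rewrite mulrBr.
  rewrite [RHS]sumrB Q0 subr0; apply: eq_bigr => v _.
  by rewrite block_sum_upd.
apply: le_trans (ler_norm_sum _ _ _) _.
have pZ : pot S k l0 t Z <= 2 * pot S k l0 t X.
  by rewrite ZE; apply: (pot_perturb HB) => //; rewrite normrN.
have pZ0 : 0 <= pot S k l0 t Z by rewrite ltW // pot_gt0.
have q0 : 0 <= q.
  by apply: le_trans third0; apply: sumr_ge0 => v _; rewrite mulr_ge0 ?exprn_ge0.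
apply: (@le_trans _ _ (\sum_v (m1 v * `|x v| ^+ 3 + m0 v * `|x v| ^+ 3)
    * (C * pot S k l0 t Z))).
  apply: ler_sum => v _; rewrite normrM -mulrDl -mulrA; apply: ler_pM => //.
    by rewrite ler_norml; have := m0_ge0 v; have := m1_ge0 v; lra.
  exact: H.
rewrite -mulr_suml big_split /=.
apply: (@le_trans _ _ ((q + q) * (C * (2 * pot S k l0 t X)))).
  have C0 := C_ge0.
  have h1 : 0 <= \sum_v m1 v * `|x v| ^+ 3 + \sum_v m0 v * `|x v| ^+ 3.
    by rewrite addr_ge0 // sumr_ge0 // => v _; rewrite mulr_ge0 ?exprn_ge0.
  apply: ler_pM => //; [exact: mulr_ge0|exact: lerD|exact: ler_wpM2l].
by apply: le_of_eq; ring.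
Qed.

(** Only the first two moments of the independent weights matter for high
    trace moments: the two laws are joined by a segment along which the
    derivative of the trace moment only sees the third moments. *)
Theorem trace_moment_universality :
  let c := 8 * D%:R ^+ 6 * K%:R ^+ 3 * m%:R * q / l0 ^+ 3 in
  expect m1 (fun w => \tr (block_sum w ^+ K)) + N%:R * l0 ^+ K
   <= expR c * (expect m0 (fun w => \tr (block_sum w ^+ K)) + N%:R * l0 ^+ K).
Proof.
cbv zeta; set c := (X in expR X); pose F w := \tr (block_sum w ^+ K).
pose p := path_poly m0 m1 F + (N%:R * l0 ^+ K)%:P.
have pE s : p.[s] = expect (path_law m0 m1 s) F + N%:R * l0 ^+ K.
  by rewrite hornerD horner_path_poly hornerC.
have : p.[1] <= expR c * p.[0].
  apply: poly_gronwall => s s01.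
  have mu0 v : 0 <= path_law m0 m1 s v by exact: path_law_ge0.
  rewrite derivD derivC addr0 deriv_path_poly // pE.
  apply: (@le_trans _ _ (\sum_t expect (path_law m0 m1 s)
     (fun w => 4 * q * C * pot S k l0 t (block_sum w)))).
    apply: ler_sum => t _; apply: ler_expect => // w.
    by apply: le_trans (ler_norm _) _; exact: change_one_law.
  rewrite -expect_sum.
  have q0 : 0 <= q.
    by apply: le_trans third0; apply: sumr_ge0 => v _; rewrite mulr_ge0 ?exprn_ge0.
  apply: (@le_trans _ _ (expect (path_law m0 m1 s)
      (fun w => c * (N%:R * l0 ^+ K + F w)))); last first.
    rewrite expectZ expectD expect_cst ?path_law_sum //.
    by rewrite [_ + expect _ _]addrC.
  apply: ler_expect => // w; rewrite -mulr_sumr.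
  rewrite (_ : c = 4 * q * C * m%:R); last by rewrite /c /C; ring.
  rewrite -[leRHS]mulrA; apply: ler_wpM2l; first by apply: mulr_ge0; [exact: mulr_ge0|exact: C_ge0].
  exact: sum_pot_le.
rewrite !pE; congr (_ + _ <= _ * (_ + _));
 apply: eq_bigr => w _; congr (_ * _); apply: eq_bigr => j _.
  by rewrite path_law1.
by rewrite path_law0.
Qed.

End Universality.

(** * Crossing pairs of blocks *)

(** Among four exponents of total degree K = 2k at most one exceeds k. The rows
    of the other three powers are square summable by row_pow_le. *)
Lemma two_small_exponents (r : 'I_4 -> nat) k :
  (r 0%R + r 1%R + r 2%:R + r 3%:R <= k.*2)%N ->
  (forall i, (r i <= k.*2)%N) /\
  (forall i j, i != j -> (r i <= k)%N || (r j <= k)%N).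
Proof.
have -> : (r 0%R + r 1%R + r 2%:R + r 3%:R = \sum_i r i)%N.
  rewrite !big_ord_recl big_ord0 addn0 !addnA.
  by congr (_ + _ + _ + _)%N; congr r; apply: val_inj.
move=> rK; split=> [i|i j ij]; rewrite (bigD1 i) //= in rK.
  exact: leq_trans (leq_addr _ _) rK.
rewrite (bigD1 j) /= 1?eq_sym // addnA in rK.
have : (r i + r j <= k.*2)%N by exact: leq_trans (leq_addr _ _) rK.
clear; lia.
Qed.

Section Crossing.
Variables (R : rcfType) (N : nat) (J : finType).
Variables (S : J -> {set 'I_N}) (A : J -> 'M[R]_N) (D m : nat).
Hypothesis HB : block_system S A D m.
Implicit Types (t : J) (f g : 'I_N -> R) (off : bool).

(** The flag off leaves out the diagonal. It can be set for block matrices with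
    zero diagonal, and it pays off because two distinct indices determine their
    block. *)
Definition pair_sum off t f g : R :=
  \sum_(s in S t) \sum_(u in S t | off ==> (u != s)) f s * g u.

Lemma pair_sumC off t f g : pair_sum off t f g = pair_sum off t g f.
Proof.
rewrite /pair_sum (exchange_big_dep (mem (S t))) /=; last by move=> s u _ /andP[].
apply: eq_bigr => u uS; apply: eq_big => [s|s _]; last exact: mulrC.
by rewrite uS /= eq_sym.
Qed.

Lemma pair_sum_ge0 off t f g : (forall s, 0 <= f s) -> (forall s, 0 <= g s) ->
  0 <= pair_sum off t f g.
Proof. by move=> f0 g0; do 2!apply: sumr_ge0 => ? _; rewrite mulr_ge0. Qed.

Let loc t f := \sum_(s in S t) f s.

Let loc_ge0 t f : (forall s, 0 <= f s) -> 0 <= loc t f.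
Proof. by move=> f0; apply: sumr_ge0. Qed.

Let pair_sum_loc off t f g : (forall s, 0 <= f s) -> (forall s, 0 <= g s) ->
  pair_sum off t f g <= loc t f * loc t g.
Proof.
move=> f0 g0; rewrite /pair_sum /loc big_distrlr /=; apply: ler_sum => s _.
rewrite [leLHS]big_mkcondr /=; apply: ler_sum => u _.
by case: ifP => // _; rewrite mulr_ge0.
Qed.

Let loc_le t f b : (forall s, s \in S t -> f s <= b) -> loc t f <= D%:R * b.
Proof.
move=> fb; apply: (@le_trans _ _ (\sum_(s in S t) b)); first exact: ler_sum.
by rewrite sumr_const (block_card HB) mulr_natl.
Qed.

Let cs_set t f : (\sum_(s in S t) f s) ^+ 2 <= D%:R * \sum_(s in S t) f s ^+ 2.
Proof.
have := Cauchy_Schwarz (fun s => (s \in S t)%:R : R) (fun s => if s \in S t then f s else 0).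
rewrite (_ : \sum_i _ * _ = \sum_(s in S t) f s); last first.
  by rewrite [RHS]big_mkcond; apply: eq_bigr => s _; case: (s \in S t); rewrite ?mul1r ?mul0r.
rewrite (_ : \sum_i _ ^+ 2 = D%:R); last first.
  rewrite -(block_card HB t) -sumr_const [RHS]big_mkcond.
  by apply: eq_bigr => s _; case: (s \in S t); rewrite ?expr1n ?expr0n.
rewrite (_ : \sum_i _ ^+ 2 = \sum_(s in S t) f s ^+ 2) //.
by rewrite [RHS]big_mkcond; apply: eq_bigr => s _; case: (s \in S t); rewrite ?expr0n.
Qed.

Let sum_loc_sqr f b : \sum_s f s ^+ 2 <= b ^+ 2 ->
  \sum_t loc t f ^+ 2 <= D%:R * m%:R * b ^+ 2.
Proof.
move=> fb; apply: le_trans (ler_sum _ (fun t _ => cs_set t f)) _.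
by rewrite -mulr_sumr (sum_blocks HB) -mulrA !ler_wpM2l.
Qed.

(* Every pair of distinct indices occurs in at most one block. *)
Let sum_pair_sqr f g b c :
  0 <= b -> 0 <= c ->
  \sum_s f s ^+ 2 <= b ^+ 2 -> \sum_s g s ^+ 2 <= c ^+ 2 ->
  \sum_t pair_sum true t f g ^+ 2 <= D%:R ^+ 2 * (b ^+ 2 * c ^+ 2).
Proof.
move=> b0 c0 fb gc.
have step t : pair_sum true t f g ^+ 2 <= D%:R ^+ 2 *
    \sum_(s in S t) \sum_(u in S t | u != s) f s ^+ 2 * g u ^+ 2.
  apply: le_trans (cs_set _ _) _; rewrite expr2 -mulrA ler_wpM2l //.
  rewrite mulr_sumr; apply: ler_sum => s _.
  rewrite big_mkcondr [X in _ <= _ * X]big_mkcondr /=.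
  apply: le_trans (cs_set _ _) _; rewrite ler_wpM2l //; apply: ler_sum => u _.
  by case: ifP; rewrite ?exprMn ?expr0n.
apply: le_trans (ler_sum _ (fun t _ => step t)) _.
rewrite -mulr_sumr ler_wpM2l ?exprn_ge0 //.
apply: (@le_trans _ _ (\sum_s \sum_u f s ^+ 2 * g u ^+ 2)); last first.
  under eq_bigr do rewrite -mulr_sumr.
  rewrite -mulr_suml; apply: ler_pM => //;
    by apply: sumr_ge0 => i _; exact: sqr_ge0.
under eq_bigr do rewrite big_mkcond /=.
rewrite exchange_big /=; apply: ler_sum => s _.
have E t : (if s \in S t then \sum_(u in S t | u != s) f s ^+ 2 * g u ^+ 2 else 0)
   = \sum_u (if [&& s \in S t, u \in S t & u != s] then f s ^+ 2 * g u ^+ 2 else 0).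
  by case: (s \in S t) => /=; [exact: big_mkcond|rewrite big1].
rewrite (eq_bigr _ (fun t _ => E t)) exchange_big /=; apply: ler_sum => u _.
rewrite -big_mkcond /=.
have [us|us] := eqVneq u s.
  rewrite big_pred0; first by rewrite mulr_ge0 ?sqr_ge0.
  by move=> t; rewrite !andbF.
rewrite sumr_const -[leRHS]mulr1n; apply: ler_wpMn2l; first by rewrite mulr_ge0 ?sqr_ge0.
have [t0 /andP[st0 /andP[ut0 _]]|none] := pickP [pred t | [&& s \in S t, u \in S t & true]].
  rewrite -(card1 t0); apply/subset_leq_card/fintype.subsetP => t.
  rewrite !inE => /andP[st /andP[ut _]]; apply/eqP.
  by apply: (block_pair HB (i := s) (j := u)) => //; rewrite eq_sym.
rewrite eq_card0 // => t; have := none t; rewrite /= !andbT => nt.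
Qed.

Definition cross_const off : R :=
  if off then D%:R ^+ 2 * Num.sqrt (D%:R * m%:R) else D%:R ^+ 3 * m%:R.

Lemma cross_const_ge0 off : 0 <= cross_const off.
Proof. by case: off; rewrite /cross_const mulr_ge0 ?exprn_ge0 ?sqrtr_ge0. Qed.

Let cs_le (I : finType) (G : pred I) (a b : I -> R) x y :
  0 <= x -> 0 <= y -> (forall i, 0 <= a i) -> (forall i, 0 <= b i) ->
  \sum_i a i ^+ 2 <= x ^+ 2 -> \sum_i b i ^+ 2 <= y ^+ 2 ->
  \sum_(i | G i) a i * b i <= x * y.
Proof.
move=> x0 y0 a0 b0 ax bY; apply: (@le_trans _ _ (\sum_i a i * b i)).
  by rewrite big_mkcond /=; apply: ler_sum => i _; case: ifP; rewrite ?mulr_ge0.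
rewrite -(ler_pXn2r (isT : (0 < 2)%N)) ?nnegrE ?mulr_ge0 //; last first.
  by apply: sumr_ge0 => i _; rewrite mulr_ge0.
apply: le_trans (Cauchy_Schwarz _ _) _; rewrite exprMn.
by apply: ler_pM => //; apply: sumr_ge0 => i _; exact: sqr_ge0.
Qed.

(* The sum over the blocks of a product of four functions, of which the last
   two and one of the first two are square summable. *)
Let pair_cross_core off (G : pred J) f1 f2 f3 f4 b1 b2 b3 b4 :
  (forall s, 0 <= f1 s) -> (forall s, 0 <= f2 s) ->
  (forall s, 0 <= f3 s) -> (forall s, 0 <= f4 s) ->
  0 <= b1 -> 0 <= b2 -> 0 <= b3 -> 0 <= b4 ->
  (forall t s, G t -> s \in S t -> f1 s <= b1) ->
  (forall t s, G t -> s \in S t -> f2 s <= b2) ->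
  \sum_s f2 s ^+ 2 <= b2 ^+ 2 ->
  \sum_s f3 s ^+ 2 <= b3 ^+ 2 -> \sum_s f4 s ^+ 2 <= b4 ^+ 2 ->
  \sum_(t | G t) pair_sum off t f1 f2 * pair_sum off t f3 f4
    <= cross_const off * (b1 * b2 * b3 * b4).
Proof.
move=> f10 f20 f30 f40 b10 b20 b30 b40 h1 h2' h2 h3 h4; rewrite /cross_const.
have sq : Num.sqrt (D%:R * m%:R) ^+ 2 = D%:R * m%:R :> R.
  by rewrite sqr_sqrtr ?mulr_ge0.
case: off.
  apply: (@le_trans _ _ (\sum_(t | G t) (D%:R * b1) * (loc t f2 * pair_sum true t f3 f4))).
    apply: ler_sum => t Gt; rewrite mulrA ler_wpM2r ?pair_sum_ge0 //.
    apply: le_trans (pair_sum_loc _ _ f10 f20) _; rewrite ler_wpM2r ?loc_ge0 //.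
    by apply: loc_le => s; exact: h1.
  rewrite -mulr_sumr.
  rewrite [leRHS](_ : _ = D%:R * b1 * ((Num.sqrt (D%:R * m%:R) * b2) * (D%:R * (b3 * b4))));
    last by ring.
  apply: ler_wpM2l; first exact: mulr_ge0.
  apply: cs_le; rewrite ?mulr_ge0 ?sqrtr_ge0 //.
  - by move=> t; exact: loc_ge0.
  - by move=> t; exact: pair_sum_ge0.
  - by rewrite exprMn sq; exact: sum_loc_sqr.
  - by rewrite exprMn [(b3 * b4) ^+ 2]exprMn; exact: sum_pair_sqr.
apply: (@le_trans _ _ (\sum_(t | G t) ((D%:R * b1) * (D%:R * b2)) * (loc t f3 * loc t f4))).
  apply: ler_sum => t Gt; apply: ler_pM; rewrite ?pair_sum_ge0 //.
    apply: le_trans (pair_sum_loc _ _ f10 f20) _; apply: ler_pM; rewrite ?loc_ge0 //.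
      by apply: loc_le => s; exact: h1.
    by apply: loc_le => s; exact: h2'.
  exact: pair_sum_loc.
rewrite -mulr_sumr.
rewrite [leRHS](_ : _ = (D%:R * b1) * (D%:R * b2) * ((Num.sqrt (D%:R * m%:R) * b3) * (Num.sqrt (D%:R * m%:R) * b4)));
  last first.
  rewrite [(_ * b3) * (_ * b4)]mulrACA -expr2 sq; ring.
apply: ler_wpM2l; first by rewrite !mulr_ge0.
apply: cs_le; rewrite ?mulr_ge0 ?sqrtr_ge0 //.
- by move=> t; exact: loc_ge0.
- by move=> t; exact: loc_ge0.
- by rewrite exprMn sq; exact: sum_loc_sqr.
- by rewrite exprMn sq; exact: sum_loc_sqr.
Qed.

(** Four functions of which at least three are square summable.  When a square
    summable factor is summed over all blocks this costs sqrt m, and a pair of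
    distinct indices determines its block, so that a pair of square summable
    functions costs nothing. *)
Lemma pair_cross off (G : pred J) (f : 'I_4 -> 'I_N -> R) (b : 'I_4 -> R) (e : 'I_4 -> bool) :
  (forall i s, 0 <= f i s) -> (forall i, 0 <= b i) ->
  (forall i t s, G t -> s \in S t -> f i s <= b i) ->
  (forall i, e i -> \sum_s f i s ^+ 2 <= b i ^+ 2) ->
  (forall i j, i != j -> e i || e j) ->
  \sum_(t | G t) pair_sum off t (f 0) (f 1) * pair_sum off t (f 2%:R) (f 3%:R)
    <= cross_const off * (b 0 * b 1 * b 2%:R * b 3%:R).
Proof.
move=> f0 b0 fb fe ee.
have [e0|e0] := boolP (e 0); last first.
  have e_ i : i != 0 -> e i by move=> i0; have := ee i 0 i0; rewrite (negbTE e0) orbF.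
  by apply: pair_cross_core => //; rewrite ?fe ?e_ //; move=> t s; exact: fb.
have [e1|e1] := boolP (e 1); last first.
  have e_ i : i != 1 -> e i by move=> i0; have := ee i 1 i0; rewrite (negbTE e1) orbF.
  rewrite [b 0 * b 1]mulrC; under eq_bigr do rewrite [pair_sum _ _ (f 0) _]pair_sumC.
  by apply: pair_cross_core => //; rewrite ?fe ?e_ //; move=> t s; exact: fb.
rewrite (_ : b 0 * b 1 * b 2%:R * b 3%:R = b 2%:R * b 3%:R * b 0 * b 1); last by ring.
have [e2|e2] := boolP (e 2%:R); last first.
  have e_ i : i != 2%:R -> e i by move=> i0; have := ee i 2%:R i0; rewrite (negbTE e2) orbF.
  under eq_bigr do rewrite mulrC.
  by apply: pair_cross_core => //; rewrite ?fe ?e_ //; move=> t s; exact: fb.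
rewrite [b 2%:R * _]mulrC.
under eq_bigr do rewrite mulrC [pair_sum _ _ (f 2%:R) _]pair_sumC.
by apply: pair_cross_core => //; rewrite ?fe //; move=> t s; exact: fb.
Qed.

Let pairs off t (p : 'I_N * 'I_N) :=
  [&& p.1 \in S t, p.2 \in S t & off ==> (p.2 != p.1)].

Let pair_sumE off t f g :
  pair_sum off t f g = \sum_(p | pairs off t p) f p.1 * g p.2.
Proof. by rewrite /pair_sum pair_big_dep. Qed.

Let sum_pairs_le off t (c : R) : 0 <= c ->
  \sum_(p | pairs off t p) c <= D%:R ^+ 2 * c.
Proof.
move=> c0; apply: (@le_trans _ _ (\sum_(p | pairs false t p) c)).
  rewrite big_mkcond [leRHS]big_mkcond; apply: ler_sum => p _.
  rewrite /pairs /= andbT; case: (p.1 \in S t) => //=.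
  by case: (p.2 \in S t) => //=; case: ifP.
rewrite (eq_bigl (fun p => (p.1 \in S t) && (p.2 \in S t))); last first.
  by move=> p; rewrite /pairs /= andbT.
rewrite -(pair_big (mem (S t)) (mem (S t)) (fun _ _ => c)) /=.
by rewrite !sumr_const (block_card HB) -mulrnA -[_ *+ (D * D)]mulr_natl natrM expr2.
Qed.

Let trace_pairsE off t t' (W1 W2 W3 W4 K1 K2 : 'M[R]_N) :
  supported S t' K1 -> supported S t' K2 ->
  (off -> forall i, K1 i i = 0) -> (off -> forall i, K2 i i = 0) ->
  \tr (A t *m ((W1 *m K1 *m W2) *m A t *m (W3 *m K2 *m W4)))
  = \sum_(p | pairs off t p) \sum_(r | pairs off t r)
    \sum_(x | pairs off t' x) \sum_(y | pairs off t' y)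
      (A t p.1 p.2 * A t r.1 r.2 * K1 x.1 x.2 * K2 y.1 y.2)
      * (W1 p.2 x.1 * W2 x.2 r.1 * W3 r.2 y.1 * W4 y.2 p.1).
Proof.
move=> s1 s2 z1 z2; rewrite (mxtrace_blockE HB).
have dropd t0 (Z : 'M[R]_N) (F : 'I_N -> 'I_N -> R) : (off -> forall i, Z i i = 0) ->
    \sum_(a in S t0) \sum_(b in S t0) Z a b * F a b
    = \sum_(p | pairs off t0 p) Z p.1 p.2 * F p.1 p.2.
  move=> z; rewrite -(pair_big_dep (mem (S t0)) (fun a b => (b \in S t0) && (off ==> (b != a)))
     (fun a b => Z a b * F a b)) /=.
  apply: eq_bigr => a _; rewrite [RHS]big_mkcondr /=; apply: eq_bigr => b _.
  have [->|ba] := eqVneq b a; last by rewrite implybT.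
  by case: (off) z => // z; rewrite z // mul0r.
have zA t0 : off -> forall i, A t0 i i = 0 by move=> _ i; exact: (block_diag0 HB).
rewrite dropd; last exact: zA.
apply: eq_bigr => p _.
rewrite (block_mulE HB).
rewrite (eq_bigr (fun c => \sum_(e in S t) A t c e *
   ((W1 *m K1 *m W2) p.2 c * (W3 *m K2 *m W4) e p.1))); last first.
  by move=> c _; apply: eq_bigr => e _; ring.
rewrite dropd; last exact: zA.
rewrite mulr_sumr; apply: eq_bigr => r _.
have U1 : (W1 *m K1 *m W2) p.2 r.1
   = \sum_(x | pairs off t' x) K1 x.1 x.2 * (W1 p.2 x.1 * W2 x.2 r.1).
  rewrite (supported_mulE _ _ _ _ s1) -(dropd t' K1 (fun a b => W1 p.2 a * W2 b r.1)) //; apply: eq_bigr => a _.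
  by apply: eq_bigr => b _; ring.
have U2 : (W3 *m K2 *m W4) r.2 p.1
   = \sum_(y | pairs off t' y) K2 y.1 y.2 * (W3 r.2 y.1 * W4 y.2 p.1).
  rewrite (supported_mulE _ _ _ _ s2) -(dropd t' K2 (fun a b => W3 r.2 a * W4 b p.1)) //; apply: eq_bigr => a _.
  by apply: eq_bigr => b _; ring.
rewrite U1 U2 big_distrlr /= !mulr_sumr; apply: eq_bigr => x _.
by rewrite !mulr_sumr; apply: eq_bigr => y _; ring.
Qed.

Variables (k : nat) (rho : J -> R).
Hypothesis rho_gt0 : forall t, 0 < rho t.
Local Notation K := (k.*2).

(** The function rho is a local radius for Y: it bounds the powers of Y up to K
    in the rows of each block, by entry_pow_le. *)
Definition block_radius (Y : 'M[R]_N) :=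
  Y^T = Y /\ forall t i, i \in S t -> (Y ^+ K) i i <= rho t ^+ K.

Let row_cross off t (G : pred J) (Y : 'I_4 -> 'M[R]_N) (r : 'I_4 -> nat)
    (a : 'I_4 -> 'I_N) :
  (forall i, block_radius (Y i)) -> (forall i, a i \in S t) ->
  (forall t', G t' -> rho t' <= rho t) ->
  (r 0%R + r 1%R + r 2%:R + r 3%:R <= K)%N ->
  \sum_(t' | G t')
     pair_sum off t' (fun s => `|(Y 0 ^+ r 0) (a 0) s|) (fun s => `|(Y 1 ^+ r 1) (a 1) s|)
   * pair_sum off t' (fun s => `|(Y 2%:R ^+ r 2%:R) (a 2%:R) s|)
                     (fun s => `|(Y 3%:R ^+ r 3%:R) (a 3%:R) s|)
  <= cross_const off * rho t ^+ (r 0%R + r 1%R + r 2%:R + r 3%:R).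
Proof.
move=> Yr aS Gr /two_small_exponents[rK rk]; rewrite !exprD.
apply: (@pair_cross off G (fun i s => `|(Y i ^+ r i) (a i) s|)
  (fun i => rho t ^+ r i) (fun i => (r i <= k)%N)) => //.
- by move=> i; rewrite exprn_ge0 // ltW.
- move=> i t' s Gt' sS; have [Ys Yd] := Yr i.
  apply: (@entry_pow_le R N (Y i) k) => //; first exact: ltW.
    by apply: Yd.
  apply: le_trans (Yd _ _ sS) _.
  by apply: lerXn2r; rewrite ?nnegrE ?(ltW (rho_gt0 _)) // (Gr t').
- move=> i rik; have [Ys Yd] := Yr i.
  rewrite (eq_bigr (fun s => (Y i ^+ r i) (a i) s ^+ 2)); last first.
    by move=> s _; rewrite -normrX ger0_norm // sqr_ge0.
  by apply: row_pow_le Ys (ltW (rho_gt0 t)) _ _ rik; exact: Yd.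
Qed.

(** Between two blocks run four powers of matrices.  All local factors are
    charged to the block with the larger radius, and then the other block is
    summed out with pair_cross. *)
Lemma cross_trace_le off (Y1 Y2 : 'M[R]_N) r1 r2 r3 r4 (K1 K2 : J -> 'M[R]_N)
    (c1 c2 : R) (g1 g2 : nat) :
  block_radius Y1 -> block_radius Y2 -> (r1 + r2 + r3 + r4 <= K)%N ->
  (forall t, supported S t (K1 t)) -> (forall t, supported S t (K2 t)) ->
  (off -> forall t i, K1 t i i = 0) -> (off -> forall t i, K2 t i i = 0) ->
  0 <= c1 -> 0 <= c2 ->
  (forall t, block_le S t (K1 t) (c1 * rho t ^+ g1)) ->
  (forall t, block_le S t (K2 t) (c2 * rho t ^+ g2)) ->
  \sum_t \sum_t' `|\tr (A t *m ((Y1 ^+ r1 *m K1 t' *m Y1 ^+ r2) *m A t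
       *m (Y2 ^+ r3 *m K2 t' *m Y2 ^+ r4)))|
  <= 2 * D%:R ^+ 4 * c1 * c2 * cross_const off
     * \sum_t rho t ^+ (r1 + r2 + r3 + r4 + g1 + g2).
Proof.
move=> R1 R2 rK s1 s2 z1 z2 c10 c20 b1 b2.
have [Y1s _] := R1; have [Y2s _] := R2.
pose Q t t' := \sum_(p | pairs off t p) \sum_(r | pairs off t r)
    \sum_(x | pairs off t' x) \sum_(y | pairs off t' y)
      (`|(Y1 ^+ r1) p.2 x.1| * `|(Y1 ^+ r2) x.2 r.1|)
      * (`|(Y2 ^+ r3) r.2 y.1| * `|(Y2 ^+ r4) y.2 p.1|).
have rho0 t n : 0 <= rho t ^+ n by rewrite exprn_ge0 // ltW.
have Qle t t' : `|\tr (A t *m ((Y1 ^+ r1 *m K1 t' *m Y1 ^+ r2) *m A t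
       *m (Y2 ^+ r3 *m K2 t' *m Y2 ^+ r4)))|
    <= c1 * c2 * rho t' ^+ (g1 + g2) * Q t t'.
  have z1' : off -> forall i, K1 t' i i = 0 by move=> o; exact: z1.
  have z2' : off -> forall i, K2 t' i i = 0 by move=> o; exact: z2.
  rewrite (trace_pairsE _ _ _ _ _ (s1 t') (s2 t') z1' z2').
  rewrite /Q; rewrite mulr_sumr; apply: le_trans (ler_norm_sum _ _ _) _.
  apply: ler_sum => p _; rewrite mulr_sumr; apply: le_trans (ler_norm_sum _ _ _) _.
  apply: ler_sum => r _; rewrite mulr_sumr; apply: le_trans (ler_norm_sum _ _ _) _.
  apply: ler_sum => x /and3P[x1 x2 _].
  rewrite mulr_sumr; apply: le_trans (ler_norm_sum _ _ _) _.
  apply: ler_sum => y /and3P[y1 y2 _].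
  rewrite normrM; apply: ler_pM; rewrite ?normr_ge0 //; last first.
    by rewrite !normrM !mulrA.
  rewrite !normrM exprD.
  rewrite (_ : _ * _ * (_ * _) = 1 * 1 * (c1 * rho t' ^+ g1) * (c2 * rho t' ^+ g2));
    last by ring.
  apply: ler_pM; rewrite ?mulr_ge0 ?normr_ge0 ?b2 //.
  apply: ler_pM; rewrite ?mulr_ge0 ?normr_ge0 ?b1 //.
  by apply: ler_pM; rewrite ?normr_ge0 ?(block_le1 HB).
have ge0Q t t' : 0 <= Q t t'.
  by do 4!apply: sumr_ge0 => ? _; rewrite !mulr_ge0.
have row1 t : \sum_(t' | rho t' <= rho t) Q t t'
    <= D%:R ^+ 4 * cross_const off * rho t ^+ (r1 + r2 + r3 + r4).
  rewrite /Q exchange_big /=.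
  under eq_bigr do rewrite exchange_big /=.
  pose c := cross_const off * rho t ^+ (r1 + r2 + r3 + r4).
  have c0 : 0 <= c by rewrite mulr_ge0 ?cross_const_ge0.
  apply: (@le_trans _ _ (\sum_(p | pairs off t p) \sum_(r | pairs off t r) c)).
    apply: ler_sum => p /and3P[p1 p2 _]; apply: ler_sum => r /and3P[q1 q2 _].
    have E t' : \sum_(x | pairs off t' x) \sum_(y | pairs off t' y)
        (`|(Y1 ^+ r1) p.2 x.1| * `|(Y1 ^+ r2) x.2 r.1|)
        * (`|(Y2 ^+ r3) r.2 y.1| * `|(Y2 ^+ r4) y.2 p.1|)
      = pair_sum off t' (fun s => `|(Y1 ^+ r1) p.2 s|) (fun s => `|(Y1 ^+ r2) r.1 s|)
      * pair_sum off t' (fun s => `|(Y2 ^+ r3) r.2 s|) (fun s => `|(Y2 ^+ r4) p.1 s|).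
      rewrite !pair_sumE big_distrlr /=; apply: eq_bigr => x _; apply: eq_bigr => y _.
      by rewrite (sym_pow r2 _ _ Y1s) (sym_pow r4 _ _ Y2s).
    rewrite (eq_bigr _ (fun t' _ => E t')).
    apply: (@row_cross off t (fun t' => rho t' <= rho t)
      (fun i => nth Y1 [:: Y1; Y1; Y2; Y2] i) (fun i => nth 0%N [:: r1; r2; r3; r4] i)
      (fun i => nth p.1 [:: p.2; r.1; r.2; p.1] i)) => //.
    - by move=> [[|[|[|[|]]]]].
    - by move=> [[|[|[|[|]]]]].
  apply: (@le_trans _ _ (\sum_(p | pairs off t p) D%:R ^+ 2 * c)).
    by apply: ler_sum => p _; exact: sum_pairs_le.
  apply: le_trans (sum_pairs_le _ _ _) _; first by rewrite mulr_ge0 ?exprn_ge0.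
  by rewrite /c; apply: le_of_eq; ring.
have cyc4 : (r4 + r1 + r2 + r3 = r1 + r2 + r3 + r4)%N by clear; lia.
have row2 t' : \sum_(t | ~~ (rho t' <= rho t)) Q t t'
    <= D%:R ^+ 4 * cross_const off * rho t' ^+ (r1 + r2 + r3 + r4).
  have Qx t : Q t t' = \sum_(x | pairs off t' x) \sum_(y | pairs off t' y)
    pair_sum off t (fun s => `|(Y2 ^+ r4) y.2 s|) (fun s => `|(Y1 ^+ r1) x.1 s|)
    * pair_sum off t (fun s => `|(Y1 ^+ r2) x.2 s|) (fun s => `|(Y2 ^+ r3) y.1 s|).
    rewrite /Q (eq_bigr _ (fun p _ => exchange_big _ _ _ _ _ _)) /= exchange_big /=.
    apply: eq_bigr => x _.
    rewrite (eq_bigr _ (fun p _ => exchange_big _ _ _ _ _ _)) /= exchange_big /=.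
    apply: eq_bigr => y _.
    rewrite !pair_sumE big_distrlr /=; apply: eq_bigr => p _; apply: eq_bigr => r _.
    by rewrite (sym_pow r1 x.1 _ Y1s) (sym_pow r3 y.1 _ Y2s); ring.
  rewrite (eq_bigr _ (fun t _ => Qx t)) exchange_big /=.
  under eq_bigr do rewrite exchange_big /=.
  pose c := cross_const off * rho t' ^+ (r1 + r2 + r3 + r4).
  have c0 : 0 <= c by rewrite mulr_ge0 ?cross_const_ge0.
  apply: (@le_trans _ _ (\sum_(p | pairs off t' p) \sum_(r | pairs off t' r) c)).
    apply: ler_sum => x /and3P[x1 x2 _]; apply: ler_sum => y /and3P[y1 y2 _].
    have -> : c = cross_const off * rho t' ^+ (r4 + r1 + r2 + r3).
      by rewrite /c; rewrite cyc4.
    apply: (@row_cross off t' (fun t => ~~ (rho t' <= rho t))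
      (fun i => nth Y1 [:: Y2; Y1; Y1; Y2] i) (fun i => nth 0%N [:: r4; r1; r2; r3] i)
      (fun i => nth x.1 [:: y.2; x.1; x.2; y.1] i)) => //;
      last by rewrite /= [leqLHS]cyc4.
    - by move=> [[|[|[|[|]]]]].
    - by move=> [[|[|[|[|]]]]].
    - by move=> t; rewrite -ltNge => /ltW.
  apply: (@le_trans _ _ (\sum_(p | pairs off t' p) D%:R ^+ 2 * c)).
    by apply: ler_sum => p _; exact: sum_pairs_le.
  apply: le_trans (sum_pairs_le _ _ _) _; first by rewrite mulr_ge0 ?exprn_ge0.
  by rewrite /c; apply: le_of_eq; ring.
pose B t := c1 * c2 * D%:R ^+ 4 * cross_const off * rho t ^+ (r1 + r2 + r3 + r4 + g1 + g2).
have cc0 : 0 <= c1 * c2 by rewrite mulr_ge0.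
apply: (@le_trans _ _ (\sum_t B t + \sum_t B t)); last first.
  rewrite /B -!mulr_sumr.
  by apply: le_of_eq; ring.
have split : \sum_t \sum_t' (c1 * c2 * rho t' ^+ (g1 + g2) * Q t t')
  = \sum_t (\sum_(t' | rho t' <= rho t) (c1 * c2 * rho t' ^+ (g1 + g2) * Q t t'))
  + \sum_t' (\sum_(t | ~~ (rho t' <= rho t)) (c1 * c2 * rho t' ^+ (g1 + g2) * Q t t')).
  rewrite [X in _ + X](exchange_big_dep xpredT) //= -big_split /=.
  by apply: eq_bigr => t _; rewrite [LHS](bigID (fun t' => rho t' <= rho t)).
apply: le_trans (ler_sum _ (fun t _ => ler_sum _ (fun t' _ => Qle t t'))) _.
rewrite split; apply: lerD; apply: ler_sum => t _.
  apply: (@le_trans _ _ (c1 * c2 * rho t ^+ (g1 + g2) * \sum_(t' | rho t' <= rho t) Q t t')).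
    rewrite mulr_sumr; apply: ler_sum => t' tt'.
    apply: ler_wpM2r => //; apply: ler_wpM2l => //.
    by apply: lerXn2r; rewrite ?nnegrE ?(ltW (rho_gt0 _)).
  apply: le_trans (ler_wpM2l _ (row1 t)) _; first by rewrite mulr_ge0.
  by rewrite /B !exprD; apply: le_of_eq; ring.
rewrite -mulr_sumr; apply: le_trans (ler_wpM2l _ (row2 t)) _; first by rewrite mulr_ge0.
by rewrite /B !exprD; apply: le_of_eq; ring.
Qed.

End Crossing.

(** * Random signs: differentiation in one sign *)

Section SignSums.
Variables (R : realType) (N : nat) (J : finType).
Variables (S : J -> {set 'I_N}) (A : J -> 'M[R]_N) (D m : nat).
Hypothesis HB : block_system S A D m.
Implicit Types (w : {ffun J -> bool}) (t : J).

Definition spin (b : bool) : R := (-1) ^+ b.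

Lemma spin_neg b : spin (~~ b) = - spin b.
Proof. by case: b; rewrite /spin /= ?expr0 ?expr1 ?opprK. Qed.

Lemma spin_sqr b : spin b * spin b = 1.
Proof. by rewrite -expr2 sqrr_sign. Qed.

Lemma normr_spin b : `|spin b| = 1.
Proof. exact: normr_sign. Qed.

Definition sgsum w : 'M[R]_N := block_sum A spin w.

Lemma sgsum_sym w : (sgsum w)^T = sgsum w.
Proof. exact: (block_sum_sym HB). Qed.

Lemma sgsum_flip w t : sgsum (flip w t) = sgsum w + (- (2 * spin (w t))) *: A t.
Proof.
rewrite /sgsum /flip block_sum_upd spin_neg !scaleNr -addrA -opprD -scalerDl.
by congr (_ - _ *: _); rewrite mulr_natl.
Qed.

Lemma sgsum_unflip w t : sgsum w = sgsum (flip w t) + (2 * spin (w t)) *: A t.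
Proof. by rewrite sgsum_flip scaleNr addrNK. Qed.

(** The discrete derivative of a power of the sign matrix in the sign of one
    block.  The second-order terms keep the flipped matrix in the middle, so
    that both outer factors are powers of the original matrix. *)
Lemma flip_derivative w t n :
  (2^-1 * spin (w t)) *: (sgsum w ^+ n - sgsum (flip w t) ^+ n)
  = \sum_(u < n) sgsum w ^+ u *m A t *m sgsum w ^+ (n.-1 - u)
  + \sum_(u < n) \sum_(v < n.-1 - u) sgsum w ^+ u
      *m ((- (2 * spin (w t))) *: (A t *m sgsum (flip w t) ^+ v *m A t))
      *m sgsum w ^+ ((n.-1 - u).-1 - v).
Proof.
rewrite {1}(sgsum_unflip w t) pow_telescope_rev addrAC subrr add0r.
rewrite -big_split /= scaler_sumr; apply: eq_bigr => u _.
rewrite -sgsum_unflip mulmx_scale_mid scalerA.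
have -> : 2^-1 * spin (w t) * (2 * spin (w t)) = 1.
  by rewrite mulrACA mulVf ?pnatr_eq0 // mul1r spin_sqr.
rewrite scale1r.
rewrite [X in _ *m X = _](_ : _ = sgsum w ^+ (n.-1 - u)
   + \sum_(v < n.-1 - u) sgsum (flip w t) ^+ v *m ((- (2 * spin (w t))) *: A t)
       *m sgsum w ^+ ((n.-1 - u).-1 - v)); last first.
  by rewrite {1}sgsum_flip pow_telescope_rev -sgsum_flip.
rewrite mulmxDr; congr (_ + _); rewrite mulmx_sumr; apply: eq_bigr => v _.
by rewrite -!scalemxAr -!scalemxAl -!scalemxAr !mulmxA.
Qed.

Variables (k : nat) (lam : R).
Hypotheses (k_gt0 : (0 < k)%N) (D_gt0 : (0 < D)%N) (lam_gt0 : 0 < lam).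
Local Notation K := (k.*2).

(** The analogue of pot for a pair of sign vectors and for the two vectors that
    differ from them in the sign of t. *)
Definition flip_pot w w' t : R :=
  lam ^+ K + \sum_(i in S t) ((sgsum w ^+ K) i i + (sgsum (flip w t) ^+ K) i i
    + (sgsum w' ^+ K) i i + (sgsum (flip w' t) ^+ K) i i).

Lemma sgsum_pow_diag_ge0 w i : 0 <= (sgsum w ^+ K) i i.
Proof. exact: (diag_pow_ge0 _ _ (sgsum_sym w)). Qed.

Lemma flip_pot_ge w w' t : lam ^+ K <= flip_pot w w' t.
Proof.
rewrite /flip_pot lerDl; apply: sumr_ge0 => i _.
by rewrite !addr_ge0 ?sgsum_pow_diag_ge0.
Qed.

Lemma flip_radius w w' : exists rho : J -> R,
  [/\ forall t, 0 < rho t, forall t, lam <= rho t,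
      forall t, rho t ^+ K = flip_pot w w' t,
      block_radius S k rho (sgsum w) /\ block_radius S k rho (sgsum w')
    & forall t n, (n <= K)%N ->
      block_le S t (sgsum (flip w t) ^+ n) (rho t ^+ n) /\
      block_le S t (sgsum (flip w' t) ^+ n) (rho t ^+ n)].
Proof.
have K_gt0 : (0 < K)%N by rewrite double_gt0.
have [|rho rhoP] := @boolp.choice _ _ (fun t r => 0 <= r /\ r ^+ K = flip_pot w w' t).
  move=> t.
  have [|r r0 rK] := @nonneg_root_exists R K (flip_pot w w' t) K_gt0; last by exists r.
  by apply: le_trans (flip_pot_ge w w' t); rewrite exprn_ge0 // ltW.
have lr t : lam <= rho t.
  have [r0 rK] := rhoP t; have := flip_pot_ge w w' t; rewrite -rK.
  by rewrite ler_pXn2r // nnegrE ltW.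
have d4 t i : i \in S t -> [/\ (sgsum w ^+ K) i i <= rho t ^+ K,
   (sgsum (flip w t) ^+ K) i i <= rho t ^+ K,
   (sgsum w' ^+ K) i i <= rho t ^+ K & (sgsum (flip w' t) ^+ K) i i <= rho t ^+ K].
  move=> iS; have [_ ->] := rhoP t; rewrite /flip_pot (bigD1 i) //=.
  set rest := (X in lam ^+ K + (_ + X)).
  have rest0 : 0 <= rest.
    by apply: sumr_ge0 => l _; rewrite !addr_ge0 ?sgsum_pow_diag_ge0.
  have l0 := exprn_gt0 K lam_gt0.
  have := sgsum_pow_diag_ge0 w i; have := sgsum_pow_diag_ge0 (flip w t) i.
  have := sgsum_pow_diag_ge0 w' i; have := sgsum_pow_diag_ge0 (flip w' t) i.
  by move: l0 rest0; clear; move=> ? ? ? ? ? ?; split; lra.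
exists rho; split.
- by move=> t; exact: (lt_le_trans lam_gt0 (lr t)).
- exact: lr.
- by move=> t; have [] := rhoP t.
- split; (split; first exact: sgsum_sym); by move=> t i /d4[].
- move=> t n nK; have [r0 _] := rhoP t.
  by split=> i j /d4[h1 h2 h3 h4] /d4[h1' h2' h3' h4'];
    apply: (@entry_pow_le R N _ k) => //; exact: sgsum_sym.
Qed.

Lemma flip_kernel_le w t v r : 0 <= r ->
  block_le S t (sgsum (flip w t) ^+ v) (r ^+ v) ->
  block_le S t ((- (2 * spin (w t))) *: (A t *m sgsum (flip w t) ^+ v *m A t))
    (2 * D%:R ^+ 4 * r ^+ v).
Proof.
move=> r0 hv.
have b1 : block_le S t (1%:M : 'M[R]_N) 1.
  by move=> i j _ _; rewrite mxE; case: (i == j); rewrite /= ?normr1 ?normr0 ?ler01.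
have rv : 0 <= r ^+ v by exact: exprn_ge0.
have h1 := block_le_mul HB rv ler01 hv b1.
rewrite mulmx1 mulr1 in h1.
have h2 := block_le_mul HB ler01 (mulr_ge0 (exprn_ge0 2 (ler0n R D)) rv) b1 h1.
rewrite mul1mx mul1r mulmxA in h2.
move=> i j iS jS; rewrite mxE normrM normrN normrM normr_spin mulr1 ger0_norm //.
rewrite -mulrA; apply: ler_wpM2l => //.
by apply: le_trans (h2 i j iS jS) _; rewrite mulrA -exprD.
Qed.

Lemma flip_kernel_supported w t v :
  supported S t ((- (2 * spin (w t))) *: (A t *m sgsum (flip w t) ^+ v *m A t)).
Proof.
move=> i j; rewrite mxE mulf_eq0 negb_or => /andP[_ AZA]; split.
  apply: contraNT AZA => iS; rewrite -mulmxA mxE big1 // => l _.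
  have /eqP-> : A t i l == 0 by apply: contraNT iS => /(block_supp HB)[].
  by rewrite mul0r.
apply: contraNT AZA => jS; rewrite mxE big1 // => l _.
have /eqP-> : A t l j == 0 by apply: contraNT jS => /(block_supp HB)[].
by rewrite mulr0.
Qed.

(** A word of degree n is charged to the mean size lam, and the surplus of the
    local radius to a single factor whose expectation is known. *)
Lemma radius_pow_le (r pt : R) n : lam <= r -> r ^+ K = pt -> (n <= K)%N ->
  r ^+ n <= lam ^+ n * (pt / lam ^+ K).
Proof.
move=> lr <- nK; have r0 : 0 < r by exact: lt_le_trans lr.
rewrite mulrA ler_pdivlMr ?exprn_gt0 //.
have -> : K = (n + (K - n))%N by move: nK; clear; lia.
rewrite !exprD [leRHS]mulrCA; do 2!(apply: ler_wpM2l; first by rewrite exprn_ge0 // ltW).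
by apply: lerXn2r; rewrite ?nnegrE // ltW.
Qed.

End SignSums.

(** * Decoupling the trace form *)

Section Decoupling.
Variables (R : realType) (N : nat) (J : finType).
Variables (S : J -> {set 'I_N}) (A : J -> 'M[R]_N) (D m : nat).
Hypothesis HB : block_system S A D m.
Implicit Types (w : {ffun J -> bool}) (t : J).
Variables (k : nat) (lam : R).
Hypotheses (k_gt0 : (0 < k)%N) (D_gt0 : (0 < D)%N) (lam_gt0 : 0 < lam).
Local Notation K := (k.*2).
Local Notation Y := (sgsum A).
Local Notation E0 := (expect (fair R)).
Local Notation fpot := (flip_pot S A k lam).

(** The two-block trace form whose expectation has to be decoupled. *)
Definition btr t (U V : 'M[R]_N) : R := \tr (A t *m (U *m A t *m V)).

Lemma btrDl t U1 U2 V : btr t (U1 + U2) V = btr t U1 V + btr t U2 V.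
Proof. by rewrite /btr !mulmxDl mulmxDr linearD. Qed.

Lemma btrDr t U V1 V2 : btr t U (V1 + V2) = btr t U V1 + btr t U V2.
Proof. by rewrite /btr !mulmxDr linearD. Qed.

Lemma btrZl t c U V : btr t (c *: U) V = c * btr t U V.
Proof. by rewrite /btr -!scalemxAl -scalemxAr linearZ. Qed.

Lemma btrZr t c U V : btr t U (c *: V) = c * btr t U V.
Proof. by rewrite /btr -!scalemxAr linearZ. Qed.

Lemma btr_suml (I : finType) (Q : pred I) t U V :
  btr t (\sum_(i | Q i) U i) V = \sum_(i | Q i) btr t (U i) V.
Proof. by rewrite /btr !mulmx_suml mulmx_sumr raddf_sum. Qed.

Lemma btr_sumr (I : finType) (Q : pred I) t U V :
  btr t U (\sum_(i | Q i) V i) = \sum_(i | Q i) btr t U (V i).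
Proof. by rewrite /btr !mulmx_sumr raddf_sum. Qed.

(** The discrete derivative of a power in the sign of t, see flip_derivative. *)
Definition dflip w t n : 'M[R]_N :=
  (2^-1 * spin R (w t)) *: (Y w ^+ n - Y (flip w t) ^+ n).

Section Pointwise.
Variables w w' : {ffun J -> bool}.
Let total := \sum_t fpot w w' t / lam ^+ K.

Lemma fpot_gt0 t : 0 < fpot w w' t.
Proof. by apply: lt_le_trans (flip_pot_ge HB k lam w w' t); rewrite exprn_gt0. Qed.

Let total_ge0 : 0 <= total.
Proof.
by apply: sumr_ge0 => t _; rewrite divr_ge0 ?exprn_ge0 // ltW // fpot_gt0.
Qed.

(** Three matrices of the same block leave no sum over another block, so the word
    loses two degrees. *)
Lemma third_order_le t n : (n <= K)%N ->
  `|\sum_(u < n) \sum_(v < n.-1 - u) \tr (A t *m (Y w ^+ u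
      *m ((- (2 * spin R (w t))) *: (A t *m Y (flip w t) ^+ v *m A t))
      *m Y w ^+ ((n.-1 - u).-1 - v)))|
  <= 2 * D%:R ^+ 6 * K%:R ^+ 2 * (lam ^+ n / lam ^+ 2) * (fpot w w' t / lam ^+ K).
Proof.
move=> nK; have [rho [rho0 lrho rhoK [r1 _] bl]] := flip_radius HB k_gt0 lam_gt0 w w'.
have [Ys Yd] := r1.
have blY q : (q <= K)%N -> block_le S t (Y w ^+ q) (rho t ^+ q).
  move=> qK i j iS jS; apply: (@entry_pow_le R N _ k) => //; first exact/ltW.
    exact: Yd.
  exact: Yd.
set c := 2 * D%:R ^+ 6 * (lam ^+ n / lam ^+ 2) * (fpot w w' t / lam ^+ K).
have c0 : 0 <= c.
  rewrite /c; have := ltW (fpot_gt0 t); have l0 := ltW lam_gt0 => f0.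
  by rewrite !mulr_ge0 ?invr_ge0 ?exprn_ge0.
rewrite (_ : 2 * _ * _ * _ * _ = K%:R * (K%:R * c)); last by rewrite /c; ring.
have each u v : (u < n)%N -> (v < n.-1 - u)%N -> `|\tr (A t *m (Y w ^+ u
      *m ((- (2 * spin R (w t))) *: (A t *m Y (flip w t) ^+ v *m A t))
      *m Y w ^+ ((n.-1 - u).-1 - v)))| <= c.
  move=> un vn; set q := ((n.-1 - u).-1 - v)%N.
  have deg : n = (u + v + q + 2)%N by rewrite /q; lia.
  have -> : \tr (A t *m (Y w ^+ u *m ((- (2 * spin R (w t))) *: (A t *m Y (flip w t) ^+ v *m A t))
      *m Y w ^+ q)) = (- (2 * spin R (w t))) *
      \tr (A t *m ((Y w ^+ u *m A t *m Y (flip w t) ^+ v) *m A t *m Y w ^+ q)).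
    by rewrite -scalemxAr -scalemxAl -scalemxAr linearZ /= !mulmxA.
  rewrite normrM normrN normrM normr_spin mulr1 ger0_norm //.
  have rq l : 0 <= rho t ^+ l by rewrite exprn_ge0 // ltW.
  have bq : block_le S t (Y w ^+ q) (rho t ^+ q) by apply: blY; lia.
  have bu : block_le S t (Y w ^+ u) (rho t ^+ u) by apply: blY; lia.
  have bv : block_le S t (Y (flip w t) ^+ v) (rho t ^+ v).
    by have [|] := bl t v; first lia.
  have b2 := block_le_mul HB (rq u) (rq v) bu bv.
  have D2 : 0 <= D%:R ^+ 2 * (rho t ^+ u * rho t ^+ v) by rewrite !mulr_ge0.
  have b3 := block_le_mul HB D2 (rq q) b2 bq.
  have b4 := block_le_trace HB (mulr_ge0 (exprn_ge0 2 (ler0n R D)) (mulr_ge0 D2 (rq q))) b3.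
  apply: le_trans (ler_wpM2l (ler0n R 2) b4) _.
  rewrite /c [leLHS](_ : _ = 2 * D%:R ^+ 6 * rho t ^+ (u + v + q)); last first.
    by rewrite !exprD; ring.
  rewrite -[leRHS]mulrA; apply: ler_wpM2l; first by rewrite mulr_ge0 ?exprn_ge0.
  have -> : lam ^+ n / lam ^+ 2 = lam ^+ (u + v + q).
    by rewrite deg exprD mulfK // expf_neq0 // gt_eqF.
  by apply: radius_pow_le => //; lia.
apply: le_trans (ler_norm_sum _ _ _) _.
apply: (@le_trans _ _ (\sum_(u < n) (K%:R * c))); last first.
  by rewrite sum_ord_cst; apply: ler_wpM2r; [exact: mulr_ge0|rewrite ler_nat].
apply: ler_sum => u _; apply: le_trans (ler_norm_sum _ _ _) _.
apply: (@le_trans _ _ (\sum_(v < n.-1 - u) c)).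
  by apply: ler_sum => v _; apply: each.
rewrite sum_ord_cst; apply: ler_wpM2r => //; rewrite ler_nat.
by have := ltn_ord u; move: nK; clear; lia.
Qed.

(* The sums of words to which cross_trace_le is applied; e1 and e2 count the
   degrees that are lost to the block matrices. *)
Let cross_words (off : bool) (I1 I2 : finType) (Q1 : pred I1) (Q2 : pred I2)
   (u1 q1 g1 : I1 -> nat) (u2 q2 g2 : I2 -> nat)
   (K1 : I1 -> J -> 'M[R]_N) (K2 : I2 -> J -> 'M[R]_N) (c1 c2 : R) (a b e1 e2 : nat)
   (n1 n2 : nat) (rho : J -> R) :
  (forall t, 0 < rho t) -> (forall t, lam <= rho t) ->
  (forall t, rho t ^+ K = fpot w w' t) ->
  block_radius S k rho (Y w) -> block_radius S k rho (Y w') ->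
  (a + b <= K)%N -> 0 <= c1 -> 0 <= c2 ->
  (forall i, Q1 i -> u1 i + q1 i + g1 i + e1 = a)%N ->
  (forall i, Q2 i -> u2 i + q2 i + g2 i + e2 = b)%N ->
  (forall i t, supported S t (K1 i t)) -> (forall i t, supported S t (K2 i t)) ->
  (off -> forall i t l, K1 i t l l = 0) -> (off -> forall i t l, K2 i t l l = 0) ->
  (forall i t, Q1 i -> block_le S t (K1 i t) (c1 * rho t ^+ g1 i)) ->
  (forall i t, Q2 i -> block_le S t (K2 i t) (c2 * rho t ^+ g2 i)) ->
  (#|Q1| <= n1)%N -> (#|Q2| <= n2)%N ->
  `|\sum_t \sum_t' btr t (\sum_(i | Q1 i) Y w ^+ u1 i *m K1 i t' *m Y w ^+ q1 i)
                         (\sum_(i | Q2 i) Y w' ^+ u2 i *m K2 i t' *m Y w' ^+ q2 i)|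
  <= n1%:R * n2%:R * (2 * D%:R ^+ 4 * c1 * c2 * cross_const R D m off
       * (lam ^+ (a + b) / lam ^+ (e1 + e2) * total)).
Proof.
move=> rho0 lrho rhoK R1 R2 abK c10 c20 h1 h2 s1 s2 z1 z2 b1 b2 n1P n2P.
set X := (X in _ <= _ * X).
have X0 : 0 <= X.
  rewrite /X; have l0 := ltW lam_gt0.
  by rewrite !mulr_ge0 ?invr_ge0 ?exprn_ge0 ?cross_const_ge0.
have E : \sum_t \sum_t' btr t (\sum_(i | Q1 i) Y w ^+ u1 i *m K1 i t' *m Y w ^+ q1 i)
                         (\sum_(i | Q2 i) Y w' ^+ u2 i *m K2 i t' *m Y w' ^+ q2 i)
   = \sum_(i | Q1 i) \sum_(j | Q2 j) \sum_t \sum_t'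
       btr t (Y w ^+ u1 i *m K1 i t' *m Y w ^+ q1 i)
             (Y w' ^+ u2 j *m K2 j t' *m Y w' ^+ q2 j).
  under eq_bigr => t _.
    under eq_bigr => t' _.
      rewrite btr_suml; under eq_bigr do rewrite btr_sumr.
    over.
    rewrite exchange_big /=; under eq_bigr do rewrite exchange_big /=.
  over.
  by rewrite exchange_big /=; apply: eq_bigr => i _; rewrite exchange_big.
rewrite E; apply: le_trans (ler_norm_sum _ _ _) _.
apply: (@le_trans _ _ (\sum_(i | Q1 i) \sum_(j | Q2 j) X)); last first.
  rewrite !sumr_const -mulrnA -[X *+ _]mulr_natl -natrM; apply: ler_wpM2r => //.
  by rewrite ler_nat mulnC; exact: leq_mul.
apply: ler_sum => i Qi; apply: le_trans (ler_norm_sum _ _ _) _.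
apply: ler_sum => j Qj; apply: le_trans (ler_norm_sum _ _ _) _.
apply: (@le_trans _ _ (\sum_t \sum_t' `|btr t (Y w ^+ u1 i *m K1 i t' *m Y w ^+ q1 i)
             (Y w' ^+ u2 j *m K2 j t' *m Y w' ^+ q2 j)|)).
  by apply: ler_sum => t _; exact: ler_norm_sum.
have h1' := h1 i Qi; have h2' := h2 j Qj.
have rK : (u1 i + q1 i + u2 j + q2 j <= K)%N.
  by move: h1' h2' abK; clear; lia.
have := cross_trace_le HB rho0 (off := off) R1 R2 rK (s1 i) (s2 j)
  (fun o => z1 o i) (fun o => z2 o j) c10 c20 (fun t => b1 i t Qi) (fun t => b2 j t Qj).
move=> H; apply: le_trans H _; rewrite /X.
apply: ler_wpM2l.
  by rewrite !mulr_ge0 ?exprn_ge0 ?cross_const_ge0.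
rewrite /total mulr_sumr; apply: ler_sum => t _.
have -> : lam ^+ (a + b) / lam ^+ (e1 + e2)
    = lam ^+ (u1 i + q1 i + u2 j + q2 j + g1 i + g2 j).
  rewrite (_ : (a + b = u1 i + q1 i + u2 j + q2 j + g1 i + g2 j + (e1 + e2))%N).
    by rewrite exprD mulfK // expf_neq0 // gt_eqF.
  by move: h1' h2'; clear; lia.
apply: radius_pow_le => //.
by move: h1' h2' abK; clear; lia.
Qed.

(** The derivatives consist of words with one and with two block matrices. The
    former have zero diagonal, and then crossing only costs sqrt m for two lost
    degrees; all other combinations lose at least three degrees for the cost m.
    Since m is at most lam^2, one degree is gained in every case. *)
Lemma cross_pointwise_le a b : (a + b <= K)%N -> m%:R <= lam ^+ 2 -> K%:R <= lam ->
  `|\sum_t \sum_t' btr t (dflip w t' a) (dflip w' t' b)|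
  <= 18 * D%:R ^+ 15 * K%:R ^+ 3 * (lam ^+ (a + b) / lam) * total.
Proof.
move=> abK mlam Klam.
have [rho [rho0 lrho rhoK [R1 R2] bl]] := flip_radius HB k_gt0 lam_gt0 w w'.
pose Q n (p : 'I_n * 'I_n) := (p.2 < n.-1 - p.1)%N.
pose P1 w n t' : 'M[R]_N := \sum_(u < n | true) Y w ^+ u *m A t' *m Y w ^+ (n.-1 - u).
pose kern w (v : nat) t' := (- (2 * spin R (w t'))) *: (A t' *m Y (flip w t') ^+ v *m A t').
pose P2 w n t' : 'M[R]_N := \sum_(p | Q n p) Y w ^+ p.1 *m kern w p.2 t'
   *m Y w ^+ ((n.-1 - p.1).-1 - p.2).
have dE v n t' : dflip v t' n = P1 v n t' + P2 v n t'.
  rewrite /dflip flip_derivative; congr (_ + _).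
  rewrite /P2 /Q -(pair_big_dep xpredT (fun u v : 'I_n => v < n.-1 - u)%N
     (fun u v0 : 'I_n => Y v ^+ u *m kern v v0 t' *m Y v ^+ ((n.-1 - u).-1 - v0))) /=.
  apply: eq_bigr => u _.
  rewrite (big_ord_widen n (fun v0 => Y v ^+ u *m kern v v0 t' *m Y v ^+ ((n.-1 - u).-1 - v0))) //.
  by rewrite leq_subLR; have := ltn_ord u; lia.
have bA t : block_le S t (A t) (1 * rho t ^+ 0).
  by move=> i j _ _; rewrite mul1r expr0; exact: block_le1 HB t i j.
have sA t : supported S t (A t) by exact: (block_supported HB).
have zA t l : A t l l = 0 by exact: (block_diag0 HB).
have bk v t n : (v <= K)%N -> block_le S t (Y (flip n t) ^+ v) (rho t ^+ v) ->
    block_le S t (kern n v t) (2 * D%:R ^+ 4 * rho t ^+ v).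
  by move=> vK; apply: (flip_kernel_le HB); exact: ltW.
have sk v t n : supported S t (kern n v t) by exact: (flip_kernel_supported HB).
have cQ n : (n <= K)%N -> (#|Q n| <= K * K)%N.
  move=> nK; apply: leq_trans (max_card _) _.
  by rewrite card_prod card_ord leq_mul.
have dQ n (p : 'I_n * 'I_n) : Q n p -> (p.1 + ((n.-1 - p.1).-1 - p.2) + p.2 + 2 = n)%N.
  by case: p => [[u un] [v vn]]; rewrite /Q /=; clear; lia.
have d1 n (u : 'I_n) : (u + (n.-1 - u) + 0 + 1 = n)%N.
  by have := ltn_ord u; clear; lia.
have c1 n : (n <= K)%N -> (#|[pred u : 'I_n | true]| <= K)%N.
  by move=> nK; apply: leq_trans (max_card _) _; rewrite card_ord.
have aK : (a <= K)%N by exact: leq_trans (leq_addr _ _) abK.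
have bK : (b <= K)%N by exact: leq_trans (leq_addl _ _) abK.
have c4 : 0 <= 2 * D%:R ^+ 4 :> R by rewrite mulr_ge0 ?exprn_ge0.
have bkQ v n (p : 'I_n * 'I_n) t : (v = w \/ v = w') -> (n <= K)%N -> Q n p ->
    block_le S t (kern v p.2 t) (2 * D%:R ^+ 4 * rho t ^+ p.2).
  move=> vw nK Qp; have pK : (p.2 <= K)%N by have := ltn_ord p.2; move: nK; clear; lia.
  apply: bk => //; have [h h'] := bl t p.2 pK.
  by case: vw => ->.
have E11 : `|\sum_t \sum_t' btr t (P1 w a t') (P1 w' b t')|
  <= K%:R * K%:R * (2 * D%:R ^+ 4 * 1 * 1 * cross_const R D m true
       * (lam ^+ (a + b) / lam ^+ (1 + 1) * total)).
  apply: (@cross_words true _ _ _ _ (fun u : 'I_a => u) (fun u : 'I_a => a.-1 - u)%N (fun=> 0%N)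
   (fun u : 'I_b => u) (fun u : 'I_b => b.-1 - u)%N (fun=> 0%N) (fun=> A) (fun=> A) 1 1 a b 1 1
   K K rho) => //; by [move=> *; exact: c1|move=> *; exact: bA|exact: c1].
have E12 : `|\sum_t \sum_t' btr t (P1 w a t') (P2 w' b t')|
  <= K%:R * (K * K)%:R * (2 * D%:R ^+ 4 * 1 * (2 * D%:R ^+ 4) * cross_const R D m false
       * (lam ^+ (a + b) / lam ^+ (1 + 2) * total)).
  apply: (@cross_words false _ _ _ _ (fun u : 'I_a => u) (fun u : 'I_a => a.-1 - u)%N (fun=> 0%N)
   (fun p : 'I_b * 'I_b => p.1) (fun p : 'I_b * 'I_b => (b.-1 - p.1).-1 - p.2)%N
   (fun p : 'I_b * 'I_b => p.2) (fun=> A) (fun p : 'I_b * 'I_b => kern w' p.2) 1 _ a b 1 2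
   K (K * K) rho) => //.
  - by move=> p; exact: dQ.
  - by move=> i t Qi; apply: bkQ => //; right.
  - exact: c1.
  - exact: cQ.
have E21 : `|\sum_t \sum_t' btr t (P2 w a t') (P1 w' b t')|
  <= (K * K)%:R * K%:R * (2 * D%:R ^+ 4 * (2 * D%:R ^+ 4) * 1 * cross_const R D m false
       * (lam ^+ (a + b) / lam ^+ (2 + 1) * total)).
  apply: (@cross_words false _ _ _ _ (fun p : 'I_a * 'I_a => p.1)
   (fun p : 'I_a * 'I_a => (a.-1 - p.1).-1 - p.2)%N (fun p : 'I_a * 'I_a => p.2)
   (fun u : 'I_b => u) (fun u : 'I_b => b.-1 - u)%N (fun=> 0%N)
   (fun p : 'I_a * 'I_a => kern w p.2) (fun=> A) _ 1 a b 2 1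
   (K * K) K rho) => //.
  - by move=> p; exact: dQ.
  - by move=> i t Qi; apply: bkQ => //; left.
  - exact: cQ.
  - exact: c1.
have E22 : `|\sum_t \sum_t' btr t (P2 w a t') (P2 w' b t')|
  <= (K * K)%:R * (K * K)%:R * (2 * D%:R ^+ 4 * (2 * D%:R ^+ 4) * (2 * D%:R ^+ 4)
       * cross_const R D m false * (lam ^+ (a + b) / lam ^+ (2 + 2) * total)).
  apply: (@cross_words false _ _ _ _ (fun p : 'I_a * 'I_a => p.1)
   (fun p : 'I_a * 'I_a => (a.-1 - p.1).-1 - p.2)%N (fun p : 'I_a * 'I_a => p.2)
   (fun p : 'I_b * 'I_b => p.1) (fun p : 'I_b * 'I_b => (b.-1 - p.1).-1 - p.2)%N
   (fun p : 'I_b * 'I_b => p.2)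
   (fun p : 'I_a * 'I_a => kern w p.2) (fun p : 'I_b * 'I_b => kern w' p.2) _ _ a b 2 2
   (K * K) (K * K) rho) => //.
  - by move=> p; exact: dQ.
  - by move=> p; exact: dQ.
  - by move=> i t Qi; apply: bkQ => //; left.
  - by move=> i t Qi; apply: bkQ => //; right.
  - exact: cQ.
  - exact: cQ.
have split : \sum_t \sum_t' btr t (dflip w t' a) (dflip w' t' b)
  = \sum_t \sum_t' btr t (P1 w a t') (P1 w' b t')
  + \sum_t \sum_t' btr t (P1 w a t') (P2 w' b t')
  + \sum_t \sum_t' btr t (P2 w a t') (P1 w' b t')
  + \sum_t \sum_t' btr t (P2 w a t') (P2 w' b t').
  rewrite -!big_split /=; apply: eq_bigr => t _; rewrite -!big_split /=.
  by apply: eq_bigr => t' _; rewrite !dE !(btrDl, btrDr); ring.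
rewrite split.
apply: le_trans (ler_normD _ _) _; apply: le_trans (lerD (ler_normD _ _) E22) _.
apply: le_trans (lerD (lerD (ler_normD _ _) E21) (lexx _)) _.
apply: le_trans (lerD (lerD (lerD E11 E12) (lexx _)) (lexx _)) _.
rewrite /cross_const sqrtrM // natrM.
set d : R := D%:R; set x : R := K%:R; set M : R := m%:R; set L := lam ^+ (a + b).
have d1' : 1 <= d by rewrite ler1n.
have x0 : 0 <= x by [].
have L0 : 0 <= L by rewrite exprn_ge0 // ltW.
have x1 : 1 <= x by rewrite ler1n double_gt0.
have sM2 : M = Num.sqrt M ^+ 2 by rewrite sqr_sqrtr.
set sd := Num.sqrt d; set sM := Num.sqrt M; rewrite -/sM in sM2.
have sd0 : 0 <= sd by exact: sqrtr_ge0.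
have sdd : sd <= d.
  rewrite -(ler_pXn2r (isT : (0 < 2)%N)) ?nnegrE // sqr_sqrtr // expr2.
  by rewrite ler_peMl.
have sM0 : 0 <= sM by exact: sqrtr_ge0.
have sMl : sM <= lam.
  by rewrite -(ler_pXn2r (isT : (0 < 2)%N)) ?nnegrE ?(ltW lam_gt0) // -sM2.
pose r := sM / lam; pose z := x / lam; pose Z := L / lam * total.
have r0 : 0 <= r by rewrite divr_ge0 // ltW.
have r1 : r <= 1 by rewrite ler_pdivrMr // mul1r.
have z0 : 0 <= z by rewrite divr_ge0 // ltW.
have z1 : z <= 1 by rewrite ler_pdivrMr // mul1r.
have Z0 : 0 <= Z by rewrite mulr_ge0 // divr_ge0 // ltW.
have ln0 : lam != 0 by rewrite gt_eqF.
rewrite [leLHS](_ : _ = (2 * ((d ^+ 6 * sd) * (r * x ^+ 2)) + 8 * (d ^+ 11 * (r ^+ 2 * x ^+ 3))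
   + 8 * (d ^+ 15 * ((r ^+ 2 * z) * x ^+ 3))) * Z); last first.
  by rewrite /Z /r /z sM2; field.
rewrite [leRHS](_ : _ = 18 * (d ^+ 15 * x ^+ 3) * Z); last by rewrite /Z; field.
apply: ler_wpM2r => //; clearbody r z.
have dn n : 0 <= d ^+ n by exact: exprn_ge0.
have xn n : 0 <= x ^+ n by exact: exprn_ge0.
have rn : r ^+ 2 <= 1 by rewrite expr_le1.
have i1 : d ^+ 6 * sd * (r * x ^+ 2) <= d ^+ 15 * x ^+ 3.
  apply: ler_pM; rewrite ?mulr_ge0 //.
    apply: (@le_trans _ _ (d ^+ 6 * d)); first exact: (ler_wpM2l (dn 6) sdd).
    by rewrite -exprSr ler_weXn2l.
  rewrite -[leRHS]mul1r; apply: ler_pM => //; exact: ler_weXn2l.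
have i2 : d ^+ 11 * (r ^+ 2 * x ^+ 3) <= d ^+ 15 * x ^+ 3.
  apply: ler_pM; rewrite ?mulr_ge0 ?exprn_ge0 //; first exact: ler_weXn2l.
  by rewrite -[leRHS]mul1r; apply: ler_pM; rewrite ?exprn_ge0.
have i3 : d ^+ 15 * ((r ^+ 2 * z) * x ^+ 3) <= d ^+ 15 * x ^+ 3.
  apply: ler_wpM2l => //; rewrite -[leRHS]mul1r; apply: ler_wpM2r => //.
  by rewrite -[leRHS]mul1r; apply: ler_pM; rewrite ?exprn_ge0.
lra.
Qed.

End Pointwise.
End Decoupling.

Section MomentRecursion.
Variables (R : realType) (N : nat) (J : finType).
Variables (S : J -> {set 'I_N}) (A : J -> 'M[R]_N) (D m : nat).
Hypothesis HB : block_system S A D m.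
Implicit Types (w : {ffun J -> bool}) (t : J).
Variables (k : nat) (lam : R).
Hypotheses (k_gt0 : (0 < k)%N) (D_gt0 : (0 < D)%N) (lam_gt0 : 0 < lam).
Local Notation K := (k.*2).
Local Notation Y := (sgsum A).
Local Notation E0 := (expect (fair R)).
Local Notation fpot := (flip_pot S A k lam).
Hypothesis moment_le : E0 (fun w => \tr (Y w ^+ K)) <= N%:R * lam ^+ K.

(** Flipping a sign preserves the law, so each of the four powers contributes m
    times its trace. *)
Lemma expect_flip_pot (V : finType) (mu : V -> R) (h1 h2 : V -> bool) :
  (forall v, 0 <= mu v) -> \sum_v mu v = 1 ->
  (forall F, expect mu (fun w : {ffun J -> V} => F [ffun j => h1 (w j)]) = E0 F) ->
  (forall F, expect mu (fun w : {ffun J -> V} => F [ffun j => h2 (w j)]) = E0 F) ->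
  expect mu (fun w : {ffun J -> V} => \sum_t fpot [ffun j => h1 (w j)] [ffun j => h2 (w j)] t / lam ^+ K)
    <= 5 * m%:R * N%:R.
Proof.
move=> mu0 mu1 H1 H2.
pose g w := \sum_t \sum_(i in S t) (Y w ^+ K) i i.
pose gf w := \sum_t \sum_(i in S t) (Y (flip w t) ^+ K) i i.
have lK : 0 < lam ^+ K by rewrite exprn_gt0.
have Eg : E0 g <= m%:R * (N%:R * lam ^+ K).
  rewrite (eq_expect _ (G := fun w => m%:R * \tr (Y w ^+ K))) ?expectZ.
    by apply: ler_wpM2l.
  by move=> w; rewrite /g (sum_blocks HB).
have Egf : E0 gf <= m%:R * (N%:R * lam ^+ K).
  rewrite /gf expect_sum; apply: le_trans Eg; rewrite /g expect_sum.
  apply: ler_sum => t _.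
  by rewrite (expect_flip t (fun w => \sum_(i in S t) (Y w ^+ K) i i)).
rewrite (eq_expect _ (G := fun w : {ffun J -> V} => #|J|%:R + (lam ^+ K)^-1 *
   (g [ffun j => h1 (w j)] + gf [ffun j => h1 (w j)]
   + g [ffun j => h2 (w j)] + gf [ffun j => h2 (w j)]))); last first.
  move=> w; rewrite -mulr_suml mulrC /flip_pot big_split /= sumr_const.
  rewrite mulrDr -[_ *+ #|_|]mulr_natl mulrCA mulVf ?gt_eqF // mulr1; congr (_ + _ * _).
  rewrite /g /gf -!big_split /=; apply: eq_bigr => t _.
  by rewrite -!big_split.
rewrite expectD expect_cst // expectZ !expectD !(H1 g, H1 gf, H2 g, H2 gf).
have Jle : #|J|%:R <= m%:R * N%:R :> R.
  by rewrite -natrM ler_nat [leqRHS]mulnC -(card_blocks HB) leq_pmulr.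
have : (lam ^+ K)^-1 * (E0 g + E0 gf + E0 g + E0 gf) <= 4 * m%:R * N%:R.
  rewrite mulrC ler_pdivrMr // -!mulrA; lra.
lra.
Qed.

Let id_law (F : {ffun J -> bool} -> R) :
  E0 (fun w => F [ffun j => id (w j)]) = E0 F.
Proof.
by apply: eq_expect => w; congr F; apply/ffunP => j; rewrite ffunE.
Qed.

(** Integration by parts in one sign, applied to the first factor of a power. *)
Lemma moment_step n : (n < K)%N ->
  `|E0 (fun w => \tr (Y w ^+ n.+1))
    - E0 (fun w => \sum_t \sum_(u < n) btr A t (Y w ^+ u) (Y w ^+ (n.-1 - u)))|
  <= 10 * D%:R ^+ 6 * K%:R ^+ 2 * m%:R * N%:R * (lam ^+ n / lam ^+ 2).
Proof.
move=> nK.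
pose third w t := \sum_(u < n) \sum_(v < n.-1 - u) \tr (A t *m (Y w ^+ u
      *m ((- (2 * spin R (w t))) *: (A t *m Y (flip w t) ^+ v *m A t))
      *m Y w ^+ ((n.-1 - u).-1 - v))).
have E : E0 (fun w => \tr (Y w ^+ n.+1))
  = E0 (fun w => \sum_t (\sum_(u < n) btr A t (Y w ^+ u) (Y w ^+ (n.-1 - u)) + third w t)).
  transitivity (E0 (fun w => \sum_t spin R (w t) * \tr (A t *m Y w ^+ n))).
    apply: eq_expect => w; rewrite exprS [X in \tr (X * _)]/sgsum /block_sum.
    by rewrite mulr_suml raddf_sum; apply: eq_bigr => t _ /=; rewrite -linearZ /= scalemxAl.
  rewrite !expect_sum; apply: eq_bigr => t _.
  pose G w := spin R (w t) * \tr (A t *m Y w ^+ n).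
  transitivity (E0 (fun w => 2^-1 * (G w + G (flip w t)))).
    have half (e : R) : 2^-1 * (e + e) = e by lra.
    by rewrite expectZ expectD expect_flip half.
  apply: eq_expect => w; rewrite /third.
  transitivity (\tr (A t *m dflip A w t n)).
    rewrite /G /dflip -scalemxAr linearZ /= mulmxBr linearB /=.
    by rewrite {2}/flip upd_eq spin_neg; ring.
  rewrite /dflip flip_derivative mulmxDr linearD /=; congr (_ + _).
    by rewrite mulmx_sumr raddf_sum.
  rewrite mulmx_sumr raddf_sum; apply: eq_bigr => u _.
  by rewrite mulmx_sumr raddf_sum.
rewrite E -[X in _ - X]mul1r -[_ - _]/(_ + _) -mulNr -expectZ -expectD.
rewrite (eq_expect _ (G := fun w => \sum_t third w t)); last first.
  by move=> w; rewrite big_split /=; ring.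
apply: le_trans (ler_norm_expect (fair_ge0 R) _) _.
set c := 2 * D%:R ^+ 6 * K%:R ^+ 2 * (lam ^+ n / lam ^+ 2).
have c0 : 0 <= c by rewrite !mulr_ge0 ?invr_ge0 ?exprn_ge0 // ltW.
apply: (@le_trans _ _ (E0 (fun w => c * \sum_t fpot w w t / lam ^+ K))).
  apply: ler_expect => [|w]; first exact: fair_ge0.
  apply: le_trans (ler_norm_sum _ _ _) _; rewrite mulr_sumr.
  by apply: ler_sum => t _; apply: (third_order_le HB) => //; exact: ltnW.
rewrite expectZ.
have H := expect_flip_pot (fair_ge0 R) (fair_sum R) id_law id_law.
rewrite [leRHS](_ : _ = c * (5 * m%:R * N%:R)); last by rewrite /c; ring.
apply: ler_wpM2l => //; apply: le_trans H; apply: le_of_eq; apply: eq_expect => w; apply: eq_bigr => t _; congr (_ / _).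
by congr (flip_pot _ _ _ _ _ _ _); apply/ffunP => j; rewrite ffunE.
Qed.

Definition meanpow n : 'M[R]_N := \matrix_(i, j) E0 (fun w => (Y w ^+ n) i j).

Lemma meanpowE n : meanpow n = \sum_(w : {ffun J -> bool}) (\prod_j fair R (w j)) *: Y w ^+ n.
Proof.
by apply/matrixP => i j; rewrite mxE summxE; apply: eq_bigr => w _; rewrite mxE.
Qed.

Lemma btr_meanpow t a b : btr A t (meanpow a) (meanpow b)
  = E0 (fun w1 => E0 (fun w2 => btr A t (Y w1 ^+ a) (Y w2 ^+ b))).
Proof.
rewrite !meanpowE btr_suml; apply: eq_bigr => w1 _.
rewrite btrZl btr_sumr; congr (_ * _); apply: eq_bigr => w2 _.
by rewrite btrZr.
Qed.

(* The laws of a pair of independent signs and of a pair of equal signs. *)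
Let m0 (v : bool * bool) : R := fair R v.1 * fair R v.2.
Let m1 (v : bool * bool) : R := if v.1 == v.2 then 2^-1 else 0.

Let m0_sum : \sum_v m0 v = 1. Proof. by rewrite sum_bool_pair /m0 /fair /=; lra. Qed.
Let m1_sum : \sum_v m1 v = 1. Proof. by rewrite sum_bool_pair /m1 /=; lra. Qed.
Let m0_ge0 v : 0 <= m0 v. Proof. by rewrite mulr_ge0 ?fair_ge0. Qed.
Let m1_ge0 v : 0 <= m1 v. Proof. by rewrite /m1; case: ifP. Qed.

Let marg1 s F : expect (path_law m0 m1 s) (fun w : {ffun J -> bool * bool} => F [ffun j => (w j).1]) = E0 F.
Proof.
rewrite (expect_map _ (fun v : bool * bool => v.1)); apply: eq_bigr => w _; congr (_ * _).
apply: eq_bigr => j _; rewrite big_mkcond sum_bool_pair /path_law /m0 /m1 /fair /=.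
by case: (w j) => /=; lra.
Qed.

Let marg2 s F : expect (path_law m0 m1 s) (fun w : {ffun J -> bool * bool} => F [ffun j => (w j).2]) = E0 F.
Proof.
rewrite (expect_map _ (fun v : bool * bool => v.2)); apply: eq_bigr => w _; congr (_ * _).
apply: eq_bigr => j _; rewrite big_mkcond sum_bool_pair /path_law /m0 /m1 /fair /=.
by case: (w j) => /=; lra.
Qed.

Let fst_upd (w : {ffun J -> bool * bool}) t v :
  [ffun j => (upd w t v j).1] = upd [ffun j => (w j).1] t v.1.
Proof. by apply/ffunP => j; rewrite !ffunE; case: eqP. Qed.

Let snd_upd (w : {ffun J -> bool * bool}) t v :
  [ffun j => (upd w t v j).2] = upd [ffun j => (w j).2] t v.2.
Proof. by apply/ffunP => j; rewrite !ffunE; case: eqP. Qed.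

Let dflipE w t n :
  dflip A w t n = 2^-1 *: (Y (upd w t false) ^+ n - Y (upd w t true) ^+ n).
Proof.
rewrite /dflip /flip; have := upd_id w t; case: (w t) => /= ->.
  by rewrite /spin expr1 mulrN1 scaleNr -scalerN opprB.
by rewrite /spin expr0 mulr1.
Qed.

(** The two powers in the trace form may be taken from independent copies: the
    copies are correlated along a path of laws, and the derivative along this
    path differentiates both powers in the same sign, which makes the two pairs
    of block matrices cross. *)
Lemma decoupling a b : (a + b <= K)%N -> m%:R <= lam ^+ 2 -> K%:R <= lam ->
  `|E0 (fun w => \sum_t btr A t (Y w ^+ a) (Y w ^+ b))
    - \sum_t btr A t (meanpow a) (meanpow b)|
  <= 90 * D%:R ^+ 15 * K%:R ^+ 3 * m%:R * N%:R * (lam ^+ (a + b) / lam).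
Proof.
move=> abK mlam Klam.
pose p1 (w : {ffun J -> bool * bool}) := [ffun j => (w j).1].
pose p2 (w : {ffun J -> bool * bool}) := [ffun j => (w j).2].
pose G w w' := \sum_t btr A t (Y w ^+ a) (Y w' ^+ b).
pose p := path_poly m0 m1 (fun w : {ffun J -> bool * bool} => G (p1 w) (p2 w)).
have p0E : p.[0] = \sum_t btr A t (meanpow a) (meanpow b).
  rewrite horner_path_poly.
  transitivity (expect m0 (fun w : {ffun J -> bool * bool} => G (p1 w) (p2 w))).
    by apply: eq_bigr => w _; congr (_ * _); apply: eq_bigr => j _; rewrite path_law0.
  rewrite (expect_prod (fair R) (fair R) G) (eq_bigr _ (fun t _ => btr_meanpow t a b)).
  rewrite -expect_sum; apply: eq_expect => w1.
  by rewrite -expect_sum.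
have p1E : p.[1] = E0 (fun w => G w w).
  rewrite horner_path_poly.
  transitivity (expect m1 (fun w : {ffun J -> bool * bool} => G (p1 w) (p2 w))).
    by apply: eq_bigr => w _; congr (_ * _); apply: eq_bigr => j _; rewrite path_law1.
  have := expect_map (fair R) (fun b : bool => (b, b)) (fun w : {ffun J -> bool * bool} => G (p1 w) (p2 w)).
  rewrite (eq_expect _ (G := fun w => G w w)); last first.
    by move=> w; congr (G _ _); apply/ffunP => j; rewrite !ffunE.
  move=> ->; apply: eq_bigr => w _; congr (_ * _); apply: eq_bigr => j _.
  by rewrite big_mkcond big_bool /m1 /fair; case: (w j) => [[] []] /=; rewrite ?addr0 ?add0r.
rewrite -p0E -p1E; apply: poly_increment_le => s s01.
have mu0 v : 0 <= path_law m0 m1 s v by exact: path_law_ge0.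
rewrite (deriv_path_poly m0_sum m1_sum) -expect_sum.
set c := 18 * D%:R ^+ 15 * K%:R ^+ 3 * (lam ^+ (a + b) / lam).
have c0 : 0 <= c by rewrite !mulr_ge0 ?invr_ge0 ?exprn_ge0 // ltW.
apply: le_trans (ler_norm_expect mu0 _) _.
apply: (@le_trans _ _ (expect (path_law m0 m1 s)
   (fun w : {ffun J -> bool * bool} => c * \sum_t fpot (p1 w) (p2 w) t / lam ^+ K))); last first.
  rewrite expectZ [leRHS](_ : _ = c * (5 * m%:R * N%:R)); last by rewrite /c; ring.
  apply: ler_wpM2l => //; apply: expect_flip_pot => //; exact: path_law_sum.
apply: ler_expect => // w.
apply: le_trans (cross_pointwise_le HB k_gt0 D_gt0 lam_gt0 (p1 w) (p2 w) abK mlam Klam).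
rewrite [X in _ <= `|X|]exchange_big /=; apply: le_of_eq; congr `|_|.
apply: eq_bigr => t' _.
rewrite sum_bool_pair /m0 /m1 /fair /= /G /p1 /p2 !fst_upd !snd_upd /= -/(p1 w) -/(p2 w).
rewrite !mulr_sumr -!big_split /=; apply: eq_bigr => t _.
have BN U V : btr A t (- U) V = - btr A t U V by rewrite -scaleN1r btrZl mulN1r.
have BNr U V : btr A t U (- V) = - btr A t U V by rewrite -scaleN1r btrZr mulN1r.
rewrite !dflipE btrZl btrZr !(btrDl, btrDr, BN, BNr); lra.
Qed.

End MomentRecursion.

(** * The Catalan recursion for random signs *)

Section CatalanRecursion.
Variable R : realFieldType.

Lemma convolution_sum_le (x : nat -> R) i : (forall c, 0 <= x c) ->
  \sum_(j < i) \sum_(c < j.+1) x c * x (j - c)%N <= (\sum_(c < i) x c) ^+ 2.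
Proof.
move=> x0; rewrite expr2 big_distrlr /=.
rewrite (eq_bigr (fun j : 'I_i => \sum_(c < i | (c <= j)%N) x c * x (j - c)%N)); last first.
  move=> j _; rewrite (big_ord_widen i (fun c => x c * x (j - c)%N)) //.
rewrite (exchange_big_dep xpredT) //=; apply: ler_sum => c _.
rewrite -!mulr_sumr; apply: ler_wpM2l => //.
rewrite -(big_mkord (fun j => (c <= j)%N) (fun j => x (j - c)%N)).
rewrite (big_cat_nat (n := c)) ?leq0n 1?ltnW //= big_nat_cond big1 ?add0r; last first.
  by move=> j /andP[/andP[_ jc] cj]; rewrite ltnNge cj in jc.
rewrite -{1}[nat_of_ord c]add0n big_addn.
rewrite (eq_big (fun=> true) (fun j => x j)); first last.
- by move=> j _; rewrite addnK.
- by move=> j; rewrite leq_addl.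
rewrite big_mkord (big_ord_widen i) ?leq_subr // big_mkcond /=.
by apply: ler_sum => j _; case: ifP.
Qed.

(** A partial sum below 2 yields a next one of at most 1 + 4 s + k e, which is
    below 2 again. Since x 0 = 1, this leaves less than 1 for x k. *)
Lemma catalan_lt1 (x : nat -> R) s e k : (0 < k)%N ->
  0 <= s -> 0 <= e -> (forall c, 0 <= x c) -> x 0%N = 1 ->
  (forall i, (i < k)%N -> x i.+1 <= s * (\sum_(c < i.+1) x c * x (i - c)%N) + e) ->
  4 * s + k%:R * e < 1 -> x k < 1.
Proof.
move=> k0 s0 e0 x0 x01 rec small.
have X i : (i <= k)%N -> \sum_(c < i.+1) x c < 2.
  elim: i => [|i IH] ik.
    by rewrite big_ord_recl big_ord0 x01; lra.
  rewrite big_ord_recl x01 /=.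
  apply: (@le_lt_trans _ _ (1 + (s * (\sum_(c < i.+1) x c) ^+ 2 + i.+1%:R * e))).
    rewrite lerD2l.
    apply: (@le_trans _ _ (\sum_(j < i.+1) (s * (\sum_(c < j.+1) x c * x (j - c)%N) + e))).
      by apply: ler_sum => j _; apply: rec; apply: leq_ltn_trans ik; rewrite -ltnS.
    rewrite big_split /= -mulr_sumr sum_ord_cst lerD2r.
    by apply: ler_wpM2l => //; exact: convolution_sum_le.
  have Xi := IH (ltnW ik); set T := \sum_(c < i.+1) x c in Xi *.
  have T0 : 0 <= T by apply: sumr_ge0.
  have sq : s * T ^+ 2 <= s * 4.
    apply: ler_wpM2l => //; have : T * T <= 2 * 2 by apply: ler_pM => //; exact: ltW.
    by rewrite expr2; lra.
  have ke : i.+1%:R * e <= k%:R * e by apply: ler_wpM2r => //; rewrite ler_nat.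
  lra.
have := X k (leqnn k); case: k k0 {rec small X} => // k _.
rewrite big_ord_recl big_ord_recr /= x01 /bump /= add1n.
have : 0 <= \sum_(i < k) x (1 + i)%N by apply: sumr_ge0.
lra.
Qed.

End CatalanRecursion.

Section SignMoments.
Variables (R : realType) (N : nat) (J : finType).
Variables (S : J -> {set 'I_N}) (A : J -> 'M[R]_N) (D m : nat).
Hypothesis HB : block_system S A D m.
Implicit Types (w : {ffun J -> bool}) (t : J).
Local Notation Y := (sgsum A).
Local Notation E0 := (expect (fair R)).
Local Notation M := (meanpow A).

(** What the evaluation of the decoupled terms requires of the cells: block_mean
    stands for the symmetry under vertex permutations, and the two factorizations
    for the positivity of the lower and of the upper Laplacian. *)
Record homogeneous_blocks : Prop := HomogeneousBlocks {
  block_unit : forall t i j, i \in S t -> j \in S t -> i != j -> A t i j ^+ 2 = 1;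
  block_triangle : forall t i j l, A t i j * A t j l * A t l i <= 0;
  block_mean : forall n, exists a u : R, (forall i, M n i i = a) /\
    (forall t i j, i \in S t -> j \in S t -> i != j -> M n i j = u * A t i j);
  block_lower : exists p (F : 'M[R]_(N, p)), \sum_t A t + (D.-1)%:R%:M = F *m F^T;
  block_upper : exists p (F : 'M[R]_(N, p)), m%:R%:M - \sum_t A t = F *m F^T }.

Hypothesis HH : homogeneous_blocks.
Variables (k : nat).
Hypotheses (k_gt0 : (0 < k)%N) (D_gt1 : (1 < D)%N) (N_gt0 : (0 < N)%N) (m_gt0 : (0 < m)%N).
Local Notation K := (k.*2).

Let D_gt0 : (0 < D)%N. Proof. exact: ltnW. Qed.
Let d : R := (D.-1)%:R.
Let d_gt0 : 0 < d. Proof. by rewrite ltr0n; case: (D) D_gt1 => [|[]]. Qed.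
Let Nr_gt0 : 0 < N%:R :> R. Proof. by rewrite ltr0n. Qed.
Let mr_gt0 : 0 < m%:R :> R. Proof. by rewrite ltr0n. Qed.

Section FormMoments.
Variables (p : nat) (F : 'M[R]_(N, p)).

(** Moments seen by the positive semidefinite matrix F F^T. They are log-convex,
    being moments of a positive measure. *)
Definition form_moment n := E0 (fun w => \tr (F^T *m Y w ^+ n *m F)).

Lemma trace_form w u v : \tr (F^T *m Y w ^+ (u + v) *m F)
  = \sum_(x : 'I_N * 'I_p) (Y w ^+ u *m F) x.1 x.2 * (Y w ^+ v *m F) x.1 x.2.
Proof.
rewrite -(pair_bigA _ (fun i j => (Y w ^+ u *m F) i j * (Y w ^+ v *m F) i j)) /=.
rewrite exchange_big /= exprD; apply: eq_bigr => j _.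
have -> : F^T *m (Y w ^+ u * Y w ^+ v) *m F = (Y w ^+ u *m F)^T *m (Y w ^+ v *m F).
  by rewrite trmx_mul trmx_pow (sgsum_sym HB) !mulmxA.
by rewrite mxE; apply: eq_bigr => i _; rewrite mxE.
Qed.

Lemma form_moment_ge0 n : 0 <= form_moment n.*2.
Proof.
apply: expect_ge0 => [|w]; first exact: fair_ge0.
by rewrite -addnn trace_form; apply: sumr_ge0 => x _; rewrite -expr2 sqr_ge0.
Qed.

Lemma form_moment_CS u v :
  form_moment (u + v) ^+ 2 <= form_moment u.*2 * form_moment v.*2.
Proof.
have E n1 n2 : form_moment (n1 + n2) = \sum_(y : {ffun J -> bool} * ('I_N * 'I_p))
   (\prod_j fair R (y.1 j)) * ((Y y.1 ^+ n1 *m F) y.2.1 y.2.2 * (Y y.1 ^+ n2 *m F) y.2.1 y.2.2).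
  rewrite -(pair_bigA _ (fun (w : {ffun J -> bool}) (x : 'I_N * 'I_p) => (\prod_j fair R (w j)) *
    ((Y w ^+ n1 *m F) x.1 x.2 * (Y w ^+ n2 *m F) x.1 x.2))) /=.
  by apply: eq_bigr => w _; rewrite trace_form mulr_sumr.
rewrite -!addnn !E.
apply: weighted_Cauchy_Schwarz => y; apply: prodr_ge0 => j _; exact: fair_ge0.
Qed.

Lemma form_moment_le (c r : R) : 0 < c -> 0 <= r -> form_moment 0 = c ->
  form_moment K <= c * r ^+ k ->
  forall u, (u <= k)%N -> form_moment u.*2 <= c * r ^+ u.
Proof.
move=> c0 r0 Fc Fk u uk; rewrite mulrC -ler_pdivrMr //.
apply: (@logconvex_le R (fun u => form_moment u.*2 / c) k) => //.
- by move=> v _; rewrite divr_ge0 ?form_moment_ge0 // ltW.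
- by rewrite double0 Fc divff // gt_eqF.
- move=> v _; rewrite mulrACA -invfM expr_div_n expr2 -expr2.
  rewrite ler_pM2r ?invr_gt0 ?exprn_gt0 // ?mulr_gt0 //.
  have := form_moment_CS v v.+2.
  by have -> : (v + v.+2 = v.+1.*2)%N by lia.
- by rewrite ler_pdivrMr // mulrC.
Qed.

Lemma form_momentE n : form_moment n = \tr (F *m F^T *m M n).
Proof.
rewrite meanpowE mulmx_sumr raddf_sum; apply: eq_bigr => w _ /=.
by rewrite -scalemxAr linearZ /= mxtrace_mulC !mulmxA.
Qed.

End FormMoments.

Definition norm_moment n : R := E0 (fun w => \tr (Y w ^+ n)) / N%:R.

Lemma form_moment1 n : form_moment 1%:M n = N%:R * norm_moment n.
Proof.
rewrite /norm_moment mulrC divfK ?gt_eqF //; apply: eq_expect => w.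
by rewrite trmx1 mul1mx mulmx1.
Qed.

Lemma norm_moment_ge0 n : 0 <= norm_moment n.*2.
Proof.
have := form_moment_ge0 1%:M n; rewrite form_moment1.
by rewrite pmulr_rge0.
Qed.

Lemma norm_moment0 : norm_moment 0 = 1.
Proof.
rewrite /norm_moment (eq_expect _ (G := fun=> N%:R)) ?(expect_cst _ (fair_sum R)) ?divff ?gt_eqF //.
by move=> w; rewrite expr0 mxtrace1.
Qed.

(** Changing all signs preserves the law and changes the sign of an odd power. *)
Lemma meanpow_odd n : odd n -> M n = 0.
Proof.
move=> nodd; apply/matrixP => i j; rewrite !mxE.
pose f w := (Y w ^+ n) i j.
have E : E0 f = E0 (fun w => - f w).
  have -> : E0 f = expect (fun v' => \sum_(v | ~~ v == v') fair R v) f.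
    apply: eq_bigr => w _; congr (_ * _); apply: eq_bigr => t _.
    by case: (w t); rewrite big_mkcond big_bool /= ?addr0 ?add0r.
  rewrite -(expect_map (fair R) negb f); apply: eq_expect => w; rewrite /f.
  have -> : Y [ffun t => ~~ w t] = - Y w.
    rewrite /sgsum /block_sum -sumrN; apply: eq_bigr => t _.
    by rewrite ffunE spin_neg scaleNr.
  have Npow (Z : 'M[R]_N) : (- Z) ^+ n = - Z ^+ n.
    have := exprNn Z n; rewrite -signr_odd nodd expr1 => ->.
    by rewrite mulN1r.
  by rewrite Npow mxE.
rewrite expectN in E; move: E; rewrite /f; move: (E0 _) => e E; lra.
Qed.

Section Means.
Variables (n : nat) (a u : R).
Hypothesis Ma : forall i, M n i i = a.
Hypothesis Mu : forall t i j, i \in S t -> j \in S t -> i != j -> M n i j = u * A t i j.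

Lemma mean_trace : N%:R * a = N%:R * norm_moment n.
Proof.
rewrite -form_moment1 form_momentE trmx1 !mul1mx /mxtrace.
by rewrite (eq_bigr (fun=> a)) ?sum_ord_cst // => i _; exact: Ma.
Qed.

Lemma mean_diag : a = norm_moment n.
Proof. by have := mean_trace => /mulfI; apply; rewrite gt_eqF. Qed.

(** Inside a block the mean power is a%:M + u *: A t, and only the block enters
    the traces below. *)
Lemma block_trace_sqr t : \tr (A t *m A t) = D%:R * d.
Proof.
rewrite (mxtrace_blockE HB).
have E i : i \in S t -> \sum_(j in S t) A t i j * A t j i = d.
  move=> iS; rewrite (bigD1 i) //= (block_diag0 HB) mul0r add0r.
  rewrite (eq_bigr (fun=> 1)); last first.
    move=> j /andP[jS ji]; have -> : A t j i = A t i j.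
      by rewrite -[in LHS](block_sym HB) mxE.
    by rewrite -expr2 (block_unit HH) // eq_sym.
  rewrite sumr_const /d; congr _%:R.
  by rewrite -(block_card HB t) (cardD1 i) iS; apply: eq_card => j; rewrite !inE andbC.
by rewrite (eq_bigr _ E) sumr_const (block_card HB) mulr_natl.
Qed.

Lemma block_mean_local t i j : i \in S t -> j \in S t ->
  M n i j = (a%:M + u *: A t) i j.
Proof.
move=> iS jS; have -> : (a%:M + u *: A t) i j = a *+ (i == j) + u * A t i j.
  by rewrite !mxE.
have [->|ij] := eqVneq i j; first by rewrite Ma (block_diag0 HB) mulr0 addr0.
by rewrite (Mu iS jS ij) add0r.
Qed.

Lemma blocks_mean_trace : \tr ((\sum_t A t) *m M n) = u * (N%:R * m%:R * d).
Proof.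
rewrite mulmx_suml raddf_sum /= (eq_bigr (fun=> u * (D%:R * d))); last first.
  move=> t _; rewrite (mxtrace_blockE HB) -(block_trace_sqr t) (mxtrace_blockE HB) mulr_sumr.
  apply: eq_bigr => i iS; rewrite mulr_sumr; apply: eq_bigr => j jS.
  by rewrite (block_mean_local jS iS) !mxE; have [->|ij] := eqVneq j i;
    rewrite ?(block_diag0 HB) ?add0r ?mul0r ?mulr0 // mulrCA.
rewrite sumr_const -[_ *+ _]mulr_natl -natrM -(card_blocks HB) natrM; ring.
Qed.

End Means.

(** The sign of this trace makes the cross terms of btr_local harmless when the
    off-diagonal values are positive, where they need not be small. *)
Lemma trace_cube_le0 t : \tr (A t *m (A t *m A t)) <= 0.
Proof.
rewrite /mxtrace; apply: sumr_le0 => i _; rewrite mxE; apply: sumr_le0 => j _.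
rewrite mxE mulr_sumr; apply: sumr_le0 => l _; rewrite mulrA; exact: (block_triangle HH).
Qed.

Let blockA1 t : block_le S t (A t) 1.
Proof. by move=> i j _ _; exact: (block_le1 HB). Qed.

Lemma trace_cube_ge t : - D%:R ^+ 4 <= \tr (A t *m (A t *m A t)).
Proof.
have b1 : block_le S t (1%:M : 'M[R]_N) 1.
  by move=> i j _ _; rewrite mxE; case: (i == j); rewrite /= ?normr1 ?normr0 ?ler01.
have h := block_le_mul HB ler01 ler01 b1 (@blockA1 t).
rewrite mul1mx !mulr1 in h.
have := block_le_trace HB (exprn_ge0 2 (ler0n R D)) h; rewrite -exprD ler_norml => /andP[] //.
Qed.

Lemma trace_fourth_le t : \tr (A t *m (A t *m A t *m A t)) <= D%:R ^+ 4.
Proof.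
have h := block_le_mul HB ler01 ler01 (@blockA1 t) (@blockA1 t).
rewrite !mulr1 in h.
have := block_le_trace HB (exprn_ge0 2 (ler0n R D)) h; rewrite -exprD.
by apply: le_trans; exact: ler_norm.
Qed.

Lemma trace_fourth_ge0 t : 0 <= \tr (A t *m (A t *m A t *m A t)).
Proof.
have -> : A t *m (A t *m A t *m A t) = (A t *m A t)^T *m (A t *m A t).
  by rewrite trmx_mul (block_sym HB) !mulmxA.
by apply: sumr_ge0 => i _; rewrite mxE; apply: sumr_ge0 => j _; rewrite mxE -expr2 sqr_ge0.
Qed.

Lemma btr_local t n1 n2 a1 u1 a2 u2 :
  (forall i, M n1 i i = a1) ->
  (forall t i j, i \in S t -> j \in S t -> i != j -> M n1 i j = u1 * A t i j) ->
  (forall i, M n2 i i = a2) ->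
  (forall t i j, i \in S t -> j \in S t -> i != j -> M n2 i j = u2 * A t i j) ->
  btr A t (M n1) (M n2) = a1 * a2 * (D%:R * d)
   + (a1 * u2 + u1 * a2) * \tr (A t *m (A t *m A t))
   + u1 * u2 * \tr (A t *m (A t *m A t *m A t)).
Proof.
move=> Ma1 Mu1 Ma2 Mu2.
transitivity (btr A t (a1%:M + u1 *: A t) (a2%:M + u2 *: A t)).
  rewrite /btr !(mxtrace_blockE HB); apply: eq_bigr => i iS; apply: eq_bigr => j jS.
  congr (_ * _); rewrite !(block_mulE HB); apply: eq_bigr => c cS; apply: eq_bigr => e eS.
  by rewrite (block_mean_local Ma1 Mu1 (t := t)) ?(block_mean_local Ma2 Mu2 (t := t)).
rewrite -(block_trace_sqr t) -[a1%:M]scalemx1 -[a2%:M]scalemx1 !btrDl !btrDr !btrZl !btrZr /btr.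
by rewrite !mul1mx !mulmx1; ring.
Qed.

Lemma sum_even_terms (f : nat -> R) i : (forall c, f c.*2.+1 = 0) ->
  \sum_(c < i.*2.+1) f c = \sum_(c < i.+1) f c.*2.
Proof.
move=> f0; elim: i => [|i IH]; first by rewrite !big_ord_recl !big_ord0.
by rewrite doubleS big_ord_recr big_ord_recr /= IH f0 addr0 [RHS]big_ord_recr.
Qed.

(** From here on lam is the K-th root of the normalized moment, so that the
    normalized moments are 1 at both ends of the recursion. *)
Section Contradiction.
Variable lam : R.
Hypotheses (lam_gt0 : 0 < lam) (m_lam : m%:R <= lam ^+ 2) (K_lam : K%:R <= lam).
Hypothesis lam_eq : norm_moment K = lam ^+ K.

Let lam_ge0 : 0 <= lam. Proof. exact: ltW. Qed.

Lemma norm_moment_le c : (c <= k)%N -> norm_moment c.*2 <= lam ^+ c.*2.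
Proof.
move=> ck; have := @form_moment_le _ 1%:M N%:R (lam ^+ 2) Nr_gt0 (exprn_ge0 2 lam_ge0) _ _ c ck.
rewrite !form_moment1 norm_moment0 mulr1 -!exprM !mul2n lam_eq => /(_ erefl (lexx _)).
by rewrite ler_pM2l.
Qed.

(** The off-diagonal size of a mean power: positive semidefiniteness bounds it
    from both sides, and log-convexity of the moments seen by the lower
    spectral bound improves the upper one for small exponents. *)
Lemma mean_offdiag_bounds : exists g : R, [/\ 1 <= g, g ^+ k = 1 + m%:R
  & forall c a u, (c <= k)%N ->
    (forall i, M c.*2 i i = a) ->
    (forall t i j, i \in S t -> j \in S t -> i != j -> M c.*2 i j = u * A t i j) ->
    0 <= a + m%:R * u /\ a + m%:R * u <= g ^+ c * lam ^+ c.*2].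
Proof.
have [p [F FE]] := block_lower HH; have [p' [F' FE']] := block_upper HH.
have [|g g0 gk] := @nonneg_root_exists R k (1 + m%:R) k_gt0; first by rewrite addr_ge0.
have g1 : 1 <= g.
  rewrite -(ler_pXn2r k_gt0) ?nnegrE // gk expr1n; have := mr_gt0; lra.
have low n a u : (forall i, M n i i = a) ->
    (forall t i j, i \in S t -> j \in S t -> i != j -> M n i j = u * A t i j) ->
    form_moment F n = N%:R * d * (a + m%:R * u).
  move=> Ma Mu; rewrite form_momentE -FE mulmxDl linearD /= (blocks_mean_trace Ma Mu).
  rewrite mul_scalar_mx linearZ /= /mxtrace (eq_bigr (fun=> a)) => [|i _]; last exact: Ma.
  by rewrite sum_ord_cst -/d; ring.
have upp n a u : (forall i, M n i i = a) ->
    (forall t i j, i \in S t -> j \in S t -> i != j -> M n i j = u * A t i j) ->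
    form_moment F' n = N%:R * m%:R * (a - d * u).
  move=> Ma Mu; rewrite form_momentE -FE' mulmxBl linearB /= (blocks_mean_trace Ma Mu).
  rewrite mul_scalar_mx linearZ /= /mxtrace (eq_bigr (fun=> a)) => [|i _]; last exact: Ma.
  by rewrite sum_ord_cst; ring.
have Nd : 0 < N%:R * d by rewrite mulr_gt0.
have d1 : 1 <= d by rewrite /d ler1n; case: (D) D_gt1 => [|[]].
have F0 : form_moment F 0 = N%:R * d.
  rewrite form_momentE -FE.
  have -> : M 0 = 1%:M.
    apply/matrixP => i j; rewrite [LHS]mxE.
    by rewrite (eq_expect _ (G := fun=> 1%:M i j)) ?(expect_cst _ (fair_sum R)).
  rewrite mulmx1 linearD /= mxtrace_scalar raddf_sum big1 ?add0r ?mulr_natl // => t _.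
  by apply: big1 => i _; exact: (block_diag0 HB).
have Fk : form_moment F K <= N%:R * d * (g * lam ^+ 2) ^+ k.
  have [a [u [Ma Mu]]] := block_mean HH K.
  rewrite (low _ _ _ Ma Mu) exprMn gk -exprM mul2n -lam_eq -(mean_diag Ma).
  apply: ler_wpM2l; first exact: ltW.
  have := form_moment_ge0 F' k; rewrite (upp _ _ _ Ma Mu) pmulr_rge0 ?mulr_gt0 // => du.
  have a0 : 0 <= a by rewrite (mean_diag Ma) norm_moment_ge0.
  have ua : u <= a.
    have [u0|u0] := leP 0 u; last by apply: le_trans a0; exact: ltW.
    have : 1 * u <= d * u by exact: ler_wpM2r.
    lra.
  rewrite mulrDl mul1r lerD2l; apply: ler_wpM2l => //.
exists g; split=> // c a u ck Ma Mu; split.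
  by have := form_moment_ge0 F c; rewrite (low _ _ _ Ma Mu) pmulr_rge0.
have := @form_moment_le _ F (N%:R * d) (g * lam ^+ 2) Nd _ F0 Fk c ck.
rewrite (low _ _ _ Ma Mu) ler_pM2l // exprMn -exprM mul2n; apply.
by rewrite mulr_ge0 ?exprn_ge0.
Qed.

(** The off-diagonal values are at least - lam^(2c) / m, and their product is at
    most of order lam^(2c+2e) / m. So only the diagonal values contribute to
    the main term. *)
Lemma main_term_le c e : (c + e <= k)%N ->
  \sum_t btr A t (M c.*2) (M e.*2)
  <= N%:R * (m%:R * d * (norm_moment c.*2 * norm_moment e.*2)
       + 4 * D%:R ^+ 3 * lam ^+ (c.*2 + e.*2)).
Proof.
move=> cek; have ck : (c <= k)%N by exact: leq_trans (leq_addr _ _) cek.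
have ek : (e <= k)%N by exact: leq_trans (leq_addl _ _) cek.
have [g [g1 gk bnd]] := mean_offdiag_bounds.
have [a [u [Ma Mu]]] := block_mean HH c.*2.
have [b [v [Mb Mv]]] := block_mean HH e.*2.
have [hu0 hu1] := bnd c a u ck Ma Mu; have [hv0 hv1] := bnd e b v ek Mb Mv.
rewrite -(mean_diag Ma) -(mean_diag Mb).
have a0 : 0 <= a by rewrite (mean_diag Ma) norm_moment_ge0.
have b0 : 0 <= b by rewrite (mean_diag Mb) norm_moment_ge0.
have al : a <= lam ^+ c.*2 by rewrite (mean_diag Ma) norm_moment_le.
have bl : b <= lam ^+ e.*2 by rewrite (mean_diag Mb) norm_moment_le.
set L := lam ^+ (c.*2 + e.*2).
have abL : a * b <= L by rewrite /L exprD; exact: ler_pM.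
have L0 : 0 <= L by rewrite exprn_ge0.
pose mi : R := m%:R^-1.
have mi0 : 0 < mi by rewrite invr_gt0.
have mmi : m%:R * mi = 1 by rewrite divff // gt_eqF.
have mi1 : mi <= 1 by rewrite invf_le1 // ler1n.
have ulow : - (a * mi) <= u.
  have : 0 <= (a + m%:R * u) * mi by rewrite mulr_ge0 // ltW.
  by rewrite mulrDl mulrAC mmi mul1r; lra.
have vlow : - (b * mi) <= v.
  have : 0 <= (b + m%:R * v) * mi by rewrite mulr_ge0 // ltW.
  by rewrite mulrDl mulrAC mmi mul1r; lra.
have uvle : u * v <= 2 * L * mi.
  have q0 : 0 <= 2 * L * mi by rewrite !mulr_ge0 // ltW.
  have [u0|u0] := leP 0 u; have [v0|v0] := leP 0 v; last first.
  - have : (- u) * (- v) <= (a * mi) * (b * mi).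
      by apply: ler_pM; rewrite ?oppr_ge0 ?(ltW u0) ?(ltW v0) // lerNl.
    have : (a * b) * (mi * mi) <= L * (1 * mi).
      by apply: ler_pM; rewrite ?mulr_ge0 ?(ltW mi0) //; apply: ler_wpM2r; rewrite ?(ltW mi0).
    have := mulr_ge0 L0 (ltW mi0); lra.
  - by apply: le_trans q0; rewrite mulr_le0_ge0 // ltW.
  - by apply: le_trans q0; rewrite mulr_ge0_le0 // ltW.
  have um : m%:R * u <= g ^+ c * lam ^+ c.*2 by apply: le_trans hu1; rewrite lerDr.
  have vm : m%:R * v <= g ^+ e * lam ^+ e.*2 by apply: le_trans hv1; rewrite lerDr.
  have : (m%:R * u) * (m%:R * v) <= (g ^+ c * lam ^+ c.*2) * (g ^+ e * lam ^+ e.*2).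
    by apply: ler_pM; rewrite ?mulr_ge0.
  rewrite [leRHS](_ : _ = g ^+ (c + e) * L); last by rewrite /L !exprD; ring.
  move=> h; have : g ^+ (c + e) * L <= (1 + m%:R) * L.
    by apply: ler_wpM2r => //; rewrite -gk; exact: ler_weXn2l.
  move=> h2; have := le_trans h h2; rewrite -(ler_pM2r (mulr_gt0 mi0 mi0)) => h3.
  have e1 : m%:R * u * (m%:R * v) * (mi * mi) = u * v.
    transitivity ((m%:R * mi) * (m%:R * mi) * (u * v)); first by ring.
    by rewrite mmi !mul1r.
  rewrite e1 in h3; apply: le_trans h3 _.
  have -> : (1 + m%:R) * L * (mi * mi) = (mi + m%:R * mi) * (L * mi) by ring.
  rewrite mmi -mulrA; apply: ler_wpM2r; last by lra.
  by rewrite mulr_ge0 // ltW.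
have each t : btr A t (M c.*2) (M e.*2) <= a * b * (D%:R * d) + 4 * D%:R ^+ 4 * L * mi.
  rewrite (btr_local t Ma Mu Mb Mv).
  have T0 := trace_cube_le0 t; have T1 := trace_cube_ge t.
  have Q0 := trace_fourth_ge0 t; have Q1 := trace_fourth_le t.
  set T := \tr _ in T0 T1 *; set Q := \tr _ in Q0 Q1 *.
  have D40 : 0 <= D%:R ^+ 4 :> R by rewrite exprn_ge0.
  have i1 : (a * v + u * b) * T <= 2 * L * mi * D%:R ^+ 4.
    have xy : - (2 * L * mi) <= a * v + u * b.
      have s1 : a * (- (b * mi)) <= a * v by exact: ler_wpM2l.
      have s2 : (- (a * mi)) * b <= u * b by exact: ler_wpM2r.
      have s3 : a * b * mi <= L * mi by apply: ler_wpM2r => //; exact: ltW.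
      lra.
    have y0 : 0 <= 2 * L * mi by rewrite !mulr_ge0 // ltW.
    have s1 : (a * v + u * b) * T <= - (2 * L * mi) * T by exact: ler_wnM2r.
    have s2 : (2 * L * mi) * (- T) <= (2 * L * mi) * D%:R ^+ 4.
      by apply: ler_wpM2l => //; rewrite lerNl.
    lra.
  have i2 : u * v * Q <= 2 * L * mi * D%:R ^+ 4.
    have y0 : 0 <= 2 * L * mi by rewrite !mulr_ge0 // ltW.
    apply: (@le_trans _ _ (2 * L * mi * Q)); first exact: ler_wpM2r.
    exact: ler_wpM2l.
  lra.
apply: le_trans (ler_sum _ (fun t _ => each t)) _.
rewrite sumr_const -[_ *+ #|_|]mulr_natl.
have JD : #|J|%:R * D%:R = N%:R * m%:R :> R by rewrite -!natrM (card_blocks HB).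
apply: le_of_eq.
transitivity ((#|J|%:R * D%:R) * (a * b * d) + (#|J|%:R * D%:R) * mi * (4 * D%:R ^+ 3 * L)); first by ring.
rewrite JD -[N%:R * m%:R * mi]mulrA mmi; ring.
Qed.

Let delta := 104 * D%:R ^+ 15 * K%:R ^+ 4 / lam.

(** The combination of moment_step, decoupling and main_term_le; the odd exponents
    drop out by meanpow_odd. The error delta is small compared with 1 / k. *)
Lemma normalized_recursion i : (i < k)%N ->
  norm_moment i.+1.*2 / lam ^+ i.+1.*2
  <= m%:R * d / lam ^+ 2 * (\sum_(c < i.+1) norm_moment c.*2 / lam ^+ c.*2
        * (norm_moment (i - c).*2 / lam ^+ (i - c).*2)) + delta.
Proof.
move=> ik; set n := i.*2.+1.
have nK : (n < K)%N by rewrite /n; move: ik; clear; lia.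
have mom_le : E0 (fun w => \tr (Y w ^+ K)) <= N%:R * lam ^+ K.
  by rewrite -lam_eq /norm_moment mulrC divfK // gt_eqF.
have step := moment_step HB k_gt0 D_gt0 lam_gt0 mom_le nK.
set err1 := (X in _ <= X) in step.
set err2 := 90 * D%:R ^+ 15 * K%:R ^+ 3 * m%:R * N%:R * (lam ^+ i.*2 / lam).
have dec (u : 'I_n) : E0 (fun w => \sum_t btr A t (Y w ^+ u) (Y w ^+ (n.-1 - u)))
    <= \sum_t btr A t (M u) (M (n.-1 - u)) + err2.
  have un := ltn_ord u.
  have uK : (u + (n.-1 - u) <= K)%N by move: un nK; clear; lia.
  have := decoupling HB k_gt0 D_gt0 lam_gt0 mom_le uK m_lam K_lam.
  have -> : (u + (n.-1 - u) = i.*2)%N by move: un; rewrite /n; clear; lia.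
  by rewrite -/err2 ler_norml => /andP[_]; lra.
have S1 : N%:R * norm_moment i.+1.*2 <= err1 + \sum_(u < n) (\sum_t btr A t (M u) (M (n.-1 - u)) + err2).
  rewrite /norm_moment mulrC divfK ?gt_eqF //.
  have -> : i.+1.*2 = n.+1 by [].
  move: step; rewrite ler_norml => /andP[_]; rewrite lerBlDr => H.
  apply: le_trans H _; rewrite lerD2l.
  apply: le_trans (ler_sum _ (fun u _ => dec u)).
  rewrite -expect_sum; apply: le_of_eq; apply: eq_expect => w.
  by rewrite exchange_big.
have S2 : \sum_(u < n) (\sum_t btr A t (M u) (M (n.-1 - u)) + err2)
   <= \sum_(c < i.+1) N%:R * (m%:R * d * (norm_moment c.*2 * norm_moment (i - c).*2)
       + 4 * D%:R ^+ 3 * lam ^+ i.*2) + n%:R * err2.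
  rewrite big_split /= sum_ord_cst lerD2r.
  rewrite (sum_even_terms (f := fun u => \sum_t btr A t (M u) (M (n.-1 - u)))); last first.
    move=> c; apply: big1 => t _.
    by rewrite meanpow_odd ?odd_double //= ?odd_double // /btr !mul0mx mulmx0 linear0.
  apply: ler_sum => c _.
  have ci : (c <= i)%N by rewrite -ltnS.
  have -> : (n.-1 - c.*2 = (i - c).*2)%N by rewrite /n doubleB.
  have cik : (c + (i - c) <= k)%N by rewrite subnKC // ltnW.
  have := main_term_le cik.
  by rewrite -doubleD subnKC.
have lK : 1 <= K%:R :> R by rewrite ler1n double_gt0.
have l1 : 1 <= lam by exact: le_trans K_lam.
set s := \sum_(c < i.+1) norm_moment c.*2 * norm_moment (i - c).*2.
have S3 : N%:R * norm_moment i.+1.*2 <= err1 + (N%:R * (m%:R * d) * s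
     + N%:R * (i.+1%:R * (4 * D%:R ^+ 3 * lam ^+ i.*2)) + n%:R * err2).
  apply: le_trans S1 _; rewrite lerD2l; apply: le_trans S2 _.
  rewrite lerD2r -mulr_sumr big_split /= sum_ord_cst /s -mulr_sumr.
  by apply: le_of_eq; ring.
set L := lam ^+ i.*2 in S3 *.
have L0 : 0 < L by rewrite exprn_gt0.
have sE : \sum_(c < i.+1) norm_moment c.*2 / lam ^+ c.*2 * (norm_moment (i - c).*2 / lam ^+ (i - c).*2)
   = s / L.
  rewrite /s mulr_suml; apply: eq_bigr => c _.
  have ci : (c <= i)%N by rewrite -ltnS.
  by rewrite mulrACA -invfM -exprD -doubleD subnKC.
rewrite sE.
have -> : lam ^+ i.+1.*2 = L * lam ^+ 2 by rewrite /L -exprD addn2.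
rewrite ler_pdivrMr ?mulr_gt0 ?exprn_gt0 //.
rewrite -(ler_pM2l Nr_gt0); apply: le_trans S3 _.
rewrite (_ : err1 = 10 * D%:R ^+ 6 * K%:R ^+ 2 * m%:R * N%:R * (L / lam)); last first.
  rewrite /err1 /n (exprS lam i.*2) -/L; congr (_ * _); field.
  by rewrite gt_eqF.
have ln0 : lam != 0 by rewrite gt_eqF.
have Ln0 : L != 0 by rewrite gt_eqF.
rewrite [leRHS](_ : _ = N%:R * (m%:R * d) * s + N%:R * L * (delta * lam ^+ 2)); last first.
  by field; rewrite ln0 Ln0.
rewrite -lerBlDl /err2 -/L.
set x : R := K%:R; set q : R := D%:R.
have q1 : 1 <= q by rewrite ler1n.
have q0 : 0 <= q by exact: le_trans q1.
have x0 : 0 <= x by exact: le_trans lK.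
have ix : i.+1%:R <= x by rewrite ler_nat; move: ik; clear; lia.
have nx : n%:R <= x by rewrite ler_nat ltnW.
set mm : R := m%:R.
rewrite [leLHS](_ : _ = N%:R * L * (10 * (q ^+ 6 * x ^+ 2) * (mm / lam)
   + 4 * (i.+1%:R * q ^+ 3) + 90 * (n%:R * (q ^+ 15 * x ^+ 3)) * (mm / lam))); last first.
  by field.
apply: ler_wpM2l; first by rewrite mulr_ge0 // ltW.
rewrite (_ : delta * lam ^+ 2 = 104 * (q ^+ 15 * x ^+ 4) * lam); last by rewrite /delta; field.
have mml : mm / lam <= lam by rewrite ler_pdivrMr // -expr2.
have mm0 : 0 <= mm / lam by rewrite divr_ge0.
set y := mm / lam in mml mm0 *; clearbody y.
have q15 e : (e <= 15)%N -> q ^+ e <= q ^+ 15 by exact: ler_weXn2l.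
have x4 e : (e <= 4)%N -> x ^+ e <= x ^+ 4 by exact: ler_weXn2l.
have qn e : 0 <= q ^+ e by exact: exprn_ge0.
have xn e : 0 <= x ^+ e by exact: exprn_ge0.
have t1 : (q ^+ 6 * x ^+ 2) * y <= (q ^+ 15 * x ^+ 4) * lam.
  by apply: ler_pM; rewrite ?mulr_ge0 //; apply: ler_pM; rewrite ?q15 ?x4.
have t2 : i.+1%:R * q ^+ 3 <= (q ^+ 15 * x ^+ 4) * lam.
  rewrite -[leLHS]mulr1; apply: ler_pM; rewrite ?mulr_ge0 // [leRHS]mulrC.
  apply: ler_pM; rewrite ?q15 //; apply: le_trans ix _.
  by rewrite -[leLHS]expr1 x4.
have t3 : (n%:R * (q ^+ 15 * x ^+ 3)) * y <= (q ^+ 15 * x ^+ 4) * lam.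
  apply: ler_pM; rewrite ?mulr_ge0 //.
  rewrite [leRHS](_ : _ = x * (q ^+ 15 * x ^+ 3)); last by ring.
  by apply: ler_wpM2r; rewrite ?mulr_ge0.
lra.
Qed.

Lemma small_moment_absurd : 4 * (m%:R * d / lam ^+ 2) + k%:R * delta < 1 -> False.
Proof.
move=> small.
have := @catalan_lt1 R (fun c => norm_moment c.*2 / lam ^+ c.*2) (m%:R * d / lam ^+ 2) delta k k_gt0.
rewrite lam_eq divff ?expf_neq0 ?gt_eqF // ltxx => H; suff: false by []; apply: H => //.
- by rewrite !mulr_ge0 ?invr_ge0 ?exprn_ge0 // ltW.
- by rewrite /delta !mulr_ge0 ?invr_ge0 ?exprn_ge0.
- by move=> c; rewrite divr_ge0 ?norm_moment_ge0 ?exprn_ge0.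
- by rewrite norm_moment0 expr0 divr1.
- exact: normalized_recursion.
Qed.

End Contradiction.

(** High moments of the sign matrix are at most those of the semicircle law of
    variance m (D-1), up to a factor (1 + o(1)) in the radius. *)
Theorem sign_moment_le (L : R) : m%:R <= L ^+ 2 -> K%:R <= L ->
  4 * (m%:R * d / L ^+ 2) + k%:R * (104 * D%:R ^+ 15 * K%:R ^+ 4 / L) < 1 ->
  E0 (fun w => \tr (Y w ^+ K)) <= N%:R * L ^+ K.
Proof.
move=> mL KL small; rewrite leNgt; apply/negP => big.
have K_gt0 : (0 < K)%N by rewrite double_gt0.
have L0 : 0 < L by apply: lt_le_trans KL; rewrite ltr0n.
have big' : L ^+ K < norm_moment K by rewrite /norm_moment ltr_pdivlMr // mulrC.
have [|r r0 rK] := @nonneg_root_exists R K (norm_moment K) K_gt0.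
  exact: norm_moment_ge0.
have Lr : L < r by rewrite -(ltr_pXn2r K_gt0) ?nnegrE ?(ltW L0) // rK.
have r_gt0 : 0 < r by exact: lt_trans Lr.
apply: (@small_moment_absurd r) => //.
- by apply: le_trans mL _; apply: lerXn2r; rewrite ?nnegrE // ltW.
- by apply: le_trans KL _; exact: ltW.
apply: le_lt_trans small; apply: lerD.
  apply: ler_wpM2l => //; apply: ler_wpM2l; first by rewrite mulr_ge0 // ltW.
  by rewrite lef_pV2 ?posrE ?exprn_gt0 //; apply: lerXn2r; rewrite ?nnegrE // ltW.
apply: ler_wpM2l => //; apply: ler_wpM2l; first by rewrite !mulr_ge0 ?exprn_ge0.
by rewrite lef_pV2 ?posrE // ltW.
Qed.

End SignMoments.

(** * From random signs to centered Bernoulli weights *)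

Section QuadraticForms.
Variables (R : rcfType) (N : nat).
Implicit Types (H : 'M[R]_N) (v : 'rV[R]_N).

Definition qform H v : R := (v *m H *m v^T) 0 0.

Definition qform_le H (h : R) : Prop :=
  forall v, `|qform H v| <= h * (v *m v^T) 0 0.

Lemma dot_sumE (u v : 'rV[R]_N) : (u *m v^T) 0 0 = \sum_i u 0 i * v 0 i.
Proof. by rewrite mxE; apply: eq_bigr => i _; rewrite mxE. Qed.

Lemma dot_ge0 v : 0 <= (v *m v^T) 0 0.
Proof. by rewrite dot_sumE; apply: sumr_ge0 => i _; rewrite -expr2 sqr_ge0. Qed.

Lemma dot_CS (u v : 'rV[R]_N) :
  (u *m v^T) 0 0 ^+ 2 <= (u *m u^T) 0 0 * (v *m v^T) 0 0.
Proof.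
rewrite !dot_sumE; apply: le_trans (Cauchy_Schwarz _ _) _.
by apply: le_of_eq; congr (_ * _);
  apply: eq_bigr => i _; rewrite expr2.
Qed.

Lemma pow_dot H v a b : H^T = H ->
  (v *m H ^+ (a + b) *m v^T) 0 0 = ((v *m H ^+ a) *m (v *m H ^+ b)^T) 0 0.
Proof.
move=> Hs; rewrite trmx_mul trmx_pow Hs exprD.
by rewrite -[H ^+ a * H ^+ b]/(H ^+ a *m H ^+ b) !mulmxA.
Qed.

(** Jensen's inequality for the spectral measure of v, whose moment of order 2k is
    at most the trace. *)
Lemma qform_le_trace H k (h : R) : H^T = H -> (0 < k)%N -> 0 <= h ->
  \tr (H ^+ k.*2) <= h ^+ k.*2 -> qform_le H h.
Proof.
move=> Hs k0 h0 trH v; pose s := (v *m v^T) 0 0.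
have s0 : 0 <= s by exact: dot_ge0.
have cE u : (v *m H ^+ u.*2 *m v^T) 0 0 = ((v *m H ^+ u) *m (v *m H ^+ u)^T) 0 0.
  by rewrite -addnn pow_dot.
have c0 u : 0 <= (v *m H ^+ u.*2 *m v^T) 0 0 by rewrite cE dot_ge0.
have [s_eq0|s_neq0] := eqVneq s 0.
  have : qform H v ^+ 2 <= 0.
    have := dot_CS (v *m H) v; rewrite -/s s_eq0 mulr0; apply: le_trans.
    by rewrite /qform.
  by rewrite -/s s_eq0 mulr0 normr_le0 real_exprn_even_le0 ?num_real.
have s_gt0 : 0 < s by rewrite lt_def s_neq0.
have ck : (v *m H ^+ k.*2 *m v^T) 0 0 <= s * h ^+ k.*2.
  apply: (@le_trans _ _ (s * \tr (H ^+ k.*2))); last exact: ler_wpM2l.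
  rewrite cE dot_sumE /mxtrace mulr_sumr; apply: ler_sum => j _.
  rewrite -expr2 mxE; apply: le_trans (Cauchy_Schwarz _ _) _.
  rewrite /s dot_sumE -sqr_row_pow //.
  apply: le_of_eq; congr (_ * _).
  by apply: eq_bigr => i _; rewrite [in LHS](sym_pow _ _ _ Hs).
have c1 : (v *m H ^+ 2 *m v^T) 0 0 / s <= h ^+ 2.
  rewrite -[leRHS]expr1.
  apply: (@logconvex_le R (fun u => (v *m H ^+ u.*2 *m v^T) 0 0 / s) k (h ^+ 2) _ _ _ _ _ 1).
  - exact: exprn_ge0.
  - by move=> u _; rewrite divr_ge0.
  - by rewrite expr0 mulmx1 divff.
  - move=> u _; rewrite expr_div_n mulrACA -invfM -expr2.
    rewrite ler_pM2r ?invr_gt0 ?exprn_gt0 // [u.+1.*2](_ : _ = u + u.+2)%N; last by lia.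
    by rewrite pow_dot // !cE; exact: dot_CS.
  - by rewrite ler_pdivrMr // mulrC -exprM mul2n.
  - by [].
have : qform H v ^+ 2 <= (h * s) ^+ 2.
  apply: le_trans (dot_CS (v *m H) v) _; rewrite -/s.
  have := cE 1%N; rewrite expr1 => <-.
  rewrite ler_pdivrMr // in c1.
  have := ler_wpM2r s0 c1; rewrite exprMn; lra.
rewrite -[_ ^+ 2]real_normK ?num_real // ler_pXn2r ?nnegrE ?mulr_ge0 //.
Qed.

End QuadraticForms.

Section CenteredBernoulli.
Variables (R : realType) (N : nat) (J : finType).
Variables (S : J -> {set 'I_N}) (A : J -> 'M[R]_N) (D m : nat).
Hypothesis HB : block_system S A D m.
Hypothesis HH : homogeneous_blocks S A D m.
Variables (k : nat) (p : R).
Hypotheses (k_gt0 : (0 < k)%N) (D_gt1 : (1 < D)%N) (N_gt0 : (0 < N)%N) (m_gt0 : (0 < m)%N).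
Hypothesis p01 : 0 < p < 1.
Local Notation K := (k.*2).
Let q := p * (1 - p).

Definition bern (b : bool) : R := if b then p else 1 - p.
Definition centered (b : bool) : R := b%:R - p.
Definition centered_sum (w : {ffun J -> bool}) : 'M[R]_N := block_sum A centered w.

Lemma bern_ge0 b : 0 <= bern b. Proof. by case: b => /=; case/andP: p01; lra. Qed.

Lemma centered_sum_sym w : (centered_sum w)^T = centered_sum w.
Proof. exact: (block_sum_sym HB). Qed.

Let q_gt0 : 0 < q. Proof. by rewrite /q; case/andP: p01 => p0 p1; rewrite mulr_gt0 ?subr_gt0. Qed.
Let q_le1 : q <= 1. Proof. by rewrite /q; case/andP: p01; nra. Qed.

(* One value space carries both laws: the first component tells which of the
   two laws a value belongs to. *)
Let val (v : bool * bool) : R := if v.1 then centered v.2 else Num.sqrt q * spin R v.2.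
Let law1 (v : bool * bool) : R := if v.1 then bern v.2 else 0.
Let law0 (v : bool * bool) : R := if v.1 then 0 else 2^-1.

Let sq0 : 0 <= Num.sqrt q. Proof. exact: sqrtr_ge0. Qed.
Let sq2 : Num.sqrt q ^+ 2 = q. Proof. by rewrite sqr_sqrtr // ltW. Qed.
Let sq1 : Num.sqrt q <= 1.
Proof. by rewrite -sqrtr1 ler_wsqrtr. Qed.

Let transfer1 F : expect law1 F = expect bern (fun w : {ffun J -> bool} => F [ffun j => (true, w j)]).
Proof.
rewrite (expect_map bern (fun e : bool => (true, e))); apply: eq_bigr => w _; congr (_ * _).
by apply: eq_bigr => j _; rewrite big_mkcond big_bool /law1; case: (w j) => [[] []] /=;
  rewrite ?addr0 ?add0r.
Qed.

Let transfer0 F : expect law0 F = expect (fair R) (fun w : {ffun J -> bool} => F [ffun j => (false, w j)]).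
Proof.
rewrite (expect_map (fair R) (fun e : bool => (false, e))); apply: eq_bigr => w _; congr (_ * _).
by apply: eq_bigr => j _; rewrite big_mkcond big_bool /law0 /fair; case: (w j) => [[] []] /=;
  rewrite ?addr0 ?add0r.
Qed.

(** The trace moment bound for signs, transferred to centered Bernoulli
    weights of variance q. *)
Lemma centered_moment_le (L : R) : m%:R <= L ^+ 2 -> K%:R <= L ->
  4 * (m%:R * (D.-1)%:R / L ^+ 2) + k%:R * (104 * D%:R ^+ 15 * K%:R ^+ 4 / L) < 1 ->
  let l0 := Num.sqrt (m%:R * q) in 2 * K%:R * D%:R ^+ 3 <= l0 ->
  expect bern (fun w => \tr (centered_sum w ^+ K))
    <= expR (8 * D%:R ^+ 6 * K%:R ^+ 3 / l0) * (2 * N%:R * (Num.sqrt q * L) ^+ K).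
Proof.
move=> mL KL small; cbv zeta; set l0 := Num.sqrt _ => l0_big.
have K_gt0 : (0 < K)%N by rewrite double_gt0.
have L0 : 0 < L by apply: lt_le_trans KL; rewrite ltr0n.
have mq : 0 < m%:R * q by rewrite mulr_gt0 // ltr0n.
have l0_gt0 : 0 < l0 by rewrite sqrtr_gt0.
have l02 : l0 ^+ 2 = m%:R * q by rewrite sqr_sqrtr // ltW.
case/andP: (p01) => p0 p1.
have law1_ge0 v : 0 <= law1 v by rewrite /law1; case: v.1 => //; exact: bern_ge0.
have law0_ge0 v : 0 <= law0 v by rewrite /law0; case: v.1.
have law1_sum : \sum_v law1 v = 1 by rewrite sum_bool_pair /law1 /=; lra.
have law0_sum : \sum_v law0 v = 1 by rewrite sum_bool_pair /law0 /=; lra.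
have val_le1 v : `|val v| <= 1.
  rewrite /val; case: v => [[] e] /=; last by rewrite normrM normr_spin mulr1 ger0_norm.
  by rewrite /centered; case: e; rewrite /= ler_norml; lra.
have mean : \sum_v law0 v * val v = \sum_v law1 v * val v.
  rewrite !sum_bool_pair /law0 /law1 /val /centered /spin /= expr1 expr0; lra.
have second : \sum_v law0 v * val v ^+ 2 = \sum_v law1 v * val v ^+ 2.
  rewrite !sum_bool_pair /law0 /law1 /val /centered /spin /= expr1 expr0 !exprMn sq2 /q.
  by field.
have third0 : \sum_v law0 v * `|val v| ^+ 3 <= q.
  rewrite !sum_bool_pair /law0 /val /= !normrM !normr_spin !mulr1 (ger0_norm sq0).
  have : Num.sqrt q ^+ 3 <= q by rewrite exprSr sq2 ler_piMr // ltW.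
  lra.
have third1 : \sum_v law1 v * `|val v| ^+ 3 <= q.
  rewrite !sum_bool_pair /law1 /val /centered /= !mul0r !addr0 sub0r normrN.
  rewrite !ger0_norm ?subr_ge0 ?(ltW p0) ?(ltW p1) // /q.
  have x3 (x : R) : 0 <= x <= 1 -> x ^+ 3 <= x.
    by move=> /andP[x0 x1]; rewrite -[leRHS]expr1 ler_wiXn2l.
  have i1 : p * (1 - p) ^+ 3 <= p * ((1 - p) * (1 - p)).
    apply: ler_wpM2l; first exact: ltW.
    rewrite exprS ler_wpM2l ?subr_ge0 ?(ltW p1) // expr2 ler_piMl //; lra.
  have i2 : (1 - p) * p ^+ 3 <= (1 - p) * (p * p).
    apply: ler_wpM2l; first by rewrite subr_ge0 ltW.
    by rewrite exprS ler_wpM2l ?(ltW p0) // expr2 ler_piMl ?(ltW p0) ?(ltW p1).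
  lra.
have := trace_moment_universality HB law0_ge0 law1_ge0 law0_sum law1_sum val_le1 mean second
   third0 third1 k_gt0 l0_gt0 (ltnW D_gt1) l0_big.
rewrite transfer1 transfer0; cbv zeta.
have -> : 8 * D%:R ^+ 6 * K%:R ^+ 3 * m%:R * q / l0 ^+ 3 = 8 * D%:R ^+ 6 * K%:R ^+ 3 / l0.
  rewrite [l0 ^+ 3]exprSr l02 -[8 * _ * _ * _ * q]mulrA; field.
  by rewrite gt_eqF // gt_eqF // gt_eqF // ltr0n.
set ex := expR _ => H.
have ex0 : 0 < ex by exact: expR_gt0.
have E1 : expect bern (fun w : {ffun J -> bool} => \tr (block_sum A val [ffun j => (true, w j)] ^+ K))
   = expect bern (fun w => \tr (centered_sum w ^+ K)).
  apply: eq_expect => w; congr (\tr (_ ^+ _)); apply: eq_bigr => t _.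
  by rewrite ffunE.
have E0 : expect (fair R) (fun w : {ffun J -> bool} => \tr (block_sum A val [ffun j => (false, w j)] ^+ K))
   = Num.sqrt q ^+ K * expect (fair R) (fun w => \tr (sgsum A w ^+ K)).
  rewrite -expectZ; apply: eq_expect => w.
  have -> : block_sum A val [ffun j => (false, w j)] = Num.sqrt q *: sgsum A w.
    rewrite /sgsum /block_sum scaler_sumr; apply: eq_bigr => t _.
    by rewrite ffunE /val /= scalerA.
  have scX (Z : 'M[R]_N) c n : (c *: Z) ^+ n = c ^+ n *: Z ^+ n.
    elim: n => [|n IH]; first by rewrite !expr0 scale1r.
    rewrite exprS IH [c ^+ n.+1]exprS [Z ^+ n.+1]exprS -scalerA.
    by rewrite -[LHS]/((c *: Z) *m (c ^+ n *: Z ^+ n)) -scalemxAl -scalemxAr.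
  by rewrite scX linearZ.
rewrite E1 E0 in H.
have B := sign_moment_le HB HH k_gt0 D_gt1 N_gt0 m_gt0 mL KL small.
apply: (@le_trans _ _ (ex * (Num.sqrt q ^+ K * expect (fair R) (fun w => \tr (sgsum A w ^+ K)) + N%:R * l0 ^+ K))).
  by apply: le_trans H; rewrite lerDl mulr_ge0 // exprn_ge0 // ltW.
apply: ler_wpM2l; first exact: ltW.
have l0L : l0 ^+ K <= (Num.sqrt q * L) ^+ K.
  apply: lerXn2r; rewrite ?nnegrE ?mulr_ge0 ?(ltW l0_gt0) ?(ltW L0) //.
  rewrite -(ler_pXn2r (isT : (0 < 2)%N)) ?nnegrE ?mulr_ge0 ?(ltW l0_gt0) ?(ltW L0) //.
  by rewrite l02 exprMn sq2 mulrC; apply: ler_wpM2l => //; exact: ltW.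
have h1 := ler_wpM2l (exprn_ge0 K sq0) B.
have h2 := ler_wpM2l (ler0n R N) l0L.
move: h1 h2; rewrite exprMn; lra.
Qed.

(** Markov's inequality for the trace moment. *)
Lemma bad_weight_le (L h : R) : 0 < h -> m%:R <= L ^+ 2 -> K%:R <= L ->
  4 * (m%:R * (D.-1)%:R / L ^+ 2) + k%:R * (104 * D%:R ^+ 15 * K%:R ^+ 4 / L) < 1 ->
  let l0 := Num.sqrt (m%:R * q) in 2 * K%:R * D%:R ^+ 3 <= l0 ->
  \sum_(w : {ffun J -> bool} | ~~ `[< qform_le (centered_sum w) h >]) \prod_j bern (w j)
    <= expR (8 * D%:R ^+ 6 * K%:R ^+ 3 / l0) * (2 * N%:R * (Num.sqrt q * L / h) ^+ K).
Proof.
move=> h0 mL KL small; cbv zeta; set l0 := Num.sqrt _ => l0_big.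
have H := centered_moment_le mL KL small l0_big.
rewrite expr_div_n mulrA mulrA ler_pdivlMr ?exprn_gt0 // -mulrA.
apply: le_trans H; rewrite mulr_suml [leLHS]big_mkcond; apply: ler_sum => w _.
have w0 : 0 <= \prod_j bern (w j) by apply: prodr_ge0 => j _; exact: bern_ge0.
case: ifP => [bad|_]; last first.
  rewrite mulr_ge0 //; apply: sumr_ge0 => i _; exact: (diag_pow_ge0 _ _ (centered_sum_sym w)).
apply: ler_wpM2l => //; rewrite leNgt; apply/negP => small_tr.
move/negP: bad; apply; apply/asboolP.
by apply: (qform_le_trace (centered_sum_sym w) k_gt0 (ltW h0)); exact: ltW.
Qed.

End CenteredBernoulli.

(** * Incidence signs of simplices *)

Section Signs.
Variables (R : realType) (n : nat).
Implicit Types (x y z : 'I_n) (t s : {set 'I_n}) (g : {perm 'I_n}).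

(** The sign of x in t: the parity of the position of x in the increasing
    enumeration of t. *)
Definition eps t x : R := \prod_(y in t) (-1) ^+ (y < x)%N.

Lemma eps_sqr t x : eps t x ^+ 2 = 1.
Proof.
rewrite /eps -prodrXl big1 // => y _; exact: sqrr_sign.
Qed.

Lemma eps_setD1 t x y : y \in t -> eps t x = (-1) ^+ (y < x)%N * eps (t :\ y) x.
Proof. by move=> yt; rewrite /eps (big_setD1 y). Qed.

Lemma eps_self t x : eps (t :\ x) x = eps t x.
Proof.
have [xt|xt] := boolP (x \in t); first by rewrite (eps_setD1 x xt) ltnn expr0 mul1r.
congr (eps _ _); apply/setP => y; rewrite !inE; case: eqP => // ->.
by rewrite (negbTE xt).
Qed.

(** The sign rule that makes the squared boundary operator vanish. *)
Lemma eps_anticomm t x y : x \in t -> y \in t -> x != y ->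
  eps t x * eps (t :\ x) y = - (eps t y * eps (t :\ y) x).
Proof.
move=> xt yt xy.
rewrite (eps_setD1 x yt) (eps_setD1 y xt).
have E : (-1) ^+ (y < x)%N = - (-1) ^+ (x < y)%N :> R.
  have : (y < x)%N = ~~ (x < y)%N.
    by rewrite -leqNgt ltn_neqAle; case: eqP => // /val_inj E; rewrite E eqxx in xy.
  by move=> ->; case: (x < y)%N; rewrite ?expr0 ?expr1 ?opprK.
rewrite E mulNr mulNr; congr (- _); ring.
Qed.

(** The parity of the number of inversions of g on t. *)
Definition inv_sign g t : R :=
  \prod_(y in t) \prod_(z in t) (-1) ^+ ((y < z)%N && (g z < g y)%N).

Lemma inv_sign_sqr g t : inv_sign g t * inv_sign g t = 1.
Proof.
rewrite -expr2 /inv_sign -prodrXl big1 // => y _.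
by rewrite -prodrXl big1 // => z _; exact: sqrr_sign.
Qed.

(** An inversion of g on t that involves x is not one on t without x. The factor
    splits into one for the cell and one for its face, so that it cancels in the
    products that make up the block matrices. *)
Lemma eps_perm g t x : x \in t ->
  eps (g @: t) (g x) = inv_sign g t * inv_sign g (t :\ x) * eps t x.
Proof.
move=> xt.
have -> : eps (g @: t) (g x) = \prod_(y in t :\ x) (-1) ^+ (g y < g x)%N.
  rewrite /eps big_imset /=; last by move=> y z _ _; exact: perm_inj.
  by rewrite (big_setD1 x xt) /= ltnn expr0 mul1r.
have -> : inv_sign g t = inv_sign g (t :\ x) *
   \prod_(y in t :\ x) ((-1) ^+ ((y < x)%N && (g x < g y)%N)
     * (-1) ^+ ((x < y)%N && (g y < g x)%N)).
  rewrite /inv_sign (big_setD1 x xt) /= (big_setD1 x xt) /= ltnn expr0 mul1r.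
  rewrite big_split /= mulrCA mulrA mulrC; congr (_ * _); rewrite -big_split /=.
  by apply: eq_bigr => y yt; rewrite (big_setD1 x xt).
rewrite [_ * _ * inv_sign g (t :\ x)]mulrAC inv_sign_sqr mul1r -eps_self /eps.
rewrite -big_split /=.
apply: eq_bigr => y; rewrite !inE => /andP[yx _].
have gyx : (g y : nat) != g x.
  by apply: contra yx => /eqP/val_inj/perm_inj ->.
have yx' : (y : nat) != x by apply: contra yx => /eqP/val_inj ->.
case: (ltngtP y x) yx' => // _ _; case: (ltngtP (g y) (g x)) gyx => // _ _;
  by rewrite /= ?expr0 ?expr1 ?mulr1 ?mul1r ?mulrNN ?mulr1.
Qed.

(** The incidence coefficient of the face s in the boundary of t. *)
Definition bcoef t s : R :=
  if [pick x in t | s == t :\ x] is Some x then eps t x else 0.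

Lemma setD1_inj t : {in t &, injective (fun x => t :\ x)}.
Proof.
move=> x y xt yt /setP/(_ x); rewrite !inE eqxx xt andbT /=.
by case: eqP.
Qed.

Lemma bcoefE t x : x \in t -> bcoef t (t :\ x) = eps t x.
Proof.
move=> xt; rewrite /bcoef; case: pickP => [y /andP[yt /eqP/(setD1_inj xt yt) -> //]|].
by move/(_ x); rewrite xt eqxx.
Qed.

Lemma face_vertex t s : s \subset t -> #|t| = #|s|.+1 ->
  exists2 x, x \in t & s = t :\ x.
Proof.
move=> st ts; have /cards1P[x tsx] : #|t :\: s| == 1%N.
  by rewrite cardsD (finset.setIidPr st) ts subSnn.
have : x \in t :\: s by rewrite tsx set11.
rewrite inE => /andP[xs xt].
exists x => //; apply/eqP; rewrite eqEcard subsetD1 st xs /=.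
by move: ts; rewrite (cardsD1 x) xt add1n => -[->].
Qed.

Lemma bcoef_out t s : ~~ (s \subset t) -> bcoef t s = 0.
Proof.
move=> st; rewrite /bcoef; case: pickP => // x /andP[_ /eqP sE].
by rewrite sE subD1set in st.
Qed.

Lemma bcoef_sqr t s : s \subset t -> #|t| = #|s|.+1 -> bcoef t s ^+ 2 = 1.
Proof.
by move=> st /(face_vertex st)[x xt ->]; rewrite bcoefE // eps_sqr.
Qed.

Lemma bcoef_perm g t s : #|t| = #|s|.+1 ->
  bcoef (g @: t) (g @: s) = inv_sign g t * inv_sign g s * bcoef t s.
Proof.
move=> ts; have [st|st] := boolP (s \subset t); last first.
  rewrite !bcoef_out ?mulr0 //; apply: contra st => /fintype.subsetP gst.
  apply/fintype.subsetP => x xs; have := gst _ (imset_f g xs).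
  by case/imsetP => y yt /perm_inj ->.
have [x xt ->] := face_vertex st ts.
have -> : g @: (t :\ x) = (g @: t) :\ g x.
  apply/setP => y; rewrite !inE; apply/imsetP/andP.
    case=> z; rewrite !inE => /andP[zx zt] ->; split; last exact: imset_f.
    by apply: contra zx => /eqP/perm_inj ->.
  case=> yx /imsetP[z zt yE]; exists z => //; rewrite !inE zt andbT.
  by apply: contra yx => /eqP <-; rewrite yE.
by rewrite !bcoefE ?imset_f // eps_perm.
Qed.

Lemma perm_of_enumerations (T : finType) (r r' : seq T) : uniq r -> uniq r' ->
  size r = #|T| -> size r' = #|T| -> exists g : {perm T}, map g r = r'.
Proof.
move=> ur ur' sr sr'.
have mem_all (q : seq T) : uniq q -> size q = #|T| -> q =i predT.
  move=> uq sq; have qn : #|q| = #|T| by rewrite -sq; apply/card_uniqP.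
  exact: (elimT (subset_cardP qn) (fintype.subset_predT _)).
have ir (x : T) : (index x r < size r')%N by rewrite sr' -sr index_mem mem_all.
have inj : injective (fun x : T => nth x r' (index x r)).
  move=> x y; rewrite (set_nth_default y) // => /eqP.
  rewrite nth_uniq // => /eqP /(congr1 (nth x r)).
  by rewrite !nth_index ?mem_all.
exists (perm inj); case: r ur sr mem_all ir inj => [|x0 r1] ur sr mem_all ir inj.
  by apply/esym/size0nil; rewrite sr' -sr.
set r := x0 :: r1 in ur sr ir inj *.
apply: (@eq_from_nth _ x0); first by rewrite size_map sr sr'.
move=> i; rewrite size_map => ir0; rewrite (nth_map x0) // permE.
by rewrite index_uniq //; apply: set_nth_default; rewrite sr' -sr.
Qed.

Lemma perm_of_cells t t' : #|t| = #|t'| -> exists g : {perm 'I_n}, g @: t = t'.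
Proof.
move=> tt'.
have E (q : {set 'I_n}) : uniq (enum q ++ enum (~: q)) /\ size (enum q ++ enum (~: q)) = #|'I_n|.
  split; last by rewrite size_cat -!cardE cardsC.
  rewrite cat_uniq !enum_uniq /= andbT; apply/hasPn => x.
  by rewrite !mem_enum !inE.
have [[u1 s1] [u2 s2]] := (E t, E t').
have [g gE] := perm_of_enumerations u1 u2 s1 s2; exists g.
move/eqP: gE; rewrite map_cat eqseq_cat ?size_map -?cardE // => /andP[/eqP gE _].
apply/setP => x; rewrite -[in RHS]mem_enum -gE.
by apply/imsetP/mapP => -[y yt ->]; exists y => //; rewrite ?mem_enum // -mem_enum.
Qed.

Lemma perm_of_flags t t' x x' y y' : #|t| = #|t'| ->
  x \in t -> y \in t -> x != y -> x' \in t' -> y' \in t' -> x' != y' ->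
  exists g : {perm 'I_n}, [/\ g @: t = t', g x = x' & g y = y'].
Proof.
move=> tt' xt yt xy xt' yt' xy'.
pose r (q : {set 'I_n}) a b := a :: b :: (enum (q :\ a :\ b) ++ enum (~: q)).
have E (q : {set 'I_n}) a b : a \in q -> b \in q -> a != b -> uniq (r q a b) /\ size (r q a b) = #|'I_n|.
  move=> aq bq ab; split.
    rewrite /r /= !inE !mem_cat !mem_enum !inE eqxx aq bq (negbTE ab) /= eqxx /= ?andbF /=.
    rewrite cat_uniq !enum_uniq /= andbT; apply/hasPn => z.
    by rewrite !mem_enum !inE; case: (z \in q); rewrite ?andbF.
  rewrite /r /= size_cat -!cardE.
  rewrite -(cardsC q); rewrite [in RHS](cardsD1 a) aq.
  by rewrite (cardsD1 b (q :\ a)) !inE eq_sym ab bq.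
have [[u1 s1] [u2 s2]] := (E t x y xt yt xy, E t' x' y' xt' yt' xy').
have [g] := perm_of_enumerations u1 u2 s1 s2.
rewrite /r /= map_cat => -[gx gy /eqP]; rewrite eqseq_cat; last first.
  rewrite size_map -!cardE; move: tt'; rewrite (cardsD1 x) xt (cardsD1 x' t') xt'.
  rewrite (cardsD1 y) (cardsD1 y' (t' :\ x')) !inE yt yt' !andbT eq_sym xy eq_sym xy'.
  by case.
move=> /andP[/eqP gE _]; exists g; split=> //.
have tE (q : {set 'I_n}) a b : a \in q -> b \in q -> a != b -> q = a |: (b |: (q :\ a :\ b)).
  move=> aq bq ab; rewrite finset.setD1K ?finset.setD1K //.
  by rewrite !inE eq_sym ab.
rewrite (tE t x y) // (tE t' x' y') // !imsetU1 gx gy; congr (_ |: (_ |: _)).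
apply/setP => z; rewrite -[in RHS]mem_enum -gE.
by apply/imsetP/mapP => -[a at_ ->]; exists a => //; rewrite ?mem_enum // -mem_enum.
Qed.

End Signs.

(** * The block system of the simplices *)

Section Equivariance.
Variables (R : realType) (N : nat) (J : finType) (A : J -> 'M[R]_N).
Variables (sigma : {perm 'I_N}) (pi : {perm J}) (s : 'I_N -> R).
Hypothesis s_sqr : forall i, s i * s i = 1.
Hypothesis A_equiv : forall t i j,
  A (pi t) (sigma i) (sigma j) = s i * s j * A t i j.

Lemma sgsum_equiv (w : {ffun J -> bool}) i j :
  sgsum A w (sigma i) (sigma j) = s i * s j * sgsum A [ffun t => w (pi t)] i j.
Proof.
rewrite /sgsum /block_sum !summxE mulr_sumr (reindex_inj (@perm_inj _ pi)) /=.
apply: eq_bigr => t _; rewrite !mxE A_equiv !ffunE.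
by rewrite mulrCA.
Qed.

Lemma sgsum_pow_equiv (w : {ffun J -> bool}) r i j :
  (sgsum A w ^+ r) (sigma i) (sigma j) =
  s i * s j * (sgsum A [ffun t => w (pi t)] ^+ r) i j.
Proof.
elim: r i j => [|r IH] i j.
  rewrite !expr0 !mxE (inj_eq perm_inj); case: eqP => [->|_].
    by rewrite s_sqr mulr1.
  by rewrite mulr0.
rewrite !exprS [LHS]mxE [X in _ = _ * X]mxE mulr_sumr (reindex_inj (@perm_inj _ sigma)) /=.
apply: eq_bigr => l _; rewrite sgsum_equiv IH.
have := s_sqr l; move: (s l) => z zz.
by rewrite [LHS](_ : _ = (z * z) * (s i * s j *
  (sgsum A [ffun t => w (pi t)] i l * (sgsum A [ffun t => w (pi t)] ^+ r) l j)));
  [rewrite zz mul1r | ring].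
Qed.

Lemma meanpow_equiv r i j :
  meanpow A r (sigma i) (sigma j) = s i * s j * meanpow A r i j.
Proof.
rewrite !mxE -expectZ -[RHS](expect_perm _ pi).
by apply: eq_expect => w; rewrite sgsum_pow_equiv.
Qed.

End Equivariance.

Section Simplices.
Variable n : nat.

Definition cells (k : nat) : finType := {s : {set 'I_n} | #|s| == k}.

Lemma card_cell k (s : cells k) : #|val s| = k.
Proof. exact: eqP (valP s). Qed.

Lemma card_subcells k (t : {set 'I_n}) : #|t| = k.+1 ->
  #|[set s : cells k | val s \subset t]| = k.+1.
Proof.
move=> tk; rewrite -(card_imset _ val_inj).
rewrite (_ : _ @: _ = (fun x => t :\ x) @: t).
  by rewrite card_in_imset //; exact: setD1_inj.
apply/setP => s; apply/imsetP/imsetP => [[s' + ->]|[x xt ->]].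
  by rewrite inE => /face_vertex; rewrite card_cell => /(_ tk)[x xt ->]; exists x.
have H : #|t :\ x| == k by move: tk; rewrite (cardsD1 x) xt add1n => -[->].
by exists (Sub (t :\ x) H : cells k); rewrite ?inE SubK ?subD1set.
Qed.

Lemma card_supercells k (s : {set 'I_n}) : #|s| = k ->
  #|[set t : cells k.+1 | s \subset val t]| = (n - k)%N.
Proof.
move=> sk; rewrite -(card_imset _ val_inj).
rewrite (_ : _ @: _ = (fun x => x |: s) @: ~: s).
  rewrite card_in_imset.
    by have := cardsC s; rewrite card_ord sk => /(canRL (addKn _)) ->.
  move=> x y; rewrite !inE => xs ys /setP/(_ x); rewrite !inE eqxx (negbTE xs) !orbF.
  by move/esym/eqP.
apply/setP => t; apply/imsetP/imsetP => [[t' + ->]|[x xs ->]].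
  rewrite inE => /face_vertex; rewrite card_cell sk => /(_ erefl)[x xt ->].
  by exists x; rewrite ?inE ?eqxx // finset.setD1K.
have H : #|x |: s| == k.+1 by move: xs; rewrite cardsU1 inE => ->; rewrite sk.
by exists (Sub (x |: s) H : cells k.+1); rewrite ?inE SubK ?finset.subsetUr.
Qed.

Fact cell_map_subproof (g : {perm 'I_n}) (k : nat) (s : cells k) : #|g @: val s| == k.
Proof. by rewrite card_imset ?card_cell //; exact: perm_inj. Qed.

Definition cell_map g k (s : cells k) : cells k :=
  exist (fun t : {set 'I_n} => #|t| == k) _ (cell_map_subproof g s).

Lemma cell_map_inj g k : injective (@cell_map g k).
Proof.
move=> s s' /(congr1 val) /= E; apply: val_inj => /=.
exact: (imset_inj (@perm_inj _ g)).
Qed.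

Definition cell_perm g k : {perm (cells k)} := perm (@cell_map_inj g k).

Lemma val_cell_perm g k (s : cells k) : val (cell_perm g k s) = g @: val s.
Proof. by rewrite permE. Qed.

End Simplices.

Section SimplicialBlocks.
Variables (R : realType) (n d : nat).
Hypothesis d_gt0 : (0 < d)%N.
Local Notation N := #|{: cells n d}|.
Local Notation J := (cells n d.+1).

Definition facet (i : 'I_N) : {set 'I_n} := val (enum_val i).

Lemma card_facet i : #|facet i| = d.
Proof. exact: card_cell. Qed.

Lemma facet_inj : injective facet.
Proof. by move=> i j /val_inj /enum_val_inj. Qed.

Lemma facet_of (s : {set 'I_n}) : #|s| = d -> exists i, facet i = s.
Proof.
move=> /eqP sd; exists (enum_rank (Sub s sd : cells n d)).
by rewrite /facet enum_rankK SubK.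
Qed.

Definition facets_of (t : J) : {set 'I_N} := [set i | facet i \subset val t].

Definition incidence (t : J) (i : 'I_N) : R := bcoef R (val t) (facet i).

(** The adjacency matrix of a single cell in the basis of the increasing
    orientations. The minus sign is due to the opposite orientation in the
    definition of adjacency. *)
Definition simplex_mx (t : J) : 'M[R]_N :=
  \matrix_(i, j) - ((i != j)%:R * (incidence t i * incidence t j)).

Lemma incidence_sqr t i : i \in facets_of t -> incidence t i * incidence t i = 1.
Proof.
by rewrite inE -expr2 => it; apply: bcoef_sqr => //; rewrite card_facet card_cell.
Qed.

Lemma incidence_sqrE t i : incidence t i * incidence t i = (i \in facets_of t)%:R.
Proof.
have [/incidence_sqr ->//|] := boolP (i \in facets_of t).
by rewrite inE => it; rewrite /incidence bcoef_out // mul0r.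
Qed.

Lemma incidence_neq0 t i : incidence t i != 0 -> i \in facets_of t.
Proof.
by apply: contraNT; rewrite inE => it; rewrite /incidence bcoef_out.
Qed.

(** This is why two distinct facets determine their cell. *)
Lemma facetsU t i j : i != j -> i \in facets_of t -> j \in facets_of t ->
  facet i :|: facet j = val t.
Proof.
rewrite !inE => ij it jt; apply/eqP; rewrite eqEcard finset.subUset it jt /= card_cell.
have : facet i \proper facet i :|: facet j.
  rewrite finset.properEneq finset.subsetUl andbT eq_sym; apply: contra ij => /eqP E.
  apply/eqP/facet_inj/eqP; rewrite eq_sym eqEcard !card_facet leqnn andbT.
  by rewrite -E finset.subsetUr.
by move/proper_card; rewrite card_facet.
Qed.

Lemma simplex_block_system : block_system facets_of simplex_mx d.+1 (n - d).
Proof.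
split.
- by move=> t; apply/matrixP => i j; rewrite !mxE eq_sym [_ t j * _]mulrC.
- move=> t i j; rewrite mxE oppr_eq0 !mulf_eq0 !negb_or => /and3P[ij i0 j0].
  by split; [exact: incidence_neq0 | exact: incidence_neq0 |
    by case: (i != j) ij; rewrite ?eqxx].
- move=> t i j; rewrite mxE normrN normrM.
  rewrite -[leRHS]mulr1; apply: ler_pM => //.
    by case: (i != j); rewrite ?normr1 ?normr0 ?ler01.
  have b1 l : `|incidence t l| <= 1.
    rewrite -(@ler_pXn2r _ 2) ?nnegrE ?ler01 ?normr_ge0 // expr1n -normrX expr2.
    by rewrite incidence_sqrE; case: (l \in _); rewrite ?normr1 ?normr0 ?ler01.
  by rewrite normrM -[leRHS]mulr1; apply: ler_pM.
- move=> t; rewrite -(card_subcells (card_cell t)).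
  rewrite (_ : facets_of t = enum_val @^-1: [set s : cells n d | val s \subset val t]).
    by rewrite on_card_preimset //; apply: onW_bij; exact: enum_val_bij.
  by apply/setP => i; rewrite !inE.
- move=> t t' i j ij it jt it' jt'; apply: val_inj.
  by rewrite -(facetsU ij it jt) (facetsU ij it' jt').
- move=> i; rewrite -(card_supercells (card_facet i)).
  by congr #|pred_of_set _|; apply/setP => t; rewrite !inE.
Qed.

Lemma simplex_unit t i j : i \in facets_of t -> j \in facets_of t -> i != j ->
  simplex_mx t i j ^+ 2 = 1.
Proof.
move=> it jt ij; rewrite mxE ij mul1r sqrrN expr2 mulrACA.
by rewrite !incidence_sqr // mulr1.
Qed.

Lemma simplex_triangle t i j l :
  simplex_mx t i j * simplex_mx t j l * simplex_mx t l i <= 0.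
Proof.
rewrite !mxE; set x := _ *+ (i != j); set y := _ *+ (j != l); set z := _ *+ (l != i).
have x0 : 0 <= x by rewrite ler0n.
have y0 : 0 <= y by rewrite ler0n.
have z0 : 0 <= z by rewrite ler0n.
rewrite [leLHS](_ : _ = - (x * y * z * (incidence t i * incidence t j * incidence t l) ^+ 2)).
  by rewrite oppr_le0 mulr_ge0 ?sqr_ge0 // !mulr_ge0.
by ring.
Qed.

(** The sum of the blocks is a shifted lower Laplacian: two facets of a cell
    meet in a ridge, and the squared boundary operator vanishes. *)
Lemma simplex_lower :
  let F := \matrix_(i < N, r < #|{: cells n d.-1}|) bcoef R (facet i) (val (enum_val r)) in
  \sum_t simplex_mx t + d%:R%:M = F *m F^T.
Proof.
move=> F.
have FE i j : (F *m F^T) i j =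
    \sum_(r : cells n d.-1) bcoef R (facet i) (val r) * bcoef R (facet j) (val r).
  rewrite mxE [RHS](reindex (@enum_val (cells n d.-1) predT)) /=; last first.
    by apply: onW_bij; exact: enum_val_bij.
  by apply: eq_bigr => r _; rewrite !mxE.
have dE i : #|facet i| = d.-1.+1 by rewrite card_facet prednK.
apply/matrixP => i j; rewrite FE !mxE summxE.
have [<-|ij] := eqVneq i j.
  rewrite mulr1n big1 ?add0r; last by move=> t _; rewrite mxE eqxx mul0r oppr0.
  rewrite (eq_bigr (fun r : cells n d.-1 => (val r \subset facet i)%:R)); last first.
    move=> r _; rewrite -expr2; have [H|H] := boolP (_ \subset _).
      by rewrite bcoef_sqr // card_cell.
    by rewrite bcoef_out // expr0n.
  have -> : d%:R = #|[set r : cells n d.-1 | val r \subset facet i]|%:R :> R.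
    by rewrite card_subcells ?dE // prednK.
  rewrite -sum1_card natr_sum big_mkcond /=; apply: eq_bigr => r _.
  by rewrite inE; case: ifP.
rewrite mulr0n addr0.
have [t0 /andP[it jt]|no] := pickP [pred t | (i \in facets_of t) && (j \in facets_of t)].
  rewrite (bigD1 t0) //= big1 ?addr0; last first.
    move=> t tt0; rewrite mxE; have [it'|/negP it'] := boolP (i \in facets_of t); last first.
      have -> : incidence t i = 0 by apply/eqP; apply: contraTT isT => /incidence_neq0.
      by rewrite mul0r mulr0 oppr0.
    have -> : incidence t j = 0.
      apply/eqP; apply: contraNT tt0 => /incidence_neq0 jt'.
      by apply/eqP; apply: (block_pair simplex_block_system ij).
    by rewrite !mulr0 oppr0.
  move: (it) (jt); rewrite !inE => /face_vertex.
  rewrite card_facet card_cell => /(_ erefl)[x xt ix] /face_vertex.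
  rewrite card_facet card_cell => /(_ erefl)[y yt jy].
  have xy : x != y by apply: contra ij => /eqP E; apply/eqP/facet_inj; rewrite ix jy E.
  have rC : val t0 :\ y :\ x = val t0 :\ x :\ y.
    by rewrite !finset.setDDl finset.setUC.
  have H : #|val t0 :\ x :\ y| == d.-1.
    have := card_cell t0; rewrite (cardsD1 x) xt (cardsD1 y) !inE eq_sym xy yt /=.
    by rewrite !add1n -[d in RHS](prednK d_gt0) => -[->].
  rewrite (bigD1 (Sub (val t0 :\ x :\ y) H : cells n d.-1)) //= big1 ?addr0 => [|r rr0].
    rewrite mxE ij mul1r /incidence ix jy -{2}rC !bcoefE ?inE ?xt ?yt ?xy 1?eq_sym ?xy //.
    have := eps_anticomm R xt yt xy; have := eps_sqr R (val t0) x.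
    have := eps_sqr R (val t0 :\ y) x.
    move: (eps R _ x) (eps R _ x) (eps R _ y) (eps R _ y) => a b c e.
    by nra.
  have [rx|rx] := boolP (val r \subset facet i); last by rewrite bcoef_out ?mul0r.
  have [ry|ry] := boolP (val r \subset facet j); last by rewrite mulrC bcoef_out ?mul0r.
  case/negP: rr0; apply/eqP/val_inj/eqP; rewrite SubK eqEcard (eqP H) card_cell leqnn andbT.
  by rewrite ix in rx; rewrite jy in ry; rewrite finset.subsetD1 rx; move: ry; rewrite finset.subsetD1 => /andP[].
rewrite !big1 // => [r _|t _].
  have [rx|rx] := boolP (val r \subset facet i); last by rewrite bcoef_out ?mul0r.
  have [ry|ry] := boolP (val r \subset facet j); last by rewrite mulrC bcoef_out ?mul0r.
  have [|x xi rE] := face_vertex rx; first by rewrite card_cell.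
  have xj : x \notin facet j.
    apply: contra ij => xj; apply/eqP/facet_inj/eqP; rewrite eqEcard !card_facet leqnn andbT.
    by rewrite -(finset.setD1K xi) -rE finset.subUset finset.sub1set xj.
  have H : #|x |: facet j| == d.+1 by rewrite cardsU1 xj card_facet.
  have := no (Sub (x |: facet j) H : J); rewrite /= !inE SubK finset.subsetUr andbT.
  by rewrite -(finset.setD1K xi) -rE finset.setUS.
rewrite mxE; have := no t; rewrite /= => /negbT/nandP[] /negP H.
  have -> : incidence t i = 0 by apply/eqP; apply/negPn/negP => /incidence_neq0.
  by rewrite mul0r mulr0 oppr0.
have -> : incidence t j = 0 by apply/eqP; apply/negPn/negP => /incidence_neq0.
by rewrite !mulr0 oppr0.
Qed.

Lemma simplex_upper :
  let F := \matrix_(i < N, t < #|{: J}|) incidence (enum_val t) i in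
  (n - d)%:R%:M - \sum_t simplex_mx t = F *m F^T.
Proof.
move=> F.
have FE i j : (F *m F^T) i j = \sum_t incidence t i * incidence t j.
  rewrite mxE [RHS](reindex (@enum_val J predT)) /=; last first.
    by apply: onW_bij; exact: enum_val_bij.
  by apply: eq_bigr => r _; rewrite !mxE.
apply/matrixP => i j; rewrite FE !mxE summxE -sumrN.
have [<-|ij] := eqVneq i j.
  rewrite mulr1n -(block_deg simplex_block_system i).
  rewrite [X in _ + X]big1 ?addr0; last by move=> t _; rewrite mxE eqxx mul0r !oppr0.
  rewrite -sum1_card natr_sum big_mkcond /=; apply: eq_bigr => t _.
  by rewrite inE incidence_sqrE; case: ifP.
by rewrite mulr0n add0r; apply: eq_bigr => t _; rewrite mxE ij mul1r opprK.
Qed.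

Definition facet_perm (g : {perm 'I_n}) : {perm 'I_N} :=
  perm (inj_comp enum_rank_inj (inj_comp (@perm_inj _ (cell_perm g d)) (@enum_val_inj _ _))).

Lemma facet_permE g i : facet (facet_perm g i) = g @: facet i.
Proof. by rewrite permE /= /facet enum_rankK val_cell_perm. Qed.

Lemma simplex_mx_perm g t i j :
  simplex_mx (cell_perm g d.+1 t) (facet_perm g i) (facet_perm g j) =
  inv_sign R g (facet i) * inv_sign R g (facet j) * simplex_mx t i j.
Proof.
rewrite !mxE (inj_eq perm_inj) /incidence !facet_permE val_cell_perm.
rewrite !bcoef_perm ?card_cell ?card_facet //.
have := inv_sign_sqr R g (val t); move: (inv_sign R g (val t)) => e ee.
rewrite [RHS](_ : _ = (e * e) * (inv_sign R g (facet i) * inv_sign R g (facet j) *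
  - ((i != j)%:R * (bcoef R (val t) (facet i) * bcoef R (val t) (facet j))))).
  by ring.
by rewrite ee mul1r.
Qed.

(** The vertex permutations act transitively on the facets and on the pairs of
    distinct facets of a common cell, and they preserve the law of the signs. *)
Lemma simplex_mean r : exists a u : R,
  (forall i, meanpow simplex_mx r i i = a) /\
  (forall t i j, i \in facets_of t -> j \in facets_of t -> i != j ->
     meanpow simplex_mx r i j = u * simplex_mx t i j).
Proof.
have E g := @meanpow_equiv R N _ simplex_mx (facet_perm g) (cell_perm g d.+1)
  (fun i => inv_sign R g (facet i)) (fun i => inv_sign_sqr R g (facet i))
  (simplex_mx_perm g) r.
pose good (x : J * ('I_N * 'I_N)) :=
  [&& x.2.1 \in facets_of x.1, x.2.2 \in facets_of x.1 & x.2.1 != x.2.2].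
exists (if [pick i : 'I_N | true] is Some i then meanpow simplex_mx r i i else 0).
exists (if [pick x | good x] is Some x then
  meanpow simplex_mx r x.2.1 x.2.2 * simplex_mx x.1 x.2.1 x.2.2 else 0).
split=> [i|t i j it jt ij].
  case: pickP => [i0 _|/(_ i) //].
  have [g gi] := perm_of_cells (etrans (card_facet i0) (esym (card_facet i))).
  have <- : facet_perm g i0 = i by apply: facet_inj; rewrite facet_permE.
  by rewrite E inv_sign_sqr mul1r.
case: pickP => [[t0 [i0 j0]] /and3P[/= it0 jt0 ij0]|/(_ (t, (i, j)))]; last first.
  by rewrite /good /= it jt ij.
have V t1 k : k \in facets_of t1 -> exists2 x, x \in val t1 & facet k = val t1 :\ x.
  by rewrite inE => /face_vertex; rewrite card_facet card_cell => /(_ erefl).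
have VN (t1 : J) k l x y : k != l -> facet k = val t1 :\ x -> facet l = val t1 :\ y -> x != y.
  by move=> kl kx ly; apply: contra kl => /eqP E1; apply/eqP/facet_inj; rewrite kx ly E1.
have [x xt ix] := V _ _ it; have [y yt jy] := V _ _ jt.
have [x0 xt0 ix0] := V _ _ it0; have [y0 yt0 jy0] := V _ _ jt0.
have [g [gt gx gy]] := perm_of_flags (etrans (card_cell t0) (esym (card_cell t)))
  xt0 yt0 (VN _ _ _ _ _ ij0 ix0 jy0) xt yt (VN _ _ _ _ _ ij ix jy).
have gD z : g @: (val t0 :\ z) = val t :\ g z.
  apply/setP => a; rewrite !inE -gt; apply/imsetP/andP.
    case=> b; rewrite !inE => /andP[bz bt] ->; split; last exact: imset_f.
    by apply: contra bz => /eqP/perm_inj ->.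
  case=> az /imsetP[b bt ab]; exists b => //; rewrite !inE bt andbT.
  by apply: contra az => /eqP <-; rewrite ab.
have <- : cell_perm g d.+1 t0 = t by apply: val_inj; rewrite val_cell_perm.
have <- : facet_perm g i0 = i by apply: facet_inj; rewrite facet_permE ix0 gD gx.
have <- : facet_perm g j0 = j by apply: facet_inj; rewrite facet_permE jy0 gD gy.
rewrite E simplex_mx_perm; have := simplex_unit it0 jt0 ij0.
move: (simplex_mx t0 i0 j0) => a aa.
rewrite [RHS](_ : _ = a ^+ 2 * (inv_sign R g (facet i0) * inv_sign R g (facet j0)
  * meanpow simplex_mx r i0 j0)); first by rewrite aa mul1r.
by ring.
Qed.

Lemma simplex_homogeneous : homogeneous_blocks facets_of simplex_mx d.+1 (n - d).
Proof.
split.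
- exact: simplex_unit.
- exact: simplex_triangle.
- exact: simplex_mean.
- by eexists; eexists; exact: simplex_lower.
- by eexists; eexists; exact: simplex_upper.
Qed.

End SimplicialBlocks.

(** * Spectra of symmetric matrices *)

Section Spectrum.
Variables (R : realType) (N : nat).
Implicit Types (M : 'M[R]_N) (v : 'rV[R]_N).

Lemma rank_diag (F : fieldType) n (u : 'rV[F]_n) :
  \rank (diag_mx u) = (\sum_i (u 0%R i != 0%R))%N.
Proof.
elim: n u => [|n IH]; first by move=> u; rewrite big_ord0 [diag_mx _]thinmx0 mxrank0.
rewrite -[n.+1]/(1 + n)%N => u; rewrite -[u]hsubmxK diag_mx_row rank_diag_block_mx IH.
rewrite big_split_ord /= big_ord1 row_mxEl rank_rV; congr (nat_of_bool _ + _)%N.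
  congr negb; apply/eqP/eqP => [/matrixP/(_ 0 0)|H]; first by rewrite !mxE.
  by apply/matrixP => i j; rewrite !ord1 [LHS]mxE H mul0rn mxE.
by apply: eq_bigr => i _; rewrite row_mxEr.
Qed.

(** Over the complex numbers M is unitarily diagonalizable with a real spectrum,
    and ranks do not change under field extension. *)
Lemma real_symmetric_rank M : M^T = M ->
  exists l : 'rV[R]_N, forall a, \rank (M - a%:M) = (\sum_i (l 0%R i != a))%N.
Proof.
move=> Ms; pose f : {rmorphism R -> complex.complex R} := @complex.real_complex_def R (Phant R).
pose MC := map_mx f M.
have fr x : f x \is Num.real by apply/complex.complex_realP; exists x.
have MCr : MC \is a mxOver Num.real by apply/mxOverP => i j; rewrite mxE.
have MCh : MC \is hermitianmx _ false Num.conj.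
  apply: spectral.realsym_hermsym => //; apply/is_hermitianmxP.
  by rewrite expr0 scale1r; apply/matrixP => i j; rewrite !mxE /= -[in LHS]Ms mxE.
have spr := spectral.hermitian_spectral_diag_real MCh.
have /spectral.orthomx_spectralP spE := spectral.hermitian_normalmx MCh.
pose P := spectral.spectralmx MC; pose sp := spectral.spectral_diag MC.
have Pu : P \in unitmx := spectral.spectral_unit MC.
have [l lE] : exists l : 'rV[R]_N, sp = map_mx f l.
  exists (map_mx (@complex.Re R) sp); apply/matrixP => i j; rewrite !mxE.
  by have /mxOverP/(_ i j)/complex.RRe_real <- := spr.
exists l => a; rewrite -(mxrank_map f) raddfB /= map_scalar_mx /= -/MC.
rewrite spE -/P -/sp.
have -> : invmx P *m diag_mx sp *m P - (f a)%:M = invmx P *m map_mx f (diag_mx (l - const_mx a)) *m P.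
  rewrite map_diag_mx map_mxB map_const_mx -lE raddfB /= diag_const_mx.
  by rewrite mulmxBr mulmxBl mul_mx_scalar -scalemxAl mulVmx // scalemx1.
rewrite mxrankMfree ?row_free_unit // -mxrank_tr trmx_mul mxrankMfree; last first.
  by rewrite row_free_unit unitmx_tr unitmx_inv.
by rewrite mxrank_tr mxrank_map rank_diag; apply: eq_bigr => i _; rewrite !mxE subr_eq0.
Qed.

Lemma symmetric_spectrum M : M^T = M ->
  exists s : seq R, [/\ sorted (fun x y : R => x <= y) s, size s = N &
    forall a, count_mem a s = \rank (eigenspace M a)].
Proof.
move=> /real_symmetric_rank[l lE].
exists (sort (fun x y : R => x <= y) [seq l 0 i | i <- enum 'I_N]); split.
- by apply: sort_sorted => x y; exact: le_total.
- by rewrite size_sort size_map size_enum_ord.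
- move=> a; rewrite mxrank_ker lE count_sort count_map -sum1_count big_enum_cond /=.
  rewrite -[X in (X - _)%N]card_ord -sum1_card big_mkcond /=.
  apply/eqP; rewrite eq_sym -(eqn_add2r (\sum_i (l 0%R i != a))%N) subnK; last first.
    by apply: leq_sum => i _; case: (_ != _).
  by rewrite -big_split; apply/eqP/eq_bigr => i _ /=; case: (_ == _).
Qed.

Local Notation dot u v := ((u *m v^T) 0 0).

Lemma eigen_orthogonal M (u v : 'rV[R]_N) a b : M^T = M ->
  u *m M = a *: u -> v *m M = b *: v -> a != b -> dot u v = 0.
Proof.
move=> Ms uM vM ab; apply/eqP; have : a * dot u v = b * dot u v.
  have -> : a * dot u v = dot (u *m M) v by rewrite uM -scalemxAl [RHS]mxE.
  by rewrite -mulmxA -{1}Ms -trmx_mul vM linearZ /= -scalemxAr [LHS]mxE.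
by move/eqP; rewrite -subr_eq0 -mulrBl mulf_eq0 subr_eq0 (negbTE ab).
Qed.

Lemma dot_eq0 v : dot v v = 0 -> v = 0.
Proof.
rewrite dot_sumE => /eqP; rewrite psumr_eq0 => [/allP v0|i _]; last first.
  by rewrite -expr2 sqr_ge0.
apply/rowP => i; have := v0 i (mem_index_enum _); rewrite -expr2 expf_eq0 /= => /eqP ->.
by rewrite mxE.
Qed.

Section Interlacing.
Variables (M : 'M[R]_N) (s : seq R).
Hypotheses (M_sym : M^T = M) (s_sorted : sorted (fun x y : R => x <= y) s)
  (s_size : size s = N) (s_count : forall a, count_mem a s = \rank (eigenspace M a)).

Definition upper_space c : 'M[R]_N :=
  (\sum_(i < size (undup s) | (c < nth 0 (undup s) i)%R) eigenspace M (nth 0 (undup s) i))%MS.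

Lemma rank_upper_space c : \rank (upper_space c) = count (fun x => c < x) s.
Proof.
have inj : injective (fun i : 'I_(size (undup s)) => nth 0 (undup s) i).
  move=> i j /eqP; rewrite nth_uniq ?undup_uniq // => /eqP; exact: val_inj.
have /mxdirectP /= -> := mxdirect_sum_eigenspace M
  (in2W inj : {in [pred i : 'I_(size (undup s)) | c < nth 0 (undup s) i] &, injective _}).
rewrite -(big_mkord (fun i => c < nth 0 (undup s) i)
  (fun i => \rank (eigenspace M (nth 0 (undup s) i)))).
rewrite -(big_nth 0 (fun x => c < x) (fun x => \rank (eigenspace M x))).
rewrite -[RHS]sum1_count -(big_undup_iterop_count _ s (fun x => c < x) (fun=> 1%N)).
apply: eq_bigr => x _; rewrite -s_count.
by case: (count_mem x s) => [//|k]; rewrite iteropS iter_addn mul1n addn1.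
Qed.

Lemma upper_space_form c v : (v <= upper_space c)%MS ->
  qform M v <= c * dot v v -> v = 0.
Proof.
pose a (i : 'I_(size (undup s))) := nth 0 (undup s) i.
case/sub_sumsmxP => w ->; pose z i := w i *m eigenspace M (a i).
set x := (X in qform M X); have -> : x = \sum_(i | c < a i) z i by [].
have zM i : z i *m M = a i *: z i by apply/eigenspaceP; rewrite submxMl.
have orth i j : i != j -> dot (z i) (z j) = 0.
  move=> ij; apply: (eigen_orthogonal M_sym (zM i) (zM j)).
  by rewrite /a nth_uniq ?undup_uniq.
have dotE (b : 'I_(size (undup s)) -> R) :
    dot (\sum_(i | c < a i) b i *: z i) (\sum_(i | c < a i) z i) =
    \sum_(i | c < a i) b i * dot (z i) (z i).
  rewrite mulmx_suml summxE; apply: eq_bigr => i ci.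
  rewrite -scalemxAl mxE raddf_sum mulmx_sumr summxE (bigD1 i) //= big1 ?addr0 //.
  by move=> j /andP[_ ji]; apply: orth; rewrite eq_sym.
have -> : qform M (\sum_(i | c < a i) z i) = \sum_(i | c < a i) a i * dot (z i) (z i).
  by rewrite -dotE /qform mulmx_suml; congr ((_ *m _) 0 0); apply: eq_bigr => i _; rewrite zM.
have -> : dot (\sum_(i | c < a i) z i) (\sum_(i | c < a i) z i) =
    \sum_(i | c < a i) dot (z i) (z i).
  have := dotE (fun=> 1); rewrite (eq_bigr z) => [->|i _]; last by rewrite scale1r.
  by apply: eq_bigr => i _; rewrite mul1r.
rewrite mulr_sumr -subr_le0 -sumrB => le0.
have ge0 i : c < a i -> 0 <= (a i - c) * dot (z i) (z i).
  by move=> ci; apply: mulr_ge0; rewrite ?subr_ge0 ?dot_ge0 // ltW.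
have z0 i : c < a i -> z i = 0.
  move=> ci; apply: dot_eq0; apply/eqP.
  have : (a i - c) * dot (z i) (z i) == 0.
    rewrite eq_le ge0 // andbT; apply: le_trans le0; rewrite (bigD1 i) //= -mulrBl lerDl.
    by apply: sumr_ge0 => j /andP[cj _]; rewrite -mulrBl; exact: ge0.
  by rewrite mulf_eq0 subr_eq0 gt_eqF.
by apply: big1.
Qed.

(** Courant-Fischer: a k-dimensional space on which the form is at most c meets
    the span of the eigenvectors above c trivially. *)
Lemma small_eigenvalues_le k (V : 'M[R]_(k, N)) c : row_free V ->
  (forall v, (v <= V)%MS -> qform M v <= c * dot v v) ->
  {in take k s, forall a, a <= c}.
Proof.
move=> Vfree Vc a /(nthP 0)[i]; rewrite size_take => ik <-.
have [iK iN] : (i < k)%N /\ (i < N)%N.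
  by move: ik; rewrite s_size; case: (ltnP k N) => kN ik; split=> //;
    [exact: (ltn_trans ik kN) | exact: (leq_trans ik kN)].
rewrite nth_take // leNgt; apply/negP => ci.
have cnt : (N - i <= count (fun x => (c < x)%R) s)%N.
  rewrite -{1}s_size -size_drop -{2}[s](cat_take_drop i) count_cat.
  apply: leq_trans (leq_addl _ _); rewrite leq_eqVlt eq_sym -all_count; apply/orP; left.
  apply/(all_nthP 0) => j; rewrite size_drop => jN; rewrite nth_drop.
  apply: lt_le_trans ci _.
  apply: (sorted_leq_nth (@le_trans _ R) (@lexx _ R) 0 s_sorted); rewrite ?inE ?s_size //.
    by rewrite -ltn_subRL -s_size.
  by rewrite leq_addr.
have : (0 < \rank (V :&: upper_space c)%MS)%N.
  have := mxrank_sum_cap V (upper_space c); rewrite rank_upper_space (eqP Vfree).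
  have := rank_leq_col (V + upper_space c)%MS; move: cnt iK iN.
  move: (\rank (V + _)%MS) (\rank (V :&: _)%MS) (count _ s) => x y z; clear; lia.
rewrite lt0n mxrank_eq0 => /rowV0Pn[v]; rewrite sub_capmx => /andP[vV vU].
by rewrite (upper_space_form vU (Vc v vV)) eqxx.
Qed.

Lemma eigenvalue_ge c : (forall v, c * dot v v <= qform M v) -> {in s, forall a, c <= a}.
Proof.
move=> Mc a sa; have : (0 < \rank (eigenspace M a))%N by rewrite -s_count -has_count has_pred1.
rewrite lt0n mxrank_eq0 => /rowV0Pn[v /eigenspaceP vM v0].
have := Mc v; rewrite /qform vM -scalemxAl [leRHS]mxE ler_pM2r // lt_def dot_ge0 andbT.
by apply: contra v0 => /eqP/dot_eq0 ->.
Qed.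

End Interlacing.
End Spectrum.

(** * The spectrum of a random complex with a given set of cells *)

Section SimplicialSpectrum.
Variables (R : realType) (n d : nat).
Hypothesis d_gt0 : (0 < d)%N.
Local Notation N := #|{: cells n d}|.
Local Notation J := (cells n d.+1).
Local Notation A := (@simplex_mx R n d).

(** The squared boundary operator vanishes: a ridge of t lies in exactly two
    facets of t, with opposite signs. *)
Lemma boundary_boundary (t : J) (r : cells n d.-1) :
  \sum_(i < N) incidence R t i * bcoef R (facet i) (val r) = 0.
Proof.
have [rt|rt] := boolP (val r \subset val t); last first.
  apply: big1 => i _; have [it|it] := boolP (i \in facets_of t).
    rewrite [bcoef _ _ _]bcoef_out ?mulr0 //; apply: contra rt => ri.
    by rewrite inE in it; exact: (fintype.subset_trans ri it).
  by rewrite /incidence bcoef_out ?mul0r //; rewrite inE in it.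
have /cards2P[x [y [xy trE]]] : #|val t :\: val r| == 2%N.
  rewrite cardsD (finset.setIidPr rt) !card_cell; move: d_gt0; clear; lia.
have /andP[xr xt] : (x \notin val r) && (x \in val t) by rewrite -finset.in_setD trE !inE eqxx.
have /andP[yr yt] : (y \notin val r) && (y \in val t) by rewrite -finset.in_setD trE !inE eqxx orbT.
have cD z : z \in val t -> #|val t :\ z| = d.
  by move=> zt; have := card_cell t; rewrite (cardsD1 z) zt add1n => -[].
have [i iE] := facet_of (cD x xt); have [j jE] := facet_of (cD y yt).
have ij : j != i.
  apply: contra xy => /eqP E; move: iE; rewrite -E jE => /(setD1_inj yt xt) ->.
  exact: eqxx.
have rE : val r = val t :\ x :\ y.
  apply/setP => z; have := congr1 (fun q : {set 'I_n} => z \in q) trE.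
  rewrite /= !inE; have [zr|_] := boolP (z \in val r).
    by rewrite (fintype.subsetP rt) //= => /esym/negbT; rewrite negb_or => /andP[-> ->].
  by case: (z \in val t) => /= [/esym|_]; rewrite ?andbF // andbT -negb_or orbC => ->.
rewrite (bigD1 i) //= (bigD1 j) //= big1 ?addr0 => [|k /andP[ki kj]].
  rewrite /incidence iE jE !bcoefE // {1}rE (_ : val r = val t :\ y :\ x); last first.
    by rewrite rE !finset.setDDl finset.setUC.
  rewrite !bcoefE ?inE ?xt ?yt ?xy 1?eq_sym ?xy // eps_anticomm //.
  by rewrite addNr.
have [kt|kt] := boolP (k \in facets_of t); last first.
  by rewrite /incidence bcoef_out ?mul0r //; rewrite inE in kt.
rewrite [bcoef _ _ _]bcoef_out ?mulr0 //; apply/negP => rk.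
move: kt; rewrite inE => /face_vertex; rewrite card_facet card_cell => /(_ erefl)[z zt kE].
have : z \in val t :\: val r.
  by rewrite finset.in_setD zt andbT; apply: contraL rk => zr; apply/negP => /fintype.subsetP/(_ z zr);
    rewrite kE !inE eqxx.
rewrite trE !inE => /orP[] /eqP zE; [case/eqP: ki | case/eqP: kj];
  by apply: facet_inj; rewrite kE ?iE ?jE zE.
Qed.

(** In the lower Laplacian F F^T the boundary F comes first, and it annihilates
    the boundary of a cell. *)
Lemma incidence_eigenvector (t : J) :
  (\row_i incidence R t i) *m (\sum_t A t) = - d%:R *: \row_i incidence R t i.
Proof.
have := @simplex_lower R n d d_gt0; set F := \matrix_(i, r) _ => FE.
have -> : \sum_t A t = F *m F^T - d%:R%:M by rewrite -FE addrK.
rewrite mulmxBr mulmxA (_ : _ *m F = 0) ?mul0mx ?sub0r ?mul_mx_scalar ?scaleNr //.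
apply/matrixP => i r; rewrite !mxE -[RHS](boundary_boundary t (enum_val r)).
by apply: eq_bigr => k _; rewrite !mxE.
Qed.

Section Star.
Variable x0 : 'I_n.

Definition star : {set J} := [set t : J | x0 \in val t].

Definition star_mx : 'M[R]_(#|star|, N) := \matrix_(k, i) incidence R (enum_val k) i.

Lemma card_star : #|star| = 'C(n.-1, d).
Proof.
rewrite -[n in RHS]card_ord -(cardsC1 x0) -cards_draws.
rewrite -(card_in_imset (f := fun t : J => val t :\ x0)); last first.
  move=> s t; rewrite !inE => sx tx E; apply: val_inj.
  by rewrite -(finset.setD1K sx) E finset.setD1K.
congr #|pred_of_set _|; apply/setP => s; rewrite !inE.
apply/imsetP/andP => [[t + ->]|[sx /eqP sd]].
  rewrite inE => tx; have := card_cell t; rewrite (cardsD1 x0 (val t)) tx add1n => -[->].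
  by rewrite eqxx; split=> //; apply/fintype.subsetP => y; rewrite !inE => /andP[].
have xs : x0 \notin s.
  by apply/negP => /(fintype.subsetP sx); rewrite !inE eqxx.
have H : #|x0 |: s| == d.+1 by rewrite cardsU1 xs sd.
exists (Sub (x0 |: s) H : J); first by rewrite inE SubK !inE eqxx.
by rewrite SubK finset.setU1K.
Qed.

(** The facet opposite to x0 tells the cells of the star apart. *)
Lemma star_mx_free : row_free star_mx.
Proof.
apply/row_freeP.
exists (\matrix_(i, k) ((facet i == val (enum_val k) :\ x0)%:R * eps R (val (enum_val k)) x0)).
apply/matrixP => k l; rewrite !mxE.
have xk (m : 'I_#|star|) : x0 \in val (enum_val m).
  by have := enum_valP m; rewrite inE.
have cD : #|val (enum_val l) :\ x0| = d.
  by have := card_cell (enum_val l); rewrite (cardsD1 x0) xk add1n => -[].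
have [i iE] := facet_of cD.
rewrite (bigD1 i) //= big1 ?addr0 => [|j ji]; last first.
  by rewrite !mxE -iE (inj_eq (@facet_inj _ _)) (negbTE ji) mul0r mulr0.
rewrite !mxE iE eqxx mul1r; have [->|kl] := eqVneq k l.
  by rewrite /incidence iE bcoefE // -expr2 eps_sqr.
rewrite /incidence bcoef_out ?mul0r // iE; apply: contra kl => sub.
apply/eqP/enum_val_inj/val_inj/eqP; rewrite eq_sym eqEcard !card_cell leqnn andbT.
by rewrite -(finset.setD1K (xk l)) finset.subUset finset.sub1set xk.
Qed.

End Star.

(** The lower bound holds for all eigenvalues because the adjacency matrix of the
    complete complex is at least - d; the upper one is Courant-Fischer for the
    span of the rows of star_mx. *)
Lemma cells_spectrum (p h : R) (w : {ffun J -> bool}) : (0 < n)%N -> 0 <= p ->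
  qform_le (centered_sum A p w) h ->
  exists s : seq R, [/\ sorted (fun x y : R => x <= y) s, size s = N,
    forall a, count_mem a s = \rank (eigenspace (\sum_t (w t)%:R *: A t) a)
    & {in take 'C(n.-1, d) s, forall a, - (p * d%:R) - h <= a <= - (p * d%:R) + h}].
Proof.
move=> n_gt0 p0 Hh; set M := \sum_t _.
have HB := simplex_block_system R n d.
have ME : M = p *: (\sum_t A t) + centered_sum A p w.
  rewrite /centered_sum /block_sum scaler_sumr -big_split; apply: eq_bigr => t _ /=.
  by rewrite -scalerDl /centered addrC subrK.
have Ms : M^T = M.
  rewrite /M raddf_sum; apply: eq_bigr => t _ /=.
  by rewrite linearZ /= (block_sym HB).
have [s [s1 s2 s3]] := symmetric_spectrum Ms; exists s; split=> // a sa.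
have qE v : qform M v = p * (v *m (\sum_t A t) *m v^T) 0 0 + qform (centered_sum A p w) v.
  by rewrite /qform ME mulmxDr mulmxDl -scalemxAr -scalemxAl [LHS]mxE [X in X + _]mxE.
apply/andP; split.
  apply: (eigenvalue_ge s3 _ (mem_take sa)) => v; rewrite qE.
  have /ler_normlP[H _] := Hh v.
  have : - d%:R * (v *m v^T) 0 0 <= (v *m (\sum_t A t) *m v^T) 0 0.
    have := @simplex_lower R n d d_gt0; set F := \matrix_(i, r) _ => FE.
    have -> : \sum_t A t = F *m F^T - d%:R%:M by rewrite -FE addrK.
    have -> : (v *m (F *m F^T - d%:R%:M) *m v^T) 0 0 =
        ((v *m F) *m (v *m F)^T) 0 0 - d%:R * (v *m v^T) 0 0.
      rewrite mulmxBr mulmxBl mul_mx_scalar -scalemxAl trmx_mul !mulmxA [LHS]mxE.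
      by congr (_ + _); rewrite [LHS]mxE; congr (- _); rewrite [LHS]mxE.
    by rewrite mulNr lerDr dot_ge0.
  by move=> /(ler_wpM2l p0); lra.
have x0 : 'I_n by exists 0%N.
have sa' : a \in take #|star x0| s by rewrite card_star.
apply: (small_eigenvalues_le Ms s1 s2 s3 (star_mx_free x0) _ sa').
move=> v /submxP[u vE]; rewrite qE.
have /ler_normlP[_ H] := Hh v.
have -> : v *m (\sum_t A t) = - d%:R *: v.
  rewrite vE -mulmxA scalemxAr; congr (_ *m _); apply/row_matrixP => k.
  rewrite row_mul linearZ /= (_ : row k _ = \row_i incidence R (enum_val k) i).
    exact: incidence_eigenvector.
  by apply/rowP => i; rewrite !mxE.
by rewrite -scalemxAl mxE; lra.
Qed.

End SimplicialSpectrum.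

(** * Orientations as signs *)

Section TupleSign.
Variables (R : realType) (n : nat).
Implicit Types (x y : 'I_n).

Definition vertex_set k (s : k.-tuple 'I_n) : {set 'I_n} := [set x in s].

Lemma card_vertex_set k (s : k.-tuple 'I_n) : uniq s -> #|vertex_set s| = k.
Proof. by move=> us; rewrite cardsE -[RHS](size_tuple s); exact/card_uniqP. Qed.

Lemma vertex_set_reorder k (s : k.-tuple 'I_n) g : vertex_set (reorder s g) = vertex_set s.
Proof. by apply/setP => x; rewrite !inE reorder_mem. Qed.

(** The parity of the number of inversions of s. *)
Definition tsgn k (s : k.-tuple 'I_n) : R :=
  Num.sg (\prod_(i < k) \prod_(j < k | (i < j)%N)
            ((tnth s j : nat)%:R - (tnth s i : nat)%:R)).

Lemma tsgn_sqr k (s : k.-tuple 'I_n) : uniq s -> tsgn s * tsgn s = 1.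
Proof.
move=> /tuple_uniqP us; rewrite -expr2 sqr_sg; set P := \prod_i _.
suff -> : P != 0 by [].
apply/prodf_neq0 => i _; apply/prodf_neq0 => j ij.
rewrite subr_eq0 eqr_nat; apply: contraTneq ij => /val_inj/us ->.
by rewrite ltnn.
Qed.

Lemma sgr_sign (b : bool) : Num.sg ((-1) ^+ b : R) = (-1) ^+ b.
Proof. by case: b; rewrite ?expr1 ?expr0 ?sgrN sgr1. Qed.

(** The product defining the sign is a Vandermonde determinant. *)
Lemma tsgn_reorder k (s : k.-tuple 'I_n) g :
  tsgn (reorder s g) = (-1) ^+ g * tsgn s.
Proof.
have E (r : k.-tuple 'I_n) :
    tsgn r = Num.sg (\det (Vandermonde k (\row_i (tnth r i : nat)%:R : 'rV[R]_k))).
  rewrite det_Vandermonde; congr Num.sg; apply: eq_bigr => i _.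
  by apply: eq_bigr => j _; rewrite !mxE.
rewrite !E (_ : Vandermonde _ _ = col_perm g (Vandermonde k (\row_i (tnth s i : nat)%:R))).
  by rewrite col_permE det_mulmx det_perm odd_permV mulrC sgrM sgr_sign.
by apply/matrixP => i j; rewrite !mxE tnth_mktuple.
Qed.

Lemma tsgn_cons k x (s : k.-tuple 'I_n) : x \notin s ->
  tsgn [tuple of x :: s] = (\prod_(j < k) (-1) ^+ (tnth s j < x)%N) * tsgn s.
Proof.
move=> xs; rewrite /tsgn big_ord_recl /= sgrM; congr (_ * _).
  rewrite big_mkcond big_ord_recl /= mul1r (big_morph _ (@sgrM R) (@sgr1 R)).
  apply: eq_bigr => j _; rewrite tnth0 tnthS.
  case: (ltngtP (tnth s j) x) => sx.
  - by rewrite ltr0_sg ?expr1 // subr_lt0 ltr_nat.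
  - by rewrite gtr0_sg ?expr0 // subr_gt0 ltr_nat.
  - by move/val_inj: sx xs => <-; rewrite mem_tnth.
congr Num.sg; apply: eq_bigr => i _; rewrite big_mkcond big_ord_recl /= mul1r.
by rewrite [RHS]big_mkcond; apply: eq_bigr => j _; rewrite !tnthS.
Qed.

Lemma vertex_set_del k (s : k.+1.-tuple 'I_n) i : uniq s ->
  vertex_set (del s i) = vertex_set s :\ tnth s i.
Proof.
move=> /tuple_uniqP us; apply/setP => x; rewrite !inE; apply/tnthP/andP.
  case=> j ->; rewrite tnth_mktuple mem_tnth; split=> //.
  by apply/eqP => /us /eqP; rewrite eq_sym (negbTE (neq_lift _ _)).
case=> xi /tnthP[j xj]; rewrite xj in xi *.
case: (unliftP i j) xi => [l ->|->]; last by rewrite eqxx.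
by exists l; rewrite tnth_mktuple.
Qed.

Lemma del_uniq k (s : k.+1.-tuple 'I_n) i : uniq s -> uniq (del s i).
Proof.
move=> /tuple_uniqP us; apply/tuple_uniqP => a b.
by rewrite !tnth_mktuple => /us /lift_inj.
Qed.

(** Moving the i-th vertex to the front takes i transpositions. *)
Lemma tsgn_del k (s : k.+1.-tuple 'I_n) (i : 'I_k.+1) : uniq s ->
  tsgn s = (-1) ^+ i * (eps R (vertex_set s) (tnth s i) * tsgn (del s i)).
Proof.
move=> us.
have {1}-> : s = reorder [tuple of tnth s i :: del s i] (lift_perm i ord0 1).
  apply: eq_from_tnth => j; rewrite tnth_mktuple; case: (unliftP i j) => [l ->|->].
    by rewrite lift_perm_lift perm1 tnthS tnth_mktuple.
  by rewrite lift_perm_id tnth0.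
rewrite tsgn_reorder odd_lift_perm odd_perm1 /= !addbF signr_odd tsgn_cons; last first.
  have := vertex_set_del i us => /setP/(_ (tnth s i)); rewrite !inE eqxx /= => ->.
  by [].
congr (_ * (_ * _)); rewrite /eps.
rewrite (eq_bigl (fun y => y \in s)); last by move=> y; rewrite inE.
rewrite -big_uniq //= big_tuple (bigD1_ord i) //= ltnn mul1r.
by apply: eq_bigr => j _; rewrite tnth_mktuple.
Qed.

End TupleSign.

Section OrientationSign.
Variables (R : realType) (n : nat).
Local Notation tsgn := (@tsgn R n _).

Lemma orient_refl k (s : k.-tuple 'I_n) : s \in orient s.
Proof.
apply/imsetP; exists 1%g; first by rewrite inE odd_perm1.
by apply: eq_from_tnth => i; rewrite tnth_mktuple perm1.
Qed.

Definition orient_sign k (c : {set k.-tuple 'I_n}) : R :=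
  if [pick s in c] is Some s then tsgn s else 0.

Definition orient_support k (c : {set k.-tuple 'I_n}) : {set 'I_n} :=
  if [pick s in c] is Some s then vertex_set s else finset.set0.

Lemma orient_signE k (s : k.-tuple 'I_n) : orient_sign (orient s) = tsgn s.
Proof.
rewrite /orient_sign; case: pickP => [_ /imsetP[g + ->]|/(_ s)]; last by rewrite orient_refl.
by rewrite inE tsgn_reorder => /negbTE ->; rewrite expr0 mul1r.
Qed.

Lemma orient_supportE k (s : k.-tuple 'I_n) : orient_support (orient s) = vertex_set s.
Proof.
rewrite /orient_support; case: pickP => [_ /imsetP[g _ ->]|/(_ s)]; last by rewrite orient_refl.
exact: vertex_set_reorder.
Qed.

Lemma odd_perm_exists k : (1 < k)%N -> exists g : 'S_k, odd_perm g.
Proof. by case: k => [|[|k]] // _; exists (tperm ord0 ord_max); rewrite odd_tperm. Qed.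

Lemma orient_opp_tuple k (s : k.-tuple 'I_n) : (1 < k)%N -> uniq s ->
  exists s' : k.-tuple 'I_n, [/\ uniq s', vertex_set s' = vertex_set s, tsgn s' = - tsgn s
    & orient_opp (orient s) = orient s'].
Proof.
move=> /odd_perm_exists[g g_odd] us; exists (reorder s g); split.
- exact: reorder_uniq.
- exact: vertex_set_reorder.
- by rewrite tsgn_reorder g_odd expr1 mulN1r.
- exact: orient_oppE.
Qed.

(** Two orderings of the same vertices differ by a permutation, whose parity is the
    quotient of the two signs. *)
Lemma orient_eq k (s s' : k.-tuple 'I_n) : uniq s -> uniq s' ->
  vertex_set s = vertex_set s' -> tsgn s = tsgn s' -> orient s = orient s'.
Proof.
move=> us us' E Et.
have /tuple_permP[g /val_inj sE] : perm_eq s s'.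
  by apply: uniq_perm => // x; have := congr1 (fun q : {set 'I_n} => x \in q) E; rewrite /= !inE.
have {}sE : s = reorder s' g by [].
have g_even : ~~ odd_perm g.
  apply/negP => g_odd; move: Et (tsgn_sqr R us'); rewrite sE tsgn_reorder g_odd expr1 mulN1r.
  by move=> /eqP; rewrite eq_sym -addr_eq0 -mulr2n mulrn_eq0 /= => /eqP ->;
    rewrite mul0r => /eqP; rewrite eq_sym oner_eq0.
rewrite sE; apply/setP => t; apply/imsetP/imsetP => -[h]; rewrite inE => h_even ->.
  exists (h * g)%g; last by rewrite reorderM.
  by rewrite inE odd_permM (negbTE g_even) addbF.
exists (h * g^-1)%g; last by rewrite reorderM mulgKV.
by rewrite inE odd_permM odd_permV (negbTE g_even) addbF.
Qed.

Definition signed_face k (s : k.+1.-tuple 'I_n) (i : 'I_k.+1) : {set k.-tuple 'I_n} :=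
  if odd i then orient_opp (orient (del s i)) else orient (del s i).

(** Every induced orientation is the orientation of some ordering, also when it
    is defined as an opposite one. *)
Lemma signed_face_tuple k (s : k.+1.-tuple 'I_n) i : (1 < k)%N -> uniq s ->
  exists s' : k.-tuple 'I_n, [/\ uniq s', vertex_set s' = vertex_set s :\ tnth s i,
    tsgn s' = tsgn s * eps R (vertex_set s) (tnth s i) & signed_face s i = orient s'].
Proof.
move=> k1 us; have ud := del_uniq i us.
have E : tsgn s * eps R (vertex_set s) (tnth s i) = (-1) ^+ i * tsgn (del s i).
  rewrite (tsgn_del R i us); have := eps_sqr R (vertex_set s) (tnth s i); rewrite expr2.
  move: (eps _ _ _) ((-1) ^+ _) (tsgn _) => e a b ee.
  rewrite [LHS](_ : _ = (e * e) * (a * b)); first by rewrite ee mul1r.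
  by ring.
rewrite /signed_face E -signr_odd -(vertex_set_del i us); case: (odd i).
  by have [s' [? ? ? ?]] := orient_opp_tuple k1 ud; exists s'; rewrite expr1 mulN1r.
by exists (del s i); rewrite expr0 mul1r.
Qed.

(** By tsgn_del the face that omits the i-th vertex, with the sign (-1)^i, differs
    from the cell by the incidence coefficient only. *)
Lemma oriented_boundaryE k (s : k.+1.-tuple 'I_n) (s1 : k.-tuple 'I_n) :
  (1 < k)%N -> uniq s -> uniq s1 ->
  (orient s1 \in oriented_boundary (orient s)) =
  (vertex_set s1 \subset vertex_set s) && (tsgn s1 == tsgn s * bcoef R (vertex_set s) (vertex_set s1)).
Proof.
move=> k1 us us1; apply/imset2P/andP.
  case=> s' i /imsetP[g + ->] _; rewrite inE => g_even E.
  have us' := reorder_uniq g us.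
  have [s2 [us2 sup2 sgn2 E2]] := signed_face_tuple i k1 us'.
  have {}E : orient s1 = orient s2 by rewrite E -E2.
  have sup : vertex_set s1 = vertex_set s2 by rewrite -!orient_supportE E.
  have sgn : tsgn s1 = tsgn s2 by rewrite -!orient_signE E.
  have xs : tnth (reorder s g) i \in vertex_set s.
    by rewrite -(vertex_set_reorder s g) inE mem_tnth.
  rewrite sup sgn sup2 sgn2 vertex_set_reorder subD1set bcoefE // tsgn_reorder (negbTE g_even).
  by rewrite expr0 mul1r.
case=> sub /eqP sgn.
have [|x + xE] := face_vertex sub; first by rewrite !card_vertex_set.
rewrite inE => /tnthP[i xi].
have [s2 [us2 sup2 sgn2 E2]] := signed_face_tuple i k1 us.
exists s i; rewrite ?orient_refl //; apply: etrans (esym E2); apply: orient_eq => //.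
  by rewrite xE sup2 xi.
rewrite sgn sgn2 xE xi bcoefE //; by rewrite inE mem_tnth.
Qed.

End OrientationSign.

(** * The adjacency operator as a matrix *)

Section DimensionCount.
Variables (R : realType) (N : nat) (vT : vectType R) (phi : {linear 'rV[R]_N -> vT}).
Hypothesis phi_inj : forall x, phi x = 0 -> x = 0.

Lemma dim_image m (E : 'M[R]_(m, N)) (U : {vspace vT}) :
  (forall f, f \in U <-> exists2 x, (x <= E)%MS & f = phi x) -> \dim U = \rank E.
Proof.
move=> UE; pose X := [tuple phi (row i (row_base E)) | i < \rank E].
have XE (i : 'I_(\rank E)) : X`_i = phi (row i (row_base E)).
  by rewrite -(tnth_nth 0) tnth_mktuple.
have sumE (k : 'I_(\rank E) -> R) :
    \sum_i k i *: X`_i = phi ((\row_i k i) *m row_base E).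
  rewrite mulmx_sum_row raddf_sum; apply: eq_bigr => i _.
  by rewrite XE mxE -linearZ.
have Xfree : free X.
  apply/freeP => k; rewrite sumE => /phi_inj /eqP.
  rewrite mulmx_free_eq0 ?row_base_free // => /eqP/rowP k0 i.
  by have := k0 i; rewrite !mxE.
have -> : U = <<X>>%VS.
  apply/vspaceP => f; apply/idP/idP => [/UE[x + ->]|].
    rewrite -(eq_row_base E) => /submxP[u ->].
    rewrite (_ : u = \row_i u 0 i) -?sumE; last by apply/rowP => i; rewrite mxE.
    apply: memv_suml => i _; apply: memvZ; apply: memv_span.
    by rewrite mem_nth // size_tuple.
  move=> /coord_span ->; rewrite sumE; apply/UE; eexists; last by [].
  by rewrite -(eq_row_base E) submxMl.
by rewrite (eqP Xfree) size_tuple.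
Qed.

End DimensionCount.

Section AdjacencyMatrix.
Variables (R : realType) (n d : nat) (X : {set {set 'I_n}}).
Hypothesis d_gt1 : (1 < d)%N.
Hypothesis skeleton : forall s : {set 'I_n}, #|s| = d -> s \in X.
Local Notation N := #|{: cells n d}|.
Local Notation J := (cells n d.+1).
Local Notation A := (@simplex_mx R n d).
Local Notation oc := (ocell X d).

Definition osign (c : oc) : R := orient_sign R (val c).

Lemma ocell_tuple k (c : ocell X k) :
  exists s : k.-tuple 'I_n, [/\ uniq s, vertex_set s \in X & val c = orient s].
Proof. by case: c => c /= /imsetP[s]; rewrite inE => /andP[us sX] ->; exists s. Qed.

Fact card_orient_vertices (c : oc) : #|orient_support (val c)| == d.
Proof.
by have [s [us _ ->]] := ocell_tuple c; rewrite orient_supportE card_vertex_set.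
Qed.

Definition oindex (c : oc) : 'I_N :=
  enum_rank (exist (fun s : {set 'I_n} => #|s| == d) _ (card_orient_vertices c) : cells n d).

Lemma facet_oindex c : facet (oindex c) = orient_support (val c).
Proof. by rewrite /facet enum_rankK. Qed.

Lemma osign_sqr c : osign c * osign c = 1.
Proof.
by rewrite /osign; have [s [us _ ->]] := ocell_tuple c; rewrite orient_signE tsgn_sqr.
Qed.

Lemma osign_cases c : osign c = 1 \/ osign c = -1.
Proof.
have := osign_sqr c; move/eqP; rewrite -expr2 sqrf_eq1 => /orP[]/eqP; [left|right]; done.
Qed.

Lemma ocell_eq c c' : oindex c = oindex c' -> osign c = osign c' -> c = c'.
Proof.
move=> Ei Es; apply: val_inj; move: (congr1 (@facet n d) Ei) Es; rewrite !facet_oindex /osign.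
have [s [us _ ->]] := ocell_tuple c; have [s' [us' _ ->]] := ocell_tuple c'.
rewrite !orient_supportE !orient_signE; exact: orient_eq.
Qed.

Lemma ocell_opp_index c : oindex (ocell_opp c) = oindex c.
Proof.
apply: facet_inj; rewrite !facet_oindex val_ocell_opp //.
have [s [us _ ->]] := ocell_tuple c.
have [s' [us' E _ ->]] := orient_opp_tuple R d_gt1 us.
by rewrite !orient_supportE.
Qed.

Lemma ocell_opp_sign c : osign (ocell_opp c) = - osign c.
Proof.
rewrite /osign val_ocell_opp //; have [s [us _ ->]] := ocell_tuple c.
have [s' [us' _ E ->]] := orient_opp_tuple R d_gt1 us.
by rewrite !orient_signE.
Qed.

Lemma ocell_of_tuple k (s : k.-tuple 'I_n) : uniq s -> vertex_set s \in X ->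
  exists c : ocell X k, val c = orient s.
Proof.
move=> us sX; have H : orient s \in oriented_cells X k.
  by apply/imsetP; exists s; rewrite // inE us.
by exists (exist (fun c : {set k.-tuple 'I_n} => c \in oriented_cells X k) _ H).
Qed.

Lemma tuple_of_set (k : nat) (s : {set 'I_n}) : #|s| = k ->
  exists r : k.-tuple 'I_n, uniq r /\ vertex_set r = s.
Proof.
move=> <-; exists (enum_tuple (mem s)); split; first exact: enum_uniq.
by apply/setP => x; rewrite inE mem_enum.
Qed.

Lemma ocell_exists (i : 'I_N) (e : R) : e * e = 1 ->
  exists c : oc, oindex c = i /\ osign c = e.
Proof.
move=> ee; have [s [us sE]] := tuple_of_set (card_facet i).
have sX : vertex_set s \in X by apply: skeleton; rewrite sE card_facet.
have [c cE] := ocell_of_tuple us sX.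
have ci : oindex c = i by apply: facet_inj; rewrite facet_oindex cE orient_supportE.
have [ce|ce] := eqVneq (osign c) e; first by exists c.
exists (ocell_opp c); rewrite ocell_opp_index ocell_opp_sign; split=> //.
move: ce; move/eqP: ee; rewrite -expr2 sqrf_eq1.
by case: (osign_cases c) => -> /orP[]/eqP -> //; rewrite ?eqxx ?opprK.
Qed.

(** The adjacency of oriented cells in terms of signs: the second cell carries
    the orientation opposite to the one induced by the common coface. *)
Lemma ocell_adjE (c c' : oc) : ocell_adj c c' =
  [exists t : J, [&& val t \in X, oindex c \in facets_of t, oindex c' \in facets_of t,
     oindex c != oindex c' & osign c' == osign c * A t (oindex c) (oindex c')]].
Proof.
have mem_boundary (s : d.+1.-tuple 'I_n) (us : uniq s) (t : J) (b : oc) : vertex_set s = val t ->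
    (val b \in oriented_boundary (orient s)) =
    (oindex b \in facets_of t) && (osign b == tsgn R s * incidence R t (oindex b)).
  move=> st; rewrite /incidence /osign inE facet_oindex.
  have [r [ur _ ->]] := ocell_tuple b.
  by rewrite orient_supportE orient_signE (oriented_boundaryE R d_gt1 us ur) st.
have AE t i j : i != j -> A t i j = - (incidence R t i * incidence R t j).
  by move=> ij; rewrite mxE ij mul1r.
apply/existsP/existsP => -[t].
  have [s [us sX ->]] := ocell_tuple t.
  have sd : #|vertex_set s| == d.+1 by rewrite card_vertex_set.
  pose t' : J := exist (fun s : {set 'I_n} => #|s| == d.+1) _ sd.
  rewrite !(mem_boundary s us t') // ocell_opp_index ocell_opp_sign.
  move=> /and3P[/andP[ct /eqP cs] /andP[ct' /eqP cs'] cc'].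
  have ij : oindex c != oindex c'.
    apply: contra cc' => /eqP E; apply/eqP/ocell_eq; first by rewrite ocell_opp_index.
    by rewrite ocell_opp_sign cs cs' E.
  exists t'; rewrite sX ct ct' ij /= AE // cs mulrN mulrA -(mulrA (tsgn R s)).
  by rewrite incidence_sqr // mulr1 -cs' opprK.
case/and5P=> tX ct ct' ij; rewrite AE // => /eqP cs.
have [s [us st]] := tuple_of_set (card_cell t).
pose e := osign c * incidence R t (oindex c).
have [s' [us' st' se]] : exists s' : d.+1.-tuple 'I_n,
    [/\ uniq s', vertex_set s' = val t & tsgn R s' = e].
  have ee : e * e = 1 by rewrite /e mulrACA osign_sqr incidence_sqr // mulr1.
  have [se|se] := eqVneq (tsgn R s) e; first by exists s.
  have [g g_odd] := odd_perm_exists (ltnW d_gt1 : (1 < d.+1)%N).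
  exists (reorder s g); split; rewrite ?vertex_set_reorder ?reorder_uniq //.
  rewrite tsgn_reorder g_odd expr1 mulN1r; move: se.
  move/eqP: (tsgn_sqr R us); move/eqP: ee; rewrite -!expr2 !sqrf_eq1.
  by case/orP=> /eqP -> /orP[]/eqP -> //; rewrite ?eqxx ?opprK.
have s'X : vertex_set s' \in X by rewrite st'.
have [t' t'E] := ocell_of_tuple us' s'X; exists t'.
rewrite t'E !(mem_boundary s' us' t) // ocell_opp_index ocell_opp_sign ct ct' /= se /e.
rewrite -mulrA incidence_sqr // mulr1 eqxx /= cs mulrN opprK mulrA eqxx /=.
by apply: contra ij => /eqP ->; rewrite ocell_opp_index.
Qed.

Local Notation cochain := {ffun oc -> R}.

(** A form is determined by its values on the increasing orientations. *)
Definition cochain_of (x : 'rV[R]_N) : cochain := [ffun c => osign c * x 0 (oindex c)].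

Fact cochain_of_is_linear : linear cochain_of.
Proof.
move=> a x y; apply/ffunP => c; rewrite !ffunE !mxE mulrDr; congr (_ + _).
by rewrite mulrCA.
Qed.
HB.instance Definition _ :=
  GRing.isLinear.Build R 'rV[R]_N cochain _ cochain_of cochain_of_is_linear.

Lemma cochain_of_inj x : cochain_of x = 0 -> x = 0.
Proof.
move=> /ffunP x0; apply/rowP => i; have [c [<- c1]] := ocell_exists i (mulr1 1).
by have := x0 c; rewrite !ffunE c1 mul1r mxE.
Qed.

Lemma forms_cochain_of f : f \in forms R X d <-> exists x, f = cochain_of x.
Proof.
split=> [/formsP fE|[x ->]]; last first.
  apply/formsP => c; rewrite !ffunE ocell_opp_sign ocell_opp_index.
  by rewrite mulNr.
have pos i := ocell_exists i (mulr1 1).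
pose b i := projT1 (cid (pos i)).
have bP i : oindex (b i) = i /\ osign (b i) = 1 := projT2 (cid (pos i)).
exists (\row_i f (b i)); apply/ffunP => c; rewrite ffunE mxE.
have [bi b1] := bP (oindex c).
have [c1|c1] := osign_cases c.
  by rewrite c1 mul1r; congr (f _); apply: ocell_eq; rewrite ?bi ?c1 ?b1.
rewrite c1 mulN1r -fE; congr (f _).
by apply: ocell_eq; rewrite ?ocell_opp_index ?ocell_opp_sign ?bi ?c1 ?b1.
Qed.

Definition adjacency_mx : 'M[R]_N := \sum_(t : J) (val t \in X)%:R *: A t.

Lemma adjacency_mxE i j (t : J) : i \in facets_of t -> j \in facets_of t -> i != j ->
  adjacency_mx i j = (val t \in X)%:R * A t i j.
Proof.
move=> it jt ij; rewrite summxE (bigD1 t) //= big1 ?addr0 ?mxE // => t' t't.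
rewrite mxE; suff -> : A t' i j = 0 by rewrite mulr0.
apply/eqP; apply: contraNT t't => /(block_supp (simplex_block_system R n d))[it' jt' _].
by apply/eqP; apply: (block_pair (simplex_block_system R n d) ij).
Qed.

Lemma adjacency_cochain_of x :
  adjacency R X d (cochain_of x) = cochain_of (x *m adjacency_mx).
Proof.
apply/ffunP => c; rewrite lfunE !ffunE /=; set i := oindex c.
rewrite (partition_big oindex predT) //= mxE mulr_sumr; apply: eq_bigr => j _.
have HB := simplex_block_system R n d.
have Ms : adjacency_mx j i = adjacency_mx i j.
  by rewrite !summxE; apply: eq_bigr => t _; rewrite !mxE eq_sym [incidence R t j * _]mulrC.
have [/existsP[t /and4P[tX it jt ij]]|no] :=
  boolP [exists t : J, [&& val t \in X, i \in facets_of t, j \in facets_of t & i != j]].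
  rewrite Ms (adjacency_mxE it jt ij) tX mul1r.
  have AA : A t i j * A t i j = 1 by rewrite -expr2 simplex_unit.
  have ee : (osign c * A t i j) * (osign c * A t i j) = 1.
    by rewrite mulrACA AA osign_sqr mulr1.
  have [c' [c'j c's]] := ocell_exists j ee.
  rewrite (big_pred1 c') => [|b] /=.
    by rewrite ffunE c'j c's -mulrA [x 0 j * _]mulrC.
  apply/andP/eqP => [[+ /eqP bj]|->]; last first.
    by rewrite ocell_adjE c'j c's eqxx; split=> //; apply/existsP; exists t; rewrite tX it jt ij eqxx.
  rewrite ocell_adjE => /existsP[t' /and5P[t'X it' jt' _ /eqP bs]].
  apply: ocell_eq; rewrite ?c'j ?c's // bs bj; congr (_ * A _ _ _).
  by rewrite bj in jt'; apply: (block_pair HB ij).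
rewrite big_pred0 => [|b]; last first.
  apply/negP => /andP[+ /eqP bj]; rewrite ocell_adjE bj => /existsP[t /and5P[tX it jt ij _]].
  by case/negP: no; apply/existsP; exists t; rewrite tX it jt ij.
rewrite [adjacency_mx j i]summxE big1 ?mulr0 // => t _; rewrite mxE.
have [tX|] := boolP (val t \in X); last by rewrite mul0r.
rewrite mul1r; apply/eqP; apply: contraNT no => /(block_supp HB)[jt it ji].
by apply/existsP; exists t; rewrite tX it jt eq_sym ji.
Qed.

(** The map cochain_of is an isomorphism onto the forms that conjugates the matrix
    to the adjacency operator, hence it preserves the dimensions of eigenspaces. *)
Lemma sorted_spectrum_mx (s : seq R) :
  sorted (fun x y : R => x <= y) s -> size s = N ->
  (forall a, count_mem a s = \rank (eigenspace adjacency_mx a)) ->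
  sorted_spectrum (adjacency R X d) (forms R X d) s.
Proof.
move=> s1 s2 s3; split=> // [|a].
  rewrite s2 -[LHS](mxrank1 R); symmetry.
  apply: (@dim_image _ _ _ cochain_of cochain_of_inj) => f; rewrite forms_cochain_of.
  by split=> -[x]; [exists x; rewrite ?submx1 | exists x].
rewrite s3; symmetry; apply: (@dim_image _ _ _ cochain_of cochain_of_inj) => f.
have eigE x : cochain_of x \in passmx.leigenspace (adjacency R X d) a <->
    (x <= eigenspace adjacency_mx a)%MS.
  rewrite memv_ker add_lfunE opp_lfunE scale_lfunE id_lfunE adjacency_cochain_of -linearZ -linearB /=.
  split=> [/eqP/cochain_of_inj/eqP|/eigenspaceP ->]; last by rewrite subrr linear0.
  by rewrite subr_eq0 => /eqP E; apply/eigenspaceP.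
rewrite memv_cap; split=> [/andP[/forms_cochain_of[x ->] /eigE xE]|[x /eigE xE ->]].
  by exists x.
by rewrite xE andbT; apply/forms_cochain_of; exists x.
Qed.

End AdjacencyMatrix.
(** * Almost sure statements *)

Local Open Scope classical_set_scope.

Section BorelCantelli.
Variables (disp : measure_display) (Om : measurableType disp) (R : realType).
Variable P : probability Om R.

Lemma eventually_avoids (E : nat -> set Om) (n0 : nat) :
  (forall n, measurable (E n)) ->
  (forall n, (n0 <= n)%N -> (P (E n) <= ((n%:R ^+ 2)^-1)%:E)%E) ->
  {ae P, forall w, \forall n \near \oo, ~ E n w}.
Proof.
move=> mE PE; pose E' n := if (n0 < n)%N then E n else set0.
have mE' n : measurable (E' n) by rewrite /E'; case: ifP.
have sumE' n : (\sum_(0 <= k < n) P (E' k) <= (6 - 6 / n.+1%:R)%:E)%E.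
  elim: n => [|n IH]; first by rewrite big_geq // divr1 subrr.
  rewrite big_nat_recr //=.
  apply: (@le_trans _ _ ((6 - 6 / n.+1%:R)%:E + (6 / n.+1%:R - 6 / n.+2%:R)%:E)%E); last first.
    by rewrite -EFinD lee_fin addrA subrK.
  apply: leeD => //; rewrite /E'; case: ltnP => [n0n|_]; last first.
    rewrite measure0 lee_fin subr_ge0 ler_pM2l // lef_pV2 ?posrE ?ltr0n //.
    by rewrite ler_nat.
  (* 1 / n^2 is at most 6 / (n + 1) - 6 / (n + 2), which telescopes. *)
  apply: le_trans (PE n (ltnW n0n)) _; rewrite lee_fin.
  have n1 : 1 <= n%:R :> R by rewrite ler1n; apply: leq_ltn_trans n0n.
  rewrite -!(natr1) -!addrA; set x := n%:R in n1 *.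
  rewrite -subr_ge0 [X in 0 <= X](_ : _ = (5 * x ^+ 2 - 3 * x - 2) / (x ^+ 2 * (x + 1) * (x + (1 + 1)))).
    have : 0 <= (x - 1) * (5 * x + 2) by apply: mulr_ge0; lra.
    move=> num; apply: divr_ge0; first by lra.
    by rewrite !mulr_ge0 ?sqr_ge0 //; lra.
  by field; apply/and3P; split; apply: lt0r_neq0; lra.
have lim0 : P (lim_sup_set E') = 0.
  apply: lim_sup_set_cvg0 => //; apply: (@le_lt_trans _ _ (6%:E)); last by rewrite ltry.
  apply: lime_le; first by apply: is_cvg_nneseries => *; exact: measure_ge0.
  apply: nearW => n; apply: le_trans (sumE' n) _; rewrite lee_fin.
  by rewrite gerBl divr_ge0.
suff : P.-negligible (~` [set w | \forall n \near \oo, ~ E n w]) by [].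
apply: (@negligibleS _ _ _ _ (lim_sup_set E')); last first.
  apply/negligibleP => //; apply: bigcap_measurable => // k _.
  exact: bigcup_measurable.
move=> w /= notev n _ /=; apply: contrapT => nE; apply: notev.
exists (maxn n n0.+1) => // k /= nk Ek; apply: nE; exists k.
  by rewrite /=; apply: leq_trans nk; rewrite leq_maxl.
by rewrite /E' ifT //; apply: leq_trans nk; rewrite leq_maxr.
Qed.

End BorelCantelli.

Section IndicatorLaw.
Variables (disp : measure_display) (Om : measurableType disp) (R : realType).
Variables (P : probability Om R) (d n : nat) (U : {fset nat} -> {RV P >-> R}).
Hypothesis U_unif : forall (tau : {fset nat}) (B : set R),
  (#|` tau| = d.+1)%N -> 0%N \notin tau -> measurable B ->
  P (U tau @^-1` B) = uniform_prob (@ltr01 R) B.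
Hypothesis U_indep : mutually_independent (J := {fset nat})
  [set tau | (#|` tau| = d.+1)%N /\ 0%N \notin tau] U.
Variable p : R.
Hypothesis p01 : 0 <= p <= 1.
Local Notation J := (cells n d.+1).

Definition present (w : Om) : {ffun J -> bool} :=
  [ffun t => U (vertex_labels (val t)) w <= p].

Lemma vertex_labels_inj : injective (@vertex_labels n).
Proof.
move=> s t /fsetP E; apply/setP => x; have := E x.+1.
have mem (q : {set 'I_n}) : (x.+1 \in vertex_labels q) = (x \in q).
  apply/imfsetP/idP => [[y /= yq [/val_inj ->]]|xq]; first exact: yq.
  by exists x.
by rewrite !mem.
Qed.

Lemma card_vertex_labels (t : J) : #|` vertex_labels (val t)| = d.+1.
Proof.
rewrite card_imfset /=; last by move=> x y [/val_inj].
by rewrite -cardE; exact: card_cell.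
Qed.

Lemma vertex_labels0 (t : J) : 0%N \notin vertex_labels (val t).
Proof. by apply/imfsetP => -[]. Qed.

Lemma uniform_prob_le : uniform_prob (@ltr01 R) [set x | x <= p] = p%:E.
Proof.
have /andP[p0 p1] := p01.
rewrite /uniform_prob integral_uniform_pdf.
have -> : [set x | x <= p] `&` `[0, 1]%classic = `[0, p]%classic.
  apply/seteqP; split=> x /=; rewrite !in_itv /=.
    by move=> [xp /andP[x0 x1]]; rewrite x0 xp.
  by move=> /andP[x0 xp]; rewrite x0 xp (le_trans xp p1).
rewrite (eq_integral (cst 1%E)) => [|x]; last first.
  rewrite inE /= in_itv /= => /andP[x0 xp].
  by rewrite /uniform_pdf x0 (le_trans xp p1) /= subr0 invr1.
rewrite integral_cst //= mul1e lebesgue_measure_itv /= lte_fin.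
by case: ltgtP p0 => //= [|<-]; rewrite ?oppr0 ?adde0.
Qed.

Lemma measurable_U tau (B : set R) : measurable B -> measurable (U tau @^-1` B).
Proof. by move=> mB; exact: measurable_funPTI. Qed.

Lemma present_coordinate (t : J) (b : bool) :
  P (U (vertex_labels (val t)) @^-1` [set x | (x <= p) = b]) = (bern p b)%:E.
Proof.
have mle : measurable [set x : R | x <= p].
  have -> : [set x : R | x <= p] = `]-oo, p]%classic by apply/seteqP; split=> x; rewrite /= in_itv.
  exact: measurable_itv.
have H := U_unif (card_vertex_labels t) (vertex_labels0 t) mle.
case: b.
  have -> : [set x : R | (x <= p) = true] = [set x | x <= p] by [].
  by rewrite H uniform_prob_le.
have -> : [set x : R | (x <= p) = false] = ~` [set x | x <= p].
  by apply/seteqP; split=> x /=; [move=> -> | move=> /negP/negbTE].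
by rewrite preimage_setC (probability_setC _ (measurable_U _ mle)) H uniform_prob_le.
Qed.

(** Independence is applied to the labels of all cells on n vertices; B extends a
    prescribed configuration to a family indexed by all label sets. *)
Lemma present_law (b : {ffun J -> bool}) :
  measurable [set w | present w = b] /\
  P [set w | present w = b] = (\prod_t bern p (b t))%:E.
Proof.
pose F : {fset {fset nat}} := [fset vertex_labels (val t) | t in [set: J]%SET]%fset.
pose B (tau : {fset nat}) : set R :=
  [set x | (x <= p) = [exists t : J, (vertex_labels (val t) == tau) && b t]].
have BE (t : J) : B (vertex_labels (val t)) = [set x | (x <= p) = b t].
  rewrite /B.
  suff -> : [exists s : J, (vertex_labels (val s) == vertex_labels (val t)) && b s] = b t by [].
  apply/existsP/idP => [[s /andP[/eqP]]|bt]; last by exists t; rewrite eqxx.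
  by move=> /vertex_labels_inj /val_inj ->.
have mB tau : measurable (B tau).
  rewrite /B; case: [exists _, _].
    have -> : [set x : R | (x <= p) = true] = `]-oo, p]%classic.
      by apply/seteqP; split=> x; rewrite /= in_itv.
    exact: measurable_itv.
  have -> : [set x : R | (x <= p) = false] = `]p, +oo[%classic.
    by apply/seteqP; split=> x; rewrite /= in_itv /= andbT ltNge; [move=> -> | move/negbTE].
  exact: measurable_itv.
have setE : [set w | present w = b] = \bigcap_(j in [set` F]) (U j @^-1` B j).
  apply/seteqP; split=> w /=.
    move=> wb tau /= /imfsetP[t /= _ ->]; rewrite BE /=.
    by have /ffunP/(_ t) := wb; rewrite ffunE.
  move=> wB; apply/ffunP => t; rewrite ffunE.
  have : (U (vertex_labels (val t)) @^-1` B (vertex_labels (val t))) w.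
    by apply: wB; apply/imfsetP; exists t; rewrite //= inE.
  by rewrite BE.
have mU j : measurable (U j @^-1` B j) by exact: measurable_U.
split.
  by rewrite setE; apply: fin_bigcap_measurable => // j _.
rewrite setE U_indep //; last first.
  by move=> tau /= /imfsetP[t /= _ ->]; rewrite card_vertex_labels vertex_labels0.
rewrite big_imfset /=; last by move=> s t _ _ /vertex_labels_inj /val_inj.
rewrite big_enum /= -prodEFin; apply: eq_big => [t|t _]; first by rewrite finset.in_setT.
by rewrite -(present_coordinate t) -BE.
Qed.

Lemma present_event (Q : pred {ffun J -> bool}) :
  measurable [set w | Q (present w)] /\
  P [set w | Q (present w)] = (\sum_(b | Q b) \prod_t bern p (b t))%:E.
Proof.
have -> : [set w | Q (present w)] =
    \bigcup_(b in [set` [fset b | b in Q]%fset]) [set w | present w = b].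
  apply/seteqP; split=> w /=.
    by move=> Qw; exists (present w) => //=; apply/imfsetP; exists (present w).
  by case=> b /= /imfsetP[b' /= Qb ->] ->.
have tE : trivIset [set` [fset b | b in Q]%fset] (fun b => [set w | present w = b]).
  by move=> b b' _ _ [w [/= <- <-]].
split; first by apply: fin_bigcup_measurable => // b _; case: (present_law b).
rewrite bigcup_fset measure_fbigsetU // => [|b _]; last by case: (present_law b).
rewrite big_imfset //= big_enum -sumEFin; apply: eq_bigr => b _.
by case: (present_law b).
Qed.

End IndicatorLaw.

(** * Asymptotics *)

Section Asymptotics.
Variable R : realType.
Implicit Types (e : R).

Local Ltac pos := repeat first [done | apply: addr_gt0 | rewrite invr_gt0 | apply: mulr_gt0
  | apply: exprn_gt0 | by rewrite ltr0n].

Lemma expR_ln_natX (n r : nat) : (0 < n)%N -> expR (r%:R * ln n%:R) = n%:R ^+ r :> R.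
Proof. by move=> n0; rewrite mulrC expRM_natr lnK // posrE ltr0n. Qed.

Lemma card_cells n d : #|{: cells n d}| = 'C(n, d).
Proof. by rewrite card_sig -[n in RHS]card_ord -card_draws cardsE. Qed.

Lemma bin_le_expn n d : ('C(n, d) <= n ^ d)%N.
Proof.
apply: (@leq_trans (n ^_ d)); first by rewrite -bin_ffact leq_pmulr ?fact_gt0.
elim: d n => [|d IH] n; first by rewrite ffactn0.
rewrite ffactnS expnS leq_mul //; apply: leq_trans (IH _) _.
by case: d {IH} => [//|d]; rewrite leq_exp2r ?leq_pred.
Qed.

Lemma combine_exponents (l r x N y : R) : 0 <= x -> x <= expR l -> 0 <= N ->
  N <= expR (r * l) -> 2 <= expR l -> 0 <= y -> y <= expR (- (r + 4) * l) ->
  x * (2 * N * y) <= expR (- (2 * l)).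
Proof.
move=> x0 xl N0 Nl l2 y0 yl.
apply: (@le_trans _ _ (expR l * (expR l * expR (r * l) * expR (- (r + 4) * l)))).
  apply: ler_pM => //; first by rewrite !mulr_ge0.
  apply: ler_pM => //; first by rewrite mulr_ge0.
  by apply: ler_pM.
by rewrite -!expRD ler_expR; lra.
Qed.

(** For moments of order proportional to ln n the bound of bad_weight_le decreases
    faster than n^-d / n^2, while the number of facets is at most n^d. *)
Lemma bad_event_small d e : (0 < d)%N -> 0 < e ->
  exists c1 c2 : R, [/\ 0 < c1, 0 < c2 & forall (n : nat) (p : R),
    (2 * d <= n)%N -> 0 < p < 1 -> 1 <= ln n%:R :> R ->
    c1 * ln n%:R ^+ 4 <= n%:R * (p * (1 - p)) ->
    c2 * ln n%:R ^+ 5 <= Num.sqrt n%:R ->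
    \sum_(w : {ffun cells n d.+1 -> bool} | ~~ `[< qform_le (centered_sum (@simplex_mx R n d) p w)
         ((2 + e) * Num.sqrt (d%:R * n%:R * (p * (1 - p)))) >]) \prod_j bern p (w j)
      <= (n%:R ^+ 2)^-1].
Proof.
move=> d_gt0 e_gt0; pose D : R := d.+1%:R.
pose a := 1 + e / 4; pose rho := a / (1 + e / 2).
have a1 : 1 < a by rewrite /a; lra.
have rho0 : 0 < rho by rewrite divr_gt0 // /a; lra.
have rho1 : rho < 1 by rewrite ltr_pdivrMr /a; lra.
have lrho : ln rho < 0 by rewrite ln_lt0 // rho0.
(* Then rho^(2 C ln n) is at most n^-(d+4); the summand 1 absorbs the rounding. *)
pose C := (d%:R + 4) / (2 * - ln rho) + 1.
have C1 : 1 <= C.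
  by rewrite /C lerDr divr_ge0 // ?addr_ge0 // mulr_ge0 // oppr_ge0 ltW.
(* The order of the moment is at most B ln n. *)
pose B := 4 * C; have B0 : 0 < B by rewrite /B; lra.
have D0 : 0 < D by rewrite ltr0n.
(* The first summand serves the factor expR of bad_weight_le, the second its
   condition on the variance. *)
pose c3 := 8 * D ^+ 6 * B ^+ 3 + 2 * B * D ^+ 3.
have c30 : 0 < c3 by rewrite /c3; pos.
have c3a : 8 * D ^+ 6 * B ^+ 3 <= c3 by rewrite /c3 lerDl ltW //; pos.
have c3b : 2 * B * D ^+ 3 <= c3 by rewrite /c3 lerDr ltW //; pos.
clearbody c3.
(* The Catalan ratio is 1 / (4 a^2), and this is the room left for the errors. *)
pose gap := 1 - (a ^+ 2)^-1.
have gap0 : 0 < gap.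
  by rewrite subr_gt0 invf_lt1 ?exprn_gt0 ?exprn_egt1 //; lra.
pose c2 := (104 * D ^+ 15 * B ^+ 5) / gap + 1 + B.
have c2B : B <= c2 by rewrite /c2 lerDr ltW //; pos.
have c20 : 0 < c2.
  by rewrite /c2; pos.
have gapc : 104 * D ^+ 15 * B ^+ 5 < gap * c2.
  have -> : gap * c2 = 104 * D ^+ 15 * B ^+ 5 + gap * (1 + B).
    by rewrite /c2; field; rewrite gt_eqF.
  by rewrite ltrDl; pos.
clearbody c2.
exists (2 * c3 ^+ 2), c2; split=> // [|n p dn p01 l1 nq sn].
  by pos.
set l := ln n%:R in l1 nq sn; set q := p * (1 - p) in nq *.
have /andP[p0 p1] := p01.
have q0 : 0 < q by rewrite mulr_gt0 ?subr_gt0.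
have n_gt0 : (0 < n)%N by apply: leq_trans dn; rewrite muln_gt0.
have nR0 : 0 < n%:R :> R by rewrite ltr0n.
have l0 : 0 < l by lra.
have dn' : (d < n)%N by move: dn d_gt0; clear; lia.
pose m := (n - d)%N; have m_gt0 : (0 < m)%N by rewrite subn_gt0.
have mR0 : 0 < m%:R :> R by rewrite ltr0n.
have m2 : n%:R <= 2 * m%:R :> R.
  by rewrite -natrM ler_nat /m; move: dn; clear; lia.
have mn : m%:R <= n%:R :> R by rewrite ler_nat leq_subr.
have d1 : 1 <= d%:R :> R by rewrite ler1n.
pose k := (Num.truncn (C * l)).+1.
have kl : C * l <= k%:R by apply: ltW; exact: truncnS_gt.
have ku : k%:R <= 2 * (C * l).
  rewrite /k -natr1; have : (Num.truncn (C * l))%:R <= C * l by rewrite truncn_le // mulr_ge0; lra.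
  have : 1 <= C * l by rewrite -[1]mulr1; apply: ler_pM.
  lra.
pose K : R := k.*2%:R.
have KE : K = 2 * k%:R by rewrite /K -muln2 natrM mulrC.
have KB : K <= B * l by rewrite KE /B; lra.
have K0 : 0 <= K by rewrite ler0n.
pose L := 2 * a * Num.sqrt (m%:R * d%:R).
have L2 : L ^+ 2 = 4 * a ^+ 2 * (m%:R * d%:R).
  by rewrite /L exprMn sqr_sqrtr ?mulr_ge0 //; ring.
have md0 : 0 < m%:R * d%:R :> R by rewrite mulr_gt0 //; lra.
have L0 : 0 < L by rewrite /L; apply: mulr_gt0; [lra | rewrite sqrtr_gt0].
have a2 : 1 <= a ^+ 2 by rewrite exprn_ege1 // ltW.
have mdm : m%:R <= m%:R * d%:R :> R by rewrite ler_peMr // ltW.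
have L2m : 4 * (m%:R * d%:R) <= L ^+ 2.
  by rewrite L2; apply: ler_wpM2r; [exact: ltW | lra].
have mL : m%:R <= L ^+ 2 by lra.
have nL : Num.sqrt n%:R <= L.
  by rewrite -[leRHS](ger0_norm (ltW L0)) -sqrtr_sqr ler_sqrt ?sqr_ge0 //; lra.
have cL : c2 * l ^+ 5 <= L by apply: le_trans nL.
have l15 : l <= l ^+ 5 by rewrite -[leLHS]expr1 ler_weXn2l.
have l5 : 0 < l ^+ 5 by rewrite exprn_gt0.
have KL : k.*2%:R <= L.
  apply: le_trans cL; apply: (le_trans KB); apply: (@le_trans _ _ (B * l ^+ 5)).
    by rewrite ler_pM2l.
  by apply: ler_wpM2r => //; exact: ltW.
have kK : k%:R <= B * l by apply: le_trans KB; rewrite KE; have := ler0n R k; lra.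
have Bl0 : 0 < B * l by apply: mulr_gt0.
have small : 4 * (m%:R * (d.+1.-1)%:R / L ^+ 2) + k%:R * (104 * D ^+ 15 * K ^+ 4 / L) < 1.
  have -> : 4 * (m%:R * (d.+1.-1)%:R / L ^+ 2) = (a ^+ 2)^-1.
    have aN : a != 0 by rewrite gt_eqF // (lt_trans ltr01).
    have mN : m%:R != 0 :> R by rewrite gt_eqF.
    have dN : d%:R != 0 :> R by rewrite pnatr_eq0 -lt0n.
    by rewrite L2 /=; field; rewrite aN mN dN.
  suff : k%:R * (104 * D ^+ 15 * K ^+ 4 / L) < gap by rewrite /gap; lra.
  rewrite mulrA ltr_pdivrMr //.
  have kK5 : k%:R * K ^+ 4 <= B ^+ 5 * l ^+ 5.
    rewrite -exprMn [leRHS]exprS; apply: ler_pM => //; first exact: exprn_ge0.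
    by apply: lerXn2r => //; rewrite nnegrE ltW.
  have x0 : 0 < 104 * D ^+ 15 by pos.
  apply: (@le_lt_trans _ _ ((104 * D ^+ 15) * (B ^+ 5 * l ^+ 5))).
    rewrite [leLHS](_ : _ = 104 * D ^+ 15 * (k%:R * K ^+ 4)); last by ring.
    by rewrite ler_pM2l.
  apply: (@lt_le_trans _ _ (gap * (c2 * l ^+ 5))); last by rewrite ler_pM2l.
  by rewrite mulrA [ltRHS]mulrA ltr_pM2r.
have l0c : c3 * l ^+ 2 <= Num.sqrt (m%:R * q).
  have c0 : 0 <= c3 * l ^+ 2 by apply: ltW; pos.
  rewrite -[leLHS](ger0_norm c0) -sqrtr_sqr ler_sqrt; last by apply: mulr_ge0; exact: ltW.
  rewrite exprMn -exprM.
  suff H : 2 * (c3 ^+ 2 * l ^+ 4) <= 2 * (m%:R * q).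
    by move: H; rewrite ler_pM2l.
  rewrite mulrA; apply: le_trans nq _.
  by rewrite mulrA; apply: ler_wpM2r => //; exact: ltW.
have ll : l <= l ^+ 2 by rewrite -[leLHS]expr1 ler_weXn2l.
have K3 : 2 * K * D ^+ 3 <= Num.sqrt (m%:R * q).
  apply: le_trans l0c; apply: (@le_trans _ _ (2 * B * D ^+ 3 * l ^+ 2)).
    rewrite [leRHS](_ : _ = 2 * (B * l ^+ 2) * D ^+ 3); last by ring.
    apply: ler_wpM2r; first by apply: ltW; pos.
    apply: ler_wpM2l => //; apply: (le_trans KB); by rewrite ler_pM2l.
  apply: ler_wpM2r; first by apply: ltW; pos.
  by [].
pose s := Num.sqrt (d%:R * n%:R * q).
have s0 : 0 < s by rewrite sqrtr_gt0; pos.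
have h0 : 0 < (2 + e) * s by apply: mulr_gt0 => //; lra.
have N_gt0 : (0 < #|{: cells n d}|)%N by rewrite card_cells bin_gt0 ltnW.
apply: le_trans (bad_weight_le (simplex_block_system R n d) (simplex_homogeneous R n d_gt0)
  (ltn0Sn _ : (0 < k)%N) (d_gt0 : (1 < d.+1)%N) N_gt0 m_gt0 p01 h0 mL KL small K3) _.
have expo : expR (8 * D ^+ 6 * K ^+ 3 / Num.sqrt (m%:R * q)) <= expR l.
  rewrite ler_expR ler_pdivrMr; last by rewrite sqrtr_gt0; pos.
  apply: (@le_trans _ _ (l * (c3 * l ^+ 2))); last by rewrite ler_pM2l.
  apply: (@le_trans _ _ (8 * D ^+ 6 * (B * l) ^+ 3)).
    apply: ler_wpM2l; first by apply: ltW; pos.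
    by apply: lerXn2r => //; rewrite nnegrE ltW.
  rewrite [leLHS](_ : _ = l * (8 * D ^+ 6 * B ^+ 3 * l ^+ 2)); last by ring.
  rewrite ler_pM2l //; apply: ler_wpM2r; first by apply: ltW; pos.
  by [].
have ratio : Num.sqrt q * L / ((2 + e) * s) <= rho.
  rewrite ler_pdivrMr // [leRHS](_ : _ = 2 * a * s); last first.
    by rewrite /rho; field; apply: lt0r_neq0; lra.
  rewrite /L mulrCA; apply: ler_wpM2l; first by lra.
  rewrite -(sqrtrM _ (ltW q0)) ler_sqrt; last by apply: ltW; pos.
  rewrite mulrC [leRHS](_ : _ = n%:R * d%:R * q); last by ring.
  by apply: ler_wpM2r; [exact: ltW | apply: ler_wpM2r].
have ratio0 : 0 <= Num.sqrt q * L / ((2 + e) * s).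
  by apply: divr_ge0; [apply: mulr_ge0; [exact: sqrtr_ge0 | exact: ltW] | exact: ltW].
have powr : (Num.sqrt q * L / ((2 + e) * s)) ^+ k.*2 <= expR (- (d%:R + 4) * l).
  apply: (@le_trans _ _ (rho ^+ k.*2)).
    by apply: lerXn2r => //; rewrite nnegrE ltW.
  rewrite -{1}(lnK (rho0 : rho \is Num.pos)) -expRM_natr ler_expR -/K KE.
  apply: (@le_trans _ _ (ln rho * (2 * (C * l)))).
    by rewrite ler_nM2l //; lra.
  have -> : ln rho * (2 * (C * l)) = (- (d%:R + 4) + 2 * ln rho) * l.
    by rewrite /C; field; rewrite lt_eqF.
  by apply: ler_wpM2r; [exact: ltW | rewrite gerDl pmulr_rle0 // ltW].
have N_le : #|{: cells n d}|%:R <= expR (d%:R * l).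
  by rewrite expR_ln_natX // card_cells -natrX ler_nat bin_le_expn.
have two : 2 <= expR l.
  rewrite lnK ?posrE // ler_nat; move: dn d_gt0; clear; lia.
rewrite -(expR_ln_natX 2 n_gt0) -expRN.
by apply: combine_exponents powr; rewrite ?expR_ge0 ?exprn_ge0.
Qed.

End Asymptotics.
Section EventualBounds.
Variable R : realType.

Lemma near_ln_ge (c : R) : \forall n \near \oo, c <= ln n%:R.
Proof.
have := nbhs_infty_ger (expR c); apply: filterS => n cn.
by rewrite -[leLHS]expRK ler_ln // posrE ?expR_gt0 // (lt_le_trans (expR_gt0 c)).
Qed.

(** For l = ln n we have n = exp(l / 12)^12, which is at least (l / 12)^12. *)
Lemma near_ln_pow_le_sqrt (c : R) : 0 <= c ->
  \forall n \near \oo, c * ln n%:R ^+ 5 <= Num.sqrt n%:R.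
Proof.
move=> c0; have := near_ln_ge (1 + c * 12 ^+ 6); apply: filterS => n.
have [->|n_gt0] := posnP n.
  by rewrite ln0 // => H; have := mulr_ge0 c0 (exprn_ge0 6 (ler0n R 12)); lra.
set l := ln n%:R => lc.
have l0 : 0 < l by apply: lt_le_trans lc; have := mulr_ge0 c0 (exprn_ge0 6 (ler0n R 12)); lra.
have sq : (l / 12) ^+ 6 <= Num.sqrt n%:R.
  have lp : 0 <= (l / 12) ^+ 6 by rewrite exprn_ge0 // divr_ge0 // ltW.
  rewrite -[leLHS](ger0_norm lp) -sqrtr_sqr ler_sqrt // -exprM.
  have -> : n%:R = expR (l / 12) ^+ 12 :> R.
    by rewrite -expRM_natr divfK // lnK // posrE ltr0n.
  apply: lerXn2r; rewrite ?nnegrE ?expR_ge0 ?divr_ge0 ?(ltW l0) //.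
  by apply: le_trans (expR_ge1Dx _); lra.
apply: le_trans sq; rewrite expr_div_n ler_pdivlMr ?exprn_gt0 // mulrAC [leRHS]exprS.
by apply: ler_wpM2r; [rewrite exprn_ge0 // ltW | lra].
Qed.

End EventualBounds.
(** The matrix of the adjacency operator is the sum of the blocks of the cells
    that are present. *)
Lemma LM_spectrum (R : realType) (d n : nat) (p h : R) (u : {fset nat} -> R) :
  (1 < d)%N -> (0 < n)%N -> 0 <= p ->
  qform_le (centered_sum (@simplex_mx R n d) p
    [ffun t : cells n d.+1 => u (vertex_labels (val t)) <= p]) h ->
  exists s : seq R,
    sorted_spectrum (adjacency R (LM_complex d n p u) d) (forms R (LM_complex d n p u) d) s /\
    {in take 'C(n.-1, d) s, forall a, - (p * d%:R) - h <= a <= - (p * d%:R) + h}.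
Proof.
move=> d1 n0 p0 Hh; have [s [s1 s2 s3 s4]] := cells_spectrum (ltnW d1) n0 p0 Hh.
exists s; split=> //; apply: sorted_spectrum_mx => // [r rd|a].
  by rewrite inE rd leqnn.
rewrite s3; congr (\rank (eigenspace _ a)); apply: eq_bigr => t _.
by rewrite ffunE inE card_cell eqxx ltnn.
Qed.

Lemma sub_open_interval (R : realType) (I : set R) : open I -> is_interval I ->
  `[-2, 2] `<=` I -> exists2 e : R, 0 < e &
    forall x, - (2 + 2 * e) <= x <= 2 + 2 * e -> I x.
Proof.
move=> oI iI sI.
have I2 : I 2 by apply: sI; rewrite /= in_itv /=; apply/andP; split; lra.
have Im2 : I (-2) by apply: sI; rewrite /= in_itv /=; apply/andP; split; lra.
have near_in (y : R) : I y -> exists2 r : R, 0 < r & forall x, `|y - x| < r -> I x.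
  by move=> Iy; have /nbhs_ballP[r /= r0 rI] := open_nbhs_nbhs (conj oI Iy); exists r.
have [r r0 rI] := near_in _ I2; have [r' r'0 r'I] := near_in _ Im2.
pose e := Num.min r r' / 4.
have m0 : 0 < Num.min r r' by rewrite lt_min r0.
have [m1 m2] : Num.min r r' <= r /\ Num.min r r' <= r' by rewrite !ge_min !lexx orbT.
exists e => [|x /andP[x1 x2]]; first by rewrite /e; lra.
apply: (iI (- (2 + 2 * e)) (2 + 2 * e)); last by rewrite x1.
  by apply: r'I; rewrite ger0_norm /e; lra.
by apply: rI; rewrite ler0_norm /e; lra.
Qed.

Theorem corollary2p4 (R : realType) (disp : measure_display)
    (Om : measurableType disp) (P : probability Om R)
    (d : nat) (hd : (2 <= d)%N)
    (I : set R) (I_open : open I) (I_itv : is_interval I)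
    (I_sub : `[-2, 2] `<=` I)
    (p : nat -> R) (hp : forall n, 0 <= p n <= 1)
    (U : {fset nat} -> {RV P >-> R})
    (U_unif : forall (tau : {fset nat}) (B : set R),
      (#|` tau| = d.+1)%N -> 0%N \notin tau -> measurable B ->
      P (U tau @^-1` B) = uniform_prob (@ltr01 R) B)
    (U_indep : mutually_independent (J := {fset nat})
      [set tau | (#|` tau| = d.+1)%N /\ 0%N \notin tau] U) :
  let q n := p n * (1 - p n) in
  (n%:R * q n / ln n%:R ^+ 4 @[n --> \oo] --> +oo) ->
  {ae P, forall w, \forall n \near \oo,
    let X := LM_complex d n (p n) (fun tau => U tau w) in
    exists s : seq R,
      sorted_spectrum (adjacency R X d) (forms R X d) s /\
      {in take 'C(n.-1, d) s, forall a,
        [set Num.sqrt (d%:R * n%:R * q n) * x | x in I] a}}.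
Proof.
move=> q q_large.
have [e e0 eI] := sub_open_interval I_open I_itv I_sub.
have d_gt0 : (0 < d)%N by exact: ltnW.
have dR0 : 0 < d%:R :> R by rewrite ltr0n.
have [c1 [c2 [c10 c20 small]]] := bad_event_small d_gt0 e0.
pose h n := (2 + e) * Num.sqrt (d%:R * n%:R * q n).
pose bad n (w : {ffun cells n d.+1 -> bool}) :=
  ~~ `[< qform_le (centered_sum (@simplex_mx R n d) (p n) w) (h n) >].
pose E n := [set w : Om | bad n (present d n U (p n) w)].
pose good n := [/\ (2 * d <= n)%N /\ 0 < p n < 1, 1 <= ln n%:R :> R,
   c1 * ln n%:R ^+ 4 <= n%:R * (p n * (1 - p n)),
   c2 * ln n%:R ^+ 5 <= Num.sqrt n%:R & d%:R / e ^+ 2 <= n%:R * q n].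
have near_good : \forall n \near \oo, good n.
  have A0 : 0 < d%:R / e ^+ 2 by rewrite divr_gt0 ?exprn_gt0.
  have H1 : \forall n \near \oo, c1 + d%:R / e ^+ 2 <= n%:R * q n / ln n%:R ^+ 4.
    by move/cvgryPge: q_large; exact.
  have H2 := near_ln_ge (1 : R).
  have H3 := near_ln_pow_le_sqrt (ltW c20).
  have H4 := nbhs_infty_ge (2 * d)%N.
  near=> n.
  have h1 : c1 + d%:R / e ^+ 2 <= n%:R * q n / ln n%:R ^+ 4 by near: n.
  have h2 : 1 <= ln n%:R :> R by near: n.
  have l1 : 1 <= ln n%:R ^+ 4 :> R by rewrite exprn_ege1.
  move: h1; rewrite ler_pdivlMr ?(lt_le_trans ltr01) // => h1.
  have cl : c1 * ln n%:R ^+ 4 <= n%:R * q n.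
    by apply: le_trans h1; apply: ler_wpM2r; [exact: le_trans l1 | lra].
  have dl : d%:R / e ^+ 2 <= n%:R * q n.
    apply: le_trans h1; apply: (@le_trans _ _ (c1 + d%:R / e ^+ 2)); first by lra.
    by rewrite ler_peMr //; lra.
  have n_gt0 : (0 < n)%N.
    by apply: (@leq_trans (2 * d)); [rewrite muln_gt0 | near: n].
  have q0 : 0 < q n.
    have : 0 < n%:R * q n by apply: lt_le_trans dl.
    by rewrite pmulr_rgt0 // ltr0n.
  split=> //; [split; first by near: n | by near: n].
  have /andP[p0 p1] := hp n.
  rewrite !lt_def p0 p1 !andbT; apply/andP; split.
    by apply: contraTneq q0 => pn; rewrite /q pn mul0r ltxx.
  by apply: contraTneq q0 => pn; rewrite /q -pn subrr mulr0 ltxx.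
have [n0 _ Hn0] := near_good.
have mE n : measurable (E n) by case: (present_event U_unif U_indep (hp n) (bad n)).
have PE n : (n0 <= n)%N -> (P (E n) <= ((n%:R ^+ 2)^-1)%:E)%E.
  move=> /Hn0 [[g1 g2] g3 g4 g5 _].
  have [_ ->] := present_event U_unif U_indep (hp n) (bad n).
  by rewrite lee_fin; exact: (small n (p n) g1 g2 g3 g4 g5).
have := eventually_avoids mE PE; apply: filterS => w avoid.
near=> n.
have [[g1 /andP[p0 p1]] g3 g4 g5 g6] : good n by near: n.
have avoid_n : ~ E n w by near: n.
have n_gt0 : (0 < n)%N by apply: leq_trans g1; rewrite muln_gt0.
have Hq : qform_le (centered_sum (@simplex_mx R n d) (p n)
    [ffun t : cells n d.+1 => U (vertex_labels (val t)) w <= p n]) (h n).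
  by move/negP/negPn/asboolP: avoid_n.
have [s [s1 s2]] := @LM_spectrum R d n (p n) (h n) (fun tau => U tau w) hd n_gt0 (ltW p0) Hq.
exists s; split=> // a /s2 /andP[a1 a2] /=.
pose t := Num.sqrt (d%:R * n%:R * q n).
have nq0 : 0 < n%:R * q n by apply: lt_le_trans g6; rewrite divr_gt0 ?exprn_gt0.
have t0 : 0 < t by rewrite sqrtr_gt0 -mulrA mulr_gt0.
have et : d%:R <= e * t.
  rewrite -ler_pdivrMl // mulrC.
  have de0 : 0 <= d%:R / e by rewrite divr_ge0 // ltW.
  rewrite -[leLHS](ger0_norm de0) -sqrtr_sqr ler_sqrt; last by rewrite -mulrA mulr_ge0 // ltW.
  rewrite -mulrA expr_div_n expr2 -mulrA ler_pM2l //.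
have pd : p n * d%:R <= e * t.
  by apply: le_trans et; rewrite ler_piMl // ltW.
have pd0 : 0 <= p n * d%:R by rewrite mulr_ge0 // ltW.
have hE : h n = (2 + e) * t by [].
exists (a / t); last by rewrite mulrC divfK // gt_eqF.
apply: eI; rewrite ler_pdivlMr // ler_pdivrMr //.
by move: a1 a2; rewrite hE => a1 a2; apply/andP; split; lra.
Unshelve. all: by end_near.
Qed.
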